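(* Let $k\geqslant 2$, $2\leqslant d_1\leqslant\dots\leqslant d_k$ and $M=d_1+\dots+d_k-k$. If $M\geqslant 3k+4$, then there exists a non-empty Zariski open subset $\mathcal F_{\rm reg}(d_1,\dots,d_k)\subset\mathcal F(d_1,\dots,d_k)$ such that every $V\in\mathcal F_{\rm reg}(d_1,\dots,d_k)$ is regular.
   Context: $\mathcal F(d_1,\dots,d_k)$ is the family of non-singular complete intersections $V=F_1\cap\dots\cap F_k\subset\mathbb P^{M+k}$ over $\mathbb C$, $\deg F_i=d_i$. For $o\in V$, take affine coordinates $z_1,\dots,z_{M+k}$ centred at $o$ and write the equation of $F_i$ as $f_i=q_{i,1}+\dots+q_{i,d_i}$ with $q_{i,j}$ homogeneous of degree $j$; $T_oV=\{q_{1,1}=\dots=q_{k,1}=0\}$ (codimension $k$). Let $I=\{(i,j):1\leqslant i\leqslant k,1\leqslant j\leqslant d_i\}\setminus\{(k,d_k),(k-1,d_{k-1})\}$ if $d_{k-1}=d_k$, and $I=\{(i,j):1\leqslant i\leqslant k,1\leqslant j\leqslant d_i\}\setminus\{(k,d_k),(k,d_k-1)\}$ if $d_{k-1}\leqslant d_k-1$. $V$ is regular at $o$ if for every linear form $l(z)$ not vanishing identically on $T_oV$, the system of equations $l=0$, $q_{i,j}=0$ for $(i,j)\in I$, defines a subset of $\mathbb C^{M+k}$ of codimension $\#I+1$ (equivalently, $\{l\}\cup\{q_{i,j}:(i,j)\in I\}$ is a regular sequence in $\mathcal O_{o,\mathbb P}$). $V$ is regular if it is regular at every point. *)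

(* Defs.v *)
From HB Require Import structures.
From mathcomp Require Import all_boot all_order all_algebra.
From mathcomp Require Import Rstruct.
From mathcomp Require Import complex.
From mathcomp Require Import mpoly.
From Stdlib Require Rdefinitions.

Set Implicit Arguments.
Unset Strict Implicit.
Unset Printing Implicit Defensive.

Import Order.TTheory GRing.Theory Num.Theory.
Local Open Scope ring_scope.

Definition C : Type := complex Rdefinitions.R.
HB.instance Definition _ := GRing.Field.on C.

Definition zset (n : nat) (S : {mpoly C[n]} -> Prop) : ('I_n -> C) -> Prop :=
  fun v => forall p, S p -> p.@[v] = 0.

Definition subs (n : nat) (Z1 Z2 : ('I_n -> C) -> Prop) : Prop :=
  forall v, Z1 v -> Z2 v.

Definition zclosed (n : nat) (Z : ('I_n -> C) -> Prop) : Prop :=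
  exists S : {mpoly C[n]} -> Prop, forall v, Z v <-> zset S v.

Definition zirreducible (n : nat) (Z : ('I_n -> C) -> Prop) : Prop :=
  [/\ zclosed Z, exists v, Z v &
      forall Z1 Z2, zclosed Z1 -> zclosed Z2 ->
        subs Z (fun v => Z1 v \/ Z2 v) -> subs Z Z1 \/ subs Z Z2].

Definition dim_ge (n : nat) (Z : ('I_n -> C) -> Prop) (e : nat) : Prop :=
  exists Y : nat -> ('I_n -> C) -> Prop,
    [/\ forall i, (i <= e)%N -> zirreducible (Y i),
        forall i, (i < e)%N -> subs (Y i) (Y i.+1) /\ exists v, Y i.+1 v /\ ~ Y i v
      & subs (Y e) Z].

Definition has_dim (n : nat) (Z : ('I_n -> C) -> Prop) (e : nat) : Prop :=
  dim_ge Z e /\ ~ dim_ge Z e.+1.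

Definition has_codim (n : nat) (Z : ('I_n -> C) -> Prop) (c : nat) : Prop :=
  (c <= n)%N /\ has_dim Z (n - c).

Section CI.
Variables (N k : nat) (d : 'I_k -> nat).

Definition nonzero_pt (x : 'I_N.+1 -> C) : Prop := exists t, x t != 0.

Definition on_V (F : 'I_k -> {mpoly C[N.+1]}) (x : 'I_N.+1 -> C) : Prop :=
  forall i, (F i).@[x] = 0.

(* non-singular complete intersection: the Jacobian matrix has rank k at
   every point of V (points of V = non-zero points of the affine cone). *)
Definition nonsingular_ci (F : 'I_k -> {mpoly C[N.+1]}) : Prop :=
  forall x, nonzero_pt x -> on_V F x ->
    \rank (\matrix_(i < k, t < N.+1) ((F i)^`M(t)).@[x]) = k.

Definition in_family (F : 'I_k -> {mpoly C[N.+1]}) : Prop :=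
  (forall i, F i \is (d i).-homog) /\ nonsingular_ci F.

(* affine chart at the point [x]: x_j <> 0, x normalised so that x_j = 1,
   affine coordinates z (the coordinates x_t / x_j - x_t/x_j(o), t <> j). *)
Definition chart_idx (x : 'I_N.+1 -> C) : 'I_N.+1 :=
  odflt ord0 [pick t | x t != 0].

Definition chart_subst (x : 'I_N.+1 -> C) : N.+1.-tuple {mpoly C[N]} :=
  let j := chart_idx x in
  [tuple (x t / x j)%:MP +
         (if unlift j t is Some s then 'X_s else 0) | t < N.+1].

Definition aff_eq (F : 'I_k -> {mpoly C[N.+1]}) (x : 'I_N.+1 -> C) (i : 'I_k)
  : {mpoly C[N]} := F i \mPo chart_subst x.

Definition hpart (n : nat) (e : nat) (p : {mpoly C[n]}) : {mpoly C[n]} :=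
  \sum_(m <- msupp p | mdeg m == e) p@_m *: 'X_[m].

(* the index set I (indices i are 0-based: i = k.-1 is the paper's k,
   i = k.-2 is the paper's k-1) *)
Definition is_last (i : 'I_k) : bool := (i : nat) == k.-1.
Definition is_prev (i : 'I_k) : bool := (i : nat) == k.-2.

Definition top_equal : bool :=
  [exists i : 'I_k, exists i' : 'I_k, [&& is_last i, is_prev i' & d i == d i']].

Definition removed (i : 'I_k) (j : nat) : bool :=
  if top_equal then (is_last i || is_prev i) && (j == d i)
  else is_last i && ((j == d i) || (j == (d i).-1)).

Definition inI (i : 'I_k) (j : nat) : bool :=
  [&& (1 <= j)%N, (j <= d i)%N & ~~ removed i j].

Definition Ibound : nat := (\sum_(i < k) d i).+1.

Definition card_I : nat := #|[set ij : 'I_k * 'I_Ibound | inI ij.1 ij.2]|.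

Definition regular_at (F : 'I_k -> {mpoly C[N.+1]}) (x : 'I_N.+1 -> C) : Prop :=
  let q := fun i j => hpart j (aff_eq F x i) in
  let T := fun v : 'I_N -> C => forall i, (q i 1%N).@[v] = 0 in
  forall l : {mpoly C[N]}, l \is 1.-homog ->
    (exists v, T v /\ l.@[v] != 0) ->
    has_codim (zset (fun p => p = l \/ exists i j, inI i j /\ p = q i j))
              card_I.+1.

Definition regular (F : 'I_k -> {mpoly C[N.+1]}) : Prop :=
  forall x, nonzero_pt x -> on_V F x -> regular_at F x.

Definition coef_idx : finType := ('I_k * 'X_{1..N.+1 < Ibound})%type.
Definition ncoef : nat := #|{: coef_idx}|.

Definition coefs (F : 'I_k -> {mpoly C[N.+1]}) : 'I_ncoef -> C :=
  fun t => let ij := enum_val t in (F ij.1)@_(bmnm ij.2).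

(* the Zariski open set of the parameter space: complement of the common
   zero set of a set S of polynomial functions of the coefficients *)
Definition in_open (S : {mpoly C[ncoef]} -> Prop) (F : 'I_k -> {mpoly C[N.+1]}) : Prop :=
  exists s, S s /\ s.@[coefs F] != 0.

End CI.

Definition Mdim (k : nat) (d : 'I_k -> nat) : nat := (\sum_(i < k) d i - k)%N.

(* Main.v *)
(* The coefficients of a generic system F are algebraically independent over
   Q, so F cannot be recovered from fewer parameters than its number of
   coefficients. Let x be a point of V and l a linear form not vanishing on
   T_x V such that {l = q_{i,j} = 0, (i,j) in I} has dimension > 1; cutting it
   by a hyperplane that is generic over F, x and l gives a zero y of l and the
   q_{i,j} which is not algebraic over K = Q(F, x). Then F is determined by
   x, by the linear span of y over K, and by the local coefficients of the
   q_{i,j}, which satisfy linear relations at y. A block q_{i,j} either lowers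
   the transcendence degree of y over what precedes it, or satisfies as many
   independent relations as there are monomials of degree j in y that are
   independent over K: more than the dimension b + 1 of the span if y has
   transcendence degree at least 2, and at least j b + 1 if it has degree 1 (by
   orders of vanishing along a curve). With M >= 3k + 4 this is more than the
   parameters (x, span of y) can provide. The same count shows that V is
   non-singular.

   Regularity is a first-order condition on F, so by quantifier elimination it
   holds, or fails, on a non-empty open set; genericity excludes the latter.
   Algebraic dependence is expressed by derivations of C. *)

(* Write B for the dimension of the span of y over K. The point and the span cost N + (N - B) B
   parameters; the k vanishing constant terms and the k linear blocks give back at least k + k B, so
   the M - 2 blocks of I of degree at least 2 may gain at most M + (M - B) B in total. Blocks that
   lower the transcendence degree of y need not gain anything, but they are few, since this degree
   is below B after the linear blocks. The form l is not charged to the budget, because F is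
   recovered without it; it serves in the curve case as one more equation on the span, giving B < M.
   The bound M >= 3k + 4 makes most blocks have degree at least 3. The tight case is B = M - 1 with
   only quadrics gaining: there the order count 2(B - 1) + 1 is too small. But then every higher
   block lowers the degree of y, which is therefore still large after the quadrics, and the gain is
   at least the number of quadratic monomials in that many independent coordinates. *)
Require Import Defs.
From HB Require Import structures.
From mathcomp Require Import all_boot all_order all_algebra.
From mathcomp Require Import mpoly.
From mathcomp Require Import boolp.
From mathcomp Require classical_sets.
From mathcomp Require Import closed_field Rstruct complex.
From mathcomp Require Import ring lra zify.
From Stdlib Require Raxioms.

Set Implicit Arguments.
Unset Strict Implicit.
Unset Printing Implicit Defensive.

Import Order.TTheory GRing.Theory Num.Theory.
Local Open Scope ring_scope.

(** * Closure and rank from derivations *)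

Section Derivations.
Variable K : fieldType.
Implicit Types (D : K -> K) (A B s t : seq K) (z w : K).

Definition derivation D :=
  (forall a b, D (a + b) = D a + D b) /\
  (forall a b, D (a * b) = D a * b + a * D b).

Definition der_over A D := derivation D /\ forall a, a \in A -> D a = 0.

(* In characteristic 0 this is the algebraic closure of Q(A), and [rk A s] is
   the transcendence degree of s over Q(A); defining them by derivations makes
   the exchange property immediate. *)
Definition cl A z := forall D, der_over A D -> D z = 0.

Lemma derD D : derivation D -> {morph D : a b / a + b}.
Proof. by case. Qed.

Lemma derM D a b : derivation D -> D (a * b) = D a * b + a * D b.
Proof. by case. Qed.

Lemma der0 D : derivation D -> D 0 = 0.
Proof. by move=> [hD _]; apply: (addrI (D 0)); rewrite -hD !addr0. Qed.

Lemma der1 D : derivation D -> D 1 = 0.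
Proof.
move=> [_ hM]; have := hM 1 1; rewrite mulr1 mul1r mulr1 => h.
by apply: (addrI (D 1)); rewrite -h addr0.
Qed.

Lemma derN D a : derivation D -> D (- a) = - D a.
Proof.
move=> hD; apply: (addrI (D a)).
by rewrite -(derD hD) !subrr (der0 hD).
Qed.

Lemma der_sum D (I : Type) (r : seq I) (P : pred I) (F : I -> K) :
  derivation D -> D (\sum_(i <- r | P i) F i) = \sum_(i <- r | P i) D (F i).
Proof.
move=> hD; elim/big_rec2: _ => [|i y1 y2 _ <-]; first exact: der0.
by rewrite (derD hD).
Qed.

Lemma derV D a : derivation D -> D a = 0 -> D a^-1 = 0.
Proof.
move=> hD Da; have [->|a0] := eqVneq a 0; first by rewrite invr0 (der0 hD).
have := derM a a^-1 hD; rewrite divff // (der1 hD) Da mul0r add0r.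
by move/esym/eqP; rewrite mulf_eq0 (negPf a0) => /eqP.
Qed.

Lemma derMn D a n : derivation D -> D (a *+ n) = D a *+ n.
Proof.
move=> hD; elim: n => [|n IH]; first by rewrite !mulr0n (der0 hD).
by rewrite !mulrS (derD hD) IH.
Qed.

Lemma derX0 D a n : derivation D -> D a = 0 -> D (a ^+ n) = 0.
Proof.
move=> hD Da; elim: n => [|n IH]; first by rewrite expr0 (der1 hD).
by rewrite exprS (derM _ _ hD) Da IH mul0r mulr0 addr0.
Qed.

Lemma der_nat D n : derivation D -> D n%:R = 0.
Proof. by move=> hD; rewrite (derMn _ _ hD) (der1 hD) mul0rn. Qed.

Lemma derivation_scale D c : derivation D -> derivation (fun z => c * D z).
Proof.
move=> hD; split=> a b; first by rewrite (derD hD) mulrDr.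
by rewrite (derM _ _ hD) mulrDr mulrA mulrCA.
Qed.

Lemma derivation_sub D1 D2 :
  derivation D1 -> derivation D2 -> derivation (fun z => D1 z - D2 z).
Proof.
move=> h1 h2; split=> a b; first by rewrite (derD h1) (derD h2); ring.
by rewrite (derM _ _ h1) (derM _ _ h2); ring.
Qed.

Lemma derivation_bracket D1 D2 :
  derivation D1 -> derivation D2 -> derivation (fun z => D1 (D2 z) - D2 (D1 z)).
Proof.
move=> h1 h2; split=> a b.
  by rewrite (derD h2) (derD h1) (derD h1) (derD h2); ring.
rewrite (derM _ _ h2) (derM _ _ h1) (derD h1) (derD h2).
by rewrite !(derM _ _ h1) !(derM _ _ h2); ring.
Qed.

Lemma der_over_scale A D c : der_over A D -> der_over A (fun z => c * D z).
Proof.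
move=> [hD h]; split; first exact: derivation_scale.
by move=> a aA; rewrite h // mulr0.
Qed.

Lemma cl_mem A z : z \in A -> cl A z.
Proof. by move=> zA D [_]; apply. Qed.

Lemma cl_sub A B z : (forall a, a \in A -> cl B a) -> cl A z -> cl B z.
Proof. by move=> h hz D [hD DB]; apply: hz; split=> // a /h; apply. Qed.

Lemma cl_subset A B z : {subset A <= B} -> cl A z -> cl B z.
Proof. by move=> h; apply: cl_sub => a /h; apply: cl_mem. Qed.

Lemma cl_cons A x z : cl A z -> cl (x :: A) z.
Proof. by apply: cl_subset => a; rewrite inE orbC => ->. Qed.

Lemma clD A a b : cl A a -> cl A b -> cl A (a + b).
Proof. by move=> ha hb D h; rewrite (derD h.1) (ha _ h) (hb _ h) addr0. Qed.

Lemma clM A a b : cl A a -> cl A b -> cl A (a * b).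
Proof.
by move=> ha hb D h; rewrite (derM _ _ h.1) (ha _ h) (hb _ h) mul0r mulr0 addr0.
Qed.

Lemma clN A a : cl A a -> cl A (- a).
Proof. by move=> ha D h; rewrite (derN _ h.1) (ha _ h) oppr0. Qed.

Lemma clB A a b : cl A a -> cl A b -> cl A (a - b).
Proof. by move=> ha hb; apply: clD => //; apply: clN. Qed.

Lemma clV A a : cl A a -> cl A a^-1.
Proof. by move=> ha D h; apply: derV h.1 (ha _ h). Qed.

Lemma cl0 A : cl A 0.
Proof. by move=> D [hD _]; exact: der0. Qed.

Lemma cl1 A : cl A 1.
Proof. by move=> D [hD _]; exact: der1. Qed.

Lemma clX A a n : cl A a -> cl A (a ^+ n).
Proof. by move=> ha D h; apply: derX0 h.1 (ha _ h). Qed.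

Lemma cl_sum A (I : Type) (r : seq I) (P : pred I) (F : I -> K) :
  (forall i, P i -> cl A (F i)) -> cl A (\sum_(i <- r | P i) F i).
Proof. by move=> h; apply: big_rec => [|i x Pi hx]; [exact: cl0|apply: clD => //; exact: h]. Qed.

Lemma cl_prod A (I : Type) (r : seq I) (P : pred I) (F : I -> K) :
  (forall i, P i -> cl A (F i)) -> cl A (\prod_(i <- r | P i) F i).
Proof. by move=> h; apply: big_rec => [|i x Pi hx]; [exact: cl1|apply: clM => //; exact: h]. Qed.

Lemma ncl_der A z : ~ cl A z -> exists2 D, der_over A D & D z = 1.
Proof.
move=> /existsNP [D] /not_implyP [hD] /eqP Dz.
exists (fun x => (D z)^-1 * D x); first exact: der_over_scale.
by rewrite mulVf.
Qed.

(** If [D] is a derivation over A with [D z = 1], then [D x] is nonzero. Subtracting from [D'] the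
    multiple of [D] that cancels its value at x gives a derivation over [x :: A]; it must vanish at
    z, which forces [D' x = 0]. *)
Lemma cl_exchange A x z : cl (x :: A) z -> ~ cl A z -> cl (z :: A) x.
Proof.
move=> hz /ncl_der [D hD Dz] D' [hD' D'A].
have Dx : D x != 0.
  apply/eqP => Dx; have := hz D; rewrite Dz => h.
  suff /h /eqP : der_over (x :: A) D by rewrite oner_eq0.
  by case: hD => hD DA; split=> // a; rewrite inE => /orP [/eqP->|/DA].
have h : der_over (x :: A) (fun a => D' a - (D' x / D x) * D a).
  case: hD => hD DA; split.
    by apply: derivation_sub => //; apply: derivation_scale.
  move=> a; rewrite inE => /orP [/eqP->|aA]; first by rewrite divfK ?subrr.
  by rewrite (D'A a) ?inE ?aA ?orbT // (DA a aA) mulr0 subrr.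
have := hz _ h; rewrite Dz D'A ?inE ?eqxx // sub0r mulr1 => /eqP.
by rewrite oppr_eq0 mulf_eq0 invr_eq0 (negPf Dx) orbF => /eqP.
Qed.

Fixpoint rk A s : nat :=
  if s is z :: s' then (~~ `[< cl A z >] + rk (z :: A) s')%N else 0%N.

Lemma rk_size A s : (rk A s <= size s)%N.
Proof. by elim: s A => //= z s IH A; rewrite -add1n leq_add //; case: asbool. Qed.

Lemma rk_anti A B s : (forall a, a \in A -> cl B a) -> (rk B s <= rk A s)%N.
Proof.
elim: s A B => //= z s IH A B h; apply: leq_add.
  case: (asboolP (cl A z)) => [hz|_]; last by case: asbool.
  by rewrite (_ : `[< cl B z >]) //; apply/asboolP; apply: cl_sub hz.
apply: IH => a; rewrite inE => /orP [/eqP->|/h]; last exact: cl_cons.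
by apply: cl_mem; rewrite inE eqxx.
Qed.

Lemma rk_eq A B s : (forall a, a \in A -> cl B a) ->
  (forall a, a \in B -> cl A a) -> rk A s = rk B s.
Proof. by move=> h1 h2; apply/eqP; rewrite eqn_leq !rk_anti. Qed.

Lemma rk_mem A B s : A =i B -> rk A s = rk B s.
Proof. by move=> h; apply: rk_eq => a; rewrite ?h -?h => ?; apply: cl_mem; rewrite ?h -?h. Qed.

Lemma rk_cl0 A s : (forall a, a \in s -> cl A a) -> rk A s = 0%N.
Proof.
elim: s A => //= z s IH A h.
rewrite (_ : `[< cl A z >]) ?IH //; first by move=> a zs; apply/cl_cons/h; rewrite inE zs orbT.
by apply/asboolP/h; rewrite inE eqxx.
Qed.

Lemma rk0_cl A s a : rk A s = 0%N -> a \in s -> cl A a.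
Proof.
elim: s A => //= z s IH A /eqP; rewrite addn_eq0 eqb0 negbK => /andP [/asboolP hz /eqP h].
rewrite inE => /orP [/eqP-> //|/(IH _ h)]; apply: cl_sub => b.
by rewrite inE => /orP [/eqP->//|]; apply: cl_mem.
Qed.

Lemma rk_cat A s t : rk A (s ++ t) = (rk A s + rk (s ++ A) t)%N.
Proof.
elim: s A => //= z s IH A; rewrite IH addnA; congr (_ + _)%N.
by apply: rk_mem => a; rewrite !(inE, mem_cat) orbCA.
Qed.

Lemma rk_swap A x y s : rk A [:: x, y & s] = rk A [:: y, x & s].
Proof.
rewrite /= !addnA; congr (_ + _)%N; last first.
  by apply: rk_mem => a; rewrite !inE orbCA.
have H u v : cl A u -> `[< cl (v :: A) u >].
  by move=> h; apply/asboolP/cl_cons.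
have [hx|hx] := asboolP (cl A x); have [hy|hy] := asboolP (cl A y).
- by rewrite !H.
- rewrite (H x) //=; suff -> : `[< cl (x :: A) y >] = false by [].
  apply/asboolPn => h; apply: hy; apply: cl_sub h => a.
  by rewrite inE => /orP [/eqP->|/cl_mem].
- rewrite (H y) //=; suff -> : `[< cl (y :: A) x >] = false by [].
  apply/asboolPn => h; apply: hx; apply: cl_sub h => a.
  by rewrite inE => /orP [/eqP->|/cl_mem].
- congr (_ + ~~ _)%N; apply/asbool_equiv_eq; split=> h; exact: cl_exchange.
Qed.

Lemma rk_catC A s t : rk A (s ++ t) = rk A (t ++ s).
Proof.
elim: s A t => [|x s IH] A t; first by rewrite cats0.
have -> : rk A (t ++ x :: s) = rk A (x :: t ++ s).
  by elim: t A => // y t IHt A; rewrite rk_swap [LHS]/= IHt.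
by rewrite /= IH.
Qed.

(** Symmetry of dependence: adjoining s lowers the rank of t exactly as much as adjoining t lowers
    the rank of s. The count rests on this: a block of coefficients that does not lower the rank of
    y is itself free over y. *)
Lemma rk_sym A s t : (rk A s + rk (s ++ A) t)%N = (rk A t + rk (t ++ A) s)%N.
Proof. by rewrite -!rk_cat rk_catC. Qed.

Lemma rk_le_cl A s t : (forall a, a \in s -> cl (t ++ A) a) -> (rk A s <= rk A t)%N.
Proof.
by move=> h; have := rk_sym A s t; rewrite (rk_cl0 h) addn0 => <-; apply: leq_addr.
Qed.

Lemma rk_le_sub A s t : {subset s <= t} -> (rk A s <= rk A t)%N.
Proof. by move=> h; apply: rk_le_cl => a /h at_; apply: cl_mem; rewrite mem_cat at_. Qed.

Lemma rk_eqmem A s t : s =i t -> rk A s = rk A t.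
Proof. by move=> h; apply/eqP; rewrite eqn_leq !rk_le_sub // => a; rewrite h. Qed.

Lemma rk_full A s t : rk A (s ++ t) = size (s ++ t) ->
  rk A s = size s /\ rk (s ++ A) t = size t.
Proof.
rewrite rk_cat size_cat => h; have h1 := rk_size A s; have h2 := rk_size (s ++ A) t.
by lia.
Qed.

(** These derivations act as the partial derivatives with respect to an algebraically independent
    family. *)
Lemma rk_full_dual A (n : nat) (y : 'I_n -> K) (i : 'I_n) :
  rk A (codom y) = n ->
  exists2 D, der_over A D & forall j, D (y j) = (j == i)%:R.
Proof.
move=> hrk; pose s := [seq y j | j <- enum 'I_n & j != i].
have hmem : codom y =i s ++ [:: y i].
  move=> a; rewrite mem_cat inE; apply/codomP/orP => [[j ->]|].
    have [->|ji] := eqVneq j i; [by right|left].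
    by apply: map_f; rewrite mem_filter ji mem_enum.
  by case=> [/mapP [j _ ->]|/eqP->]; [exists j|exists i].
have hs : size s = n.-1.
  rewrite size_map size_filter.
  have := count_predC (pred1 i) (enum 'I_n).
  rewrite count_uniq_mem ?enum_uniq // mem_enum size_enum_ord /= => h.
  by rewrite -[in RHS]h add1n /=; apply: eq_count.
have hn : n = n.-1.+1 by case: (n) (i) => [[]|].
move: hrk; rewrite (rk_eqmem _ hmem) => h.
have h' : rk A (s ++ [:: y i]) = size (s ++ [:: y i]).
  by rewrite h size_cat hs /= addn1 -hn.
have [_ /=] := rk_full h'; rewrite addn0 => /eqP; rewrite eqb1 => /asboolPn.
case/ncl_der => D [hD DA] Dy; exists D.
  by split=> // a aA; apply: DA; rewrite mem_cat aA orbT.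
move=> j; have [->//|ji] := eqVneq j i.
by apply: DA; rewrite mem_cat map_f // mem_filter ji mem_enum.
Qed.

End Derivations.

(** * Extending a derivation from a subring to the whole field *)

Section Extension.
Variable K : fieldType.
Hypothesis char0 : forall n, n.+1%:R != 0 :> K.

(* A subring of K together with a derivation from it to K, presented by its
   graph: equivalently, a subring of the dual numbers meeting the nilpotent
   line trivially.  Zorn's lemma applies directly to such graphs. *)
Definition dgraph (G : K -> K -> Prop) :=
  [/\ G 1 0,
      forall a a' b b', G a a' -> G b b' -> G (a - b) (a' - b'),
      forall a a' b b', G a a' -> G b b' -> G (a * b) (a' * b + a * b') &
      forall w, G 0 w -> w = 0].

Section Step.
Variables (G : K -> K -> Prop) (v : K).
Hypothesis dG : dgraph G.

Let G1 : G 1 0. Proof. by case: dG. Qed.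
Let GB a a' b b' : G a a' -> G b b' -> G (a - b) (a' - b').
Proof. by case: dG => _ h _ _; apply: h. Qed.
Let GM a a' b b' : G a a' -> G b b' -> G (a * b) (a' * b + a * b').
Proof. by case: dG => _ _ h _; apply: h. Qed.
Let GF w : G 0 w -> w = 0. Proof. by case: dG => _ _ _; apply. Qed.
Let G0 : G 0 0. Proof. by have := GB G1 G1; rewrite !subrr. Qed.
Let GN a a' : G a a' -> G (- a) (- a').
Proof. by move=> h; have := GB G0 h; rewrite !sub0r. Qed.
Let GD a a' b b' : G a a' -> G b b' -> G (a + b) (a' + b').
Proof. by move=> h /GN /(GB h); rewrite !opprK. Qed.
Let Gsum (I : Type) (r : seq I) (F F' : I -> K) :
  (forall i, G (F i) (F' i)) -> G (\sum_(i <- r) F i) (\sum_(i <- r) F' i).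
Proof.
move=> h; elim: r => [|i r IH]; first by rewrite !big_nil.
by rewrite !big_cons; apply: GD.
Qed.

(** [P'] lists derivatives of the coefficients of P, so [geval w P P'] is the value that the product
    rule forces on the derivative of P(v) when v has derivative w. *)
Definition glift (P P' : {poly K}) := forall i, G P`_i P'`_i.
Definition geval (w : K) (P P' : {poly K}) := P'.[v] + P^`().[v] * w.

Let liftB P P' Q Q' : glift P P' -> glift Q Q' -> glift (P - Q) (P' - Q').
Proof. by move=> h1 h2 i; rewrite !coefB; apply: GB. Qed.
Let liftM P P' Q Q' : glift P P' -> glift Q Q' -> glift (P * Q) (P' * Q + P * Q').
Proof.
move=> h1 h2 i; rewrite coefD !coefM -big_split /=.
by apply: Gsum => j; apply: GM.
Qed.
Let liftC a a' : G a a' -> glift a%:P a'%:P.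
Proof. by move=> h i; rewrite !coefC; case: eqP. Qed.
Let liftX : glift 'X 0.
Proof.
by move=> i; rewrite coefX coef0; case: eqP.
Qed.
Let liftXn n : glift 'X^n 0.
Proof.
elim: n => [|n IH]; first by apply: (liftC G1).
by rewrite exprS; have := liftM liftX IH; rewrite mul0r mulr0 addr0.
Qed.

Let evalB w P P' Q Q' :
  geval w (P - Q) (P' - Q') = geval w P P' - geval w Q Q'.
Proof. by rewrite /geval derivB !(hornerD, hornerN); ring. Qed.
Let evalM w P P' Q Q' :
  geval w (P * Q) (P' * Q + P * Q') = geval w P P' * Q.[v] + P.[v] * geval w Q Q'.
Proof. by rewrite /geval derivM !(hornerD, hornerM); ring. Qed.

Let gext w a a' := exists P P', [/\ glift P P', a = P.[v] & a' = geval w P P'].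

Let gext_dgraph w :
  (forall P P', glift P P' -> P.[v] = 0 -> geval w P P' = 0) -> dgraph (gext w).
Proof.
move=> hw; split.
- exists 1, 0; split; first exact: (liftC G1).
    by rewrite hornerC.
  by rewrite /geval derivC !horner0 mul0r addr0.
- move=> a a' b b' [P [P' [h1 -> ->]]] [Q [Q' [h2 -> ->]]].
  exists (P - Q), (P' - Q'); split; first exact: liftB.
    by rewrite hornerD hornerN.
  by rewrite evalB.
- move=> a a' b b' [P [P' [h1 -> ->]]] [Q [Q' [h2 -> ->]]].
  exists (P * Q), (P' * Q + P * Q'); split; first exact: liftM.
    by rewrite hornerM.
  by rewrite evalM.
- by move=> w' [P [P' [h1 h2 ->]]]; apply: hw.
Qed.

(** The derivative w of v can be prescribed as soon as every relation P(v) = 0 over the domain has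
    [geval] equal to 0. If v satisfies no nonzero relation, w = 0 works; otherwise a relation Q of
    minimal degree determines w, and the others follow by division by Q. The domain is only a ring,
    hence pseudo-division. *)
Lemma dgraph_extend : exists G', [/\ dgraph G', forall a a', G a a' -> G' a a' &
  exists w, G' v w].
Proof.
suff [w hw] : exists w, forall P P', glift P P' -> P.[v] = 0 -> geval w P P' = 0.
  exists (gext w); split; first exact: gext_dgraph.
    move=> a a' h; exists a%:P, a'%:P; split; first exact: liftC.
      by rewrite hornerC.
    by rewrite /geval derivC !hornerC mul0r addr0.
  exists w, 'X, 0; split=> //; first by rewrite hornerX.
  by rewrite /geval derivX !hornerC mul1r add0r.
pose bad n := exists P P', [/\ glift P P', P.[v] = 0, P != 0 & size P = n].
have zeroP P' w : glift 0 P' -> geval w 0 P' = 0.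
  move=> h; have -> : P' = 0.
    by apply/polyP => i; rewrite coef0; apply: GF; have := h i; rewrite coef0.
  by rewrite /geval deriv0 !horner0 mul0r addr0.
have [[n hn]|nobad] := pselect (exists n, bad n); last first.
  exists 0 => P P' h hP; have [P0|P0] := eqVneq P 0; last first.
    by case: nobad; exists (size P), P, P'.
  by subst P; apply: zeroP.
have [m /asboolP [Q [Q' [lQ Qv Q0 szQ]]] mmin] :=
  ex_minnP (ex_intro (fun n => `[< bad n >]) n (asboolT hn)).
have Qmin P P' : glift P P' -> P.[v] = 0 -> (size P < size Q)%N -> P = 0.
  move=> h1 h2 h3; apply/eqP/negPn/negP => h4.
  suff /mmin : `[< bad (size P) >] by rewrite leqNgt -szQ h3.
  by apply/asboolP; exists P, P'.
have szQ1 : (1 < size Q)%N.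
  rewrite ltnNge; apply/negP => /size1_polyC hQ.
  by move: Qv Q0; rewrite hQ hornerC => ->; rewrite polyC0 eqxx.
(* The formal derivative of Q is again a relation over the domain, as the naturals belong to it with
   derivative 0; it is shorter than Q, and nonzero in characteristic 0. *)
have dQ : Q^`().[v] != 0.
  apply/eqP => h.
  have ldQ : glift Q^`() Q'^`().
    move=> i; rewrite !coef_deriv -(mulr_natr Q`_i.+1) -(mulr_natr Q'`_i.+1).
    have gn k : G k%:R 0.
      by elim: k => // k IH; rewrite -natr1 -[X in G _ X](addr0 0); apply: GD.
    by have := GM (lQ i.+1) (gn i.+1); rewrite mulr0 addr0.
  have szd : (size Q^`() < size Q)%N by apply: lt_size_deriv.
  have /polyP /(_ (size Q).-2) := Qmin _ _ ldQ h szd.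
  rewrite coef_deriv coef0 => /eqP; rewrite -mulr_natr mulf_eq0.
  have -> : (size Q).-2.+1 = (size Q).-1 by case: (size Q) szQ1 => [|[]].
  rewrite -lead_coefE lead_coef_eq0 (negPf Q0) /=.
  by case: (size Q) szQ1 => [|[|k]] //= _; rewrite (negPf (char0 k)).
exists (- Q'.[v] / Q^`().[v]); set w := _ / _.
have evQ : geval w Q Q' = 0 by rewrite /geval /w mulrCA mulfV // mulr1 subrr.
move=> P P'; have [k] := ubnP (size P); elim: k P P' => // k IH P P' szP lP Pv.
have [|lePQ] := ltnP (size P) (size Q).
  by move=> /(Qmin _ _ lP Pv) P0; subst P; apply: zeroP.
(* Cancelling leading terms, [lc P - lp X^i Q] is a shorter relation, whose [geval] is [lc] times
   that of P because Q evaluates to 0. *)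
pose lc := lead_coef Q; pose lc' := Q'`_(size Q).-1.
pose lp := lead_coef P; pose lp' := P'`_(size P).-1.
have Glc : G lc lc' by apply: lQ.
have Glp : G lp lp' by apply: lP.
pose X := ('X^(size P - size Q) : {poly K}).
have l1 := liftM (liftC Glc) lP.
have l2 := liftM (liftM (liftC Glp) (liftXn (size P - size Q))) lQ.
have l3 := liftB l1 l2.
have P0 : P != 0 by apply/eqP => h; move: lePQ; rewrite h size_poly0 leqn0 => /eqP h0; rewrite h0 in szQ1.
have := IH _ _ _ l3.
rewrite evalB !evalM evQ !hornerC !(hornerD, hornerN, hornerM) Pv Qv hornerC.
rewrite !mulr0 !addr0 ?add0r !subr0 ?oppr0 => h.
have /h /(_ erefl) : (size (lc%:P * P - lp%:P * X * Q)%R < k)%N.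
  apply: leq_trans (_ : size P <= k)%N; last exact: szP.
  rewrite (_ : size P = (size P).-1.+1); last by rewrite prednK // size_poly_gt0.
  rewrite ltnS; apply/leq_sizeP => j; rewrite leq_eqVlt => /orP [/eqP <-|hj].
    rewrite coefB coefCM -mulrA coefCM coefXnM.
    have -> : ((size P).-1 < size P - size Q)%N = false.
      by apply/negbTE; rewrite -leqNgt; lia.
    have -> : ((size P).-1 - (size P - size Q) = (size Q).-1)%N by lia.
    by rewrite -!lead_coefE mulrC subrr.
  apply: nth_default; apply: leq_trans (size_polyD _ _) _.
  rewrite size_polyN geq_max; apply/andP; split.
    by rewrite mul_polyC; apply: leq_trans (size_scale_leq _ _) _; lia.
  rewrite -mulrA mul_polyC; apply: leq_trans (size_scale_leq _ _) _.
  rewrite size_monicM ?monicXn // size_polyXn. by move: hj lePQ; rewrite addSn; move: (size P) (size Q) => a b; lia.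
by move/eqP; rewrite mulf_eq0 lead_coef_eq0 (negPf Q0) => /eqP.
Qed.
End Step.

(** A maximal graph given by Zorn's lemma is total, since [dgraph_extend] would enlarge it at any
    missing point; it is single-valued because it meets the line over 0 only in 0. *)
Lemma derivation_extend (G : K -> K -> Prop) : dgraph G ->
  exists2 D, derivation D & forall a a', G a a' -> D a = a'.
Proof.
move=> dG; pose T := {G' : K -> K -> Prop | dgraph G' /\ forall a a', G a a' -> G' a a'}.
pose leT (s t : T) := `[< forall a a', sval s a a' -> sval t a a' >].
pose t0 : T := exist _ G (conj dG (fun a a' h => h)).
have [|||[M [dM GM]] maxM] := @classical_sets.ZL_preorder T t0 leT.
- by move=> t; apply/asboolP.
- by move=> r s t /asboolP h1 /asboolP h2; apply/asboolP => a a' /h1 /h2.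
- move=> A totA; have [[s0 As0]|noA] := pselect (exists s, A s); last first.
    by exists t0 => s As; case: noA; exists s.
  pose U a a' := exists2 s : T, A s & sval s a a'.
  have common s t a a' b b' : A s -> A t -> sval s a a' -> sval t b b' ->
      exists u, [/\ A u, sval u a a' & sval u b b'].
    move=> As At ha hb; case: (totA s t As At) => /asboolP h.
      by exists t; split=> //; apply: h.
    by exists s; split=> //; apply: h.
  have dU : dgraph U.
    split.
    - by exists s0 => //; case: (svalP s0) => [[]].
    - move=> a a' b b' [s As ha] [t At hb].
      have [u [Au ua ub]] := common _ _ _ _ _ _ As At ha hb.
      by exists u => //; case: (svalP u) => [[_ h _ _] _]; apply: h.
    - move=> a a' b b' [s As ha] [t At hb].
      have [u [Au ua ub]] := common _ _ _ _ _ _ As At ha hb.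
      by exists u => //; case: (svalP u) => [[_ _ h _] _]; apply: h.
    - by move=> w [s As]; case: (svalP s) => [[_ _ _ h] _]; apply: h.
  have GU a a' : G a a' -> U a a'.
    by move=> h; exists s0 => //; case: (svalP s0) => _; apply.
  exists (exist _ U (conj dU GU)) => s As; apply/asboolP => a a' h.
  by exists s.
have tot v : exists w, M v w.
  have [G' [dG' MG' [w hw]]] := dgraph_extend v dM.
  have GG' a a' : G a a' -> G' a a' by move=> /GM /MG'.
  have /maxM /asboolP : leT (exist _ M (conj dM GM)) (exist _ G' (conj dG' GG')).
    by apply/asboolP.
  by move=> /= h; exists w; apply: h.
pose D v := sval (cid (tot v)).
have MD v : M v (D v) by rewrite /D; case: cid.
have [M1 MB MM MF] := dM.
have M0 : M 0 0 by have := MB _ _ _ _ M1 M1; rewrite !subrr.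
have uniqM a b b' : M a b -> M a b' -> b = b'.
  move=> h1 h2; apply/eqP; rewrite -subr_eq0; apply/eqP/MF.
  by have := MB _ _ _ _ h1 h2; rewrite subrr.
have MN a b : M a b -> M (- a) (- b).
  by move=> h; have := MB _ _ _ _ M0 h; rewrite !sub0r.
exists D; last by move=> a a' /GM h; apply: uniqM (MD a) h.
split=> a b; apply: uniqM (MD _) _; last exact: MM.
by rewrite -[b in X in M X _]opprK -[D b]opprK; apply: MB => //; apply: MN.
Qed.

End Extension.

(** * Elements transcendental over a finite set *)

Section Transcendence.
Variable K : fieldType.
Hypothesis char0 : forall n, n.+1%:R != 0 :> K.
Hypothesis uncount : forall f : nat -> seq K, exists z, forall n, z \notin f n.

(** Codes for the elements of the subring generated by A: lists of integer coefficients with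
    exponents. The codes form a countable type, so polynomials over this subring can be enumerated
    by [unpickle]. *)
Definition zterm (A : seq K) (m : int * seq nat) : K :=
  m.1%:~R * \prod_(i < size A) A`_i ^+ nth 0%N m.2 i.
Definition zval (A : seq K) (c : seq (int * seq nat)) : K :=
  \sum_(m <- c) zterm A m.

Lemma zval_sub A c1 c2 : exists c, zval A c = zval A c1 - zval A c2.
Proof.
exists (c1 ++ [seq (- m.1, m.2) | m <- c2]).
rewrite /zval big_cat big_map -sumrN; congr (_ + _).
by apply: eq_bigr => m _; rewrite /zterm /= mulrNz mulNr.
Qed.

Lemma zval_mul A c1 c2 : exists c, zval A c = zval A c1 * zval A c2.
Proof.
exists [seq (m1.1 * m2.1, mkseq (fun i => nth 0%N m1.2 i + nth 0%N m2.2 i)%N (size A))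
         | m1 <- c1, m2 <- c2].
rewrite /zval big_allpairs_dep mulr_suml; apply: eq_bigr => m1 _.
rewrite mulr_sumr; apply: eq_bigr => m2 _.
rewrite /zterm /= intrM mulrACA; congr (_ * _); rewrite -big_split /=.
by apply: eq_bigr => i _; rewrite nth_mkseq // exprD.
Qed.

Lemma poly_roots_finite (p : {poly K}) : p != 0 ->
  exists s : seq K, forall z, root p z -> z \in s.
Proof.
have [n] := ubnP (size p); elim: n p => // n IH p szp p0.
have [[a pa]|no] := pselect (exists a, root p a); last first.
  by exists [::] => z pz; case: no; exists z.
have /factor_theorem [q pq] := pa.
have q0 : q != 0 by apply/eqP => h; move: p0; rewrite pq h mul0r eqxx.
have [|s hs] := IH q _ q0.
  by move: szp; rewrite pq size_Mmonic ?monicXsubC // size_XsubC addn2.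
exists (a :: s) => z; rewrite pq rootM root_XsubC inE.
by move=> /orP [/hs ->|->]; rewrite ?orbT.
Qed.

(** Nonzero polynomials over the subring generated by A have countably many roots altogether, so
    some z is a root of none. Then d/dz is well defined on the polynomials in z, and its extension
    to K kills A and sends z to 1. *)
Lemma exists_transcendental (A : seq K) : exists z, ~ cl A z.
Proof.
pose polc (c : seq (seq (int * seq nat))) : {poly K} := Poly (map (zval A) c).
have hroots c : exists s : seq K, polc c != 0 -> forall z, root (polc c) z -> z \in s.
  have [p0|p0] := eqVneq (polc c) 0; first by exists [::].
  by have [s hs] := poly_roots_finite p0; exists s.
pose f n := if unpickle n is Some c then sval (cid (hroots c)) else [::].
have [z hz] := uncount f.
pose E a := exists c, a = zval A c.
have ztr (p : {poly K}) : (forall i, E p`_i) -> p.[z] = 0 -> p = 0.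
  move=> hp pz; pose c := mkseq (fun i => sval (cid (hp i))) (size p).
  have cp : polc c = p.
    apply/polyP => i; rewrite coef_Poly.
    have [h|h] := ltnP i (size p).
      by rewrite (nth_map [::]) ?size_mkseq // nth_mkseq //; case: cid.
    by rewrite !nth_default // size_map size_mkseq.
  apply/eqP/negPn/negP => p0; have := hz (pickle c).
  rewrite /f pickleK; case: cid => s /= hs.
  by rewrite hs // cp //; apply/rootP.
pose G a a' := exists p : {poly K}, [/\ forall i, E p`_i, a = p.[z] & a' = p^`().[z]].
have EB a b : E a -> E b -> E (a - b).
  by move=> [c1 ->] [c2 ->]; have [c hc] := zval_sub A c1 c2; exists c.
have EM a b : E a -> E b -> E (a * b).
  by move=> [c1 ->] [c2 ->]; have [c hc] := zval_mul A c1 c2; exists c.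
have E1 : E 1.
  exists [:: (1, [::])]; rewrite /zval big_seq1 /zterm big1 ?mulr1 // => i _.
  by rewrite nth_nil expr0.
have E0 : E 0 by rewrite -(subrr 1); apply: EB.
have ED a b : E a -> E b -> E (a + b).
  by move=> ha hb; rewrite -[b]opprK; apply: (EB) => //; rewrite -sub0r; exact: EB.
have Esum (I : Type) (r : seq I) (F : I -> K) : (forall i, E (F i)) -> E (\sum_(i <- r) F i).
  by move=> h; apply: big_rec => // i x _; apply: ED.
have dG : dgraph G.
  split.
  - exists 1; split; [ | by rewrite hornerC | by rewrite derivC horner0].
    by move=> i; rewrite coef1; case: eqP.
  - move=> a a' b b' [p [hp -> ->]] [q [hq -> ->]]; exists (p - q); split.
    + by move=> i; rewrite coefB; apply: EB.
    + by rewrite hornerD hornerN.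
    + by rewrite derivB hornerD hornerN.
  - move=> a a' b b' [p [hp -> ->]] [q [hq -> ->]]; exists (p * q); split.
    + by move=> i; rewrite coefM; apply: Esum => j; apply: EM.
    + by rewrite hornerM.
    + by rewrite derivM hornerD !hornerM.
  - by move=> w [p [hp /esym h ->]]; rewrite (ztr _ hp h) deriv0 horner0.
have [D hD DG] := derivation_extend char0 dG.
exists z => hz'; suff h : der_over A D.
  move: (hz' D h) => /eqP; rewrite (DG z 1) ?oner_eq0 //.
  exists 'X; split; [ | by rewrite hornerX | by rewrite derivX hornerC].
  by move=> i; rewrite coefX; case: eqP.
split=> // a aA; apply: DG; exists a%:P; split; [ | by rewrite hornerC | by rewrite derivC horner0].
move=> i; rewrite coefC; case: eqP => // _.
exists [:: (1, mkseq (fun j => (j == index a A) : nat) (size A))].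
have ha : (index a A < size A)%N by rewrite index_mem.
rewrite /zval big_seq1 /zterm mul1r (bigD1 (Ordinal ha)) //= nth_mkseq // eqxx nth_index //.
rewrite expr1 big1 ?mulr1 // => j hj; rewrite nth_mkseq //.
by rewrite (_ : (j == _ :> nat) = false) ?expr0 //; apply: negbTE; exact: hj.
Qed.

Lemma exists_generic (A : seq K) (n : nat) : exists y : 'I_n -> K, rk A (codom y) = n.
Proof.
suff [s [szs rks]] : exists s, size s = n /\ rk A s = n.
  exists (fun i => s`_i); rewrite -[RHS]rks; congr (rk A _).
  apply: (@eq_from_nth _ 0); rewrite size_codom card_ord // => i hi.
  by rewrite (nth_map (Ordinal hi)) ?size_enum_ord // nth_enum_ord.
elim: n A => [|n IH] A; first by exists [::].
have [z hz] := exists_transcendental A.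
have [s [szs rks]] := IH (z :: A).
by exists (z :: s); rewrite /= szs rks; split=> //; case: asboolP.
Qed.

End Transcendence.

(** * Independence over closed subfields *)

Section Disjointness.
Variable K : fieldType.
Implicit Types (D : K -> K) (A B y cs : seq K).

Definition indep (k : K -> Prop) (T : finType) (S : {set T}) (u : T -> K) :=
  forall c : T -> K, (forall t, t \in S -> k (c t)) ->
    \sum_(t in S) c t * u t = 0 -> forall t, t \in S -> c t = 0.

Definition spanned (k : K -> Prop) (T : finType) (S : {set T}) (u : T -> K) (z : K) :=
  exists2 c : T -> K, forall t, k (c t) & z = \sum_(t in S) c t * u t.

Lemma indep_sub (k k' : K -> Prop) (T : finType) (S : {set T}) (u : T -> K) :
  (forall z, k z -> k' z) -> indep k' S u -> indep k S u.
Proof. by move=> h hi c hc; apply: hi => t /hc; apply: h. Qed.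

Section OneStep.
Variables (B y : seq K) (c : K) (D : K -> K).
Hypotheses (hD : der_over (y ++ B) D) (Dc : D c = 1).

Let DB b : b \in B -> D b = 0.
Proof. by move=> bB; apply: hD.2; rewrite mem_cat bB orbT. Qed.

(** For [D'] over [c :: B], the bracket of [D'] and D also kills B, and it kills c because [D c] is
    the constant 1. *)
Lemma der_cl_stable z : cl (c :: B) z -> cl (c :: B) (D z).
Proof.
move=> hz D' hD'; have [d1 d2] := (hD.1, hD'.1).
have := hz (fun z => D' (D z) - D (D' z)); rewrite (hz D' hD') (der0 d1) subr0; apply.
split; first exact: derivation_bracket.
move=> a; rewrite inE => /orP [/eqP->|aB].
  by rewrite Dc (der1 d2) (hD'.2 c) ?inE ?eqxx // (der0 d1) subrr.
by rewrite DB // (der0 d2) (hD'.2 a) ?inE ?aB ?orbT // (der0 d1) subrr.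
Qed.

(** Subtracting [D2 c] times D from a derivation [D2] over B makes it kill c, without changing its
    value at an element that D kills. *)
Lemma der_cl_descend z : cl (c :: B) z -> D z = 0 -> cl B z.
Proof.
move=> hz Dz D2 [hD2 D2B].
have := hz (fun z => D2 z - D2 c * D z); rewrite Dz mulr0 subr0; apply; split.
  by apply: derivation_sub => //; apply: derivation_scale; case: hD.
move=> a; rewrite inE => /orP [/eqP->|aB]; first by rewrite Dc mulr1 subrr.
by rewrite D2B // DB // mulr0 subrr.
Qed.

(* A relation of minimal support, normalised to have a coefficient 1, is
   killed coefficientwise by D, hence has coefficients in cl B. *)
Lemma indep_adjoin_trans (T : finType) (S : {set T}) (u : T -> K) :
  (forall t, t \in S -> cl (y ++ B) (u t)) ->
  indep (cl B) S u -> indep (cl (c :: B)) S u.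
Proof.
move=> hu hi r; have [n] := ubnP #|[set t in S | r t != 0]|.
elim: n r => // n IH r hn hr rel.
have [s0 /andP [s0S rs0]|none] := pickP [pred t | (t \in S) && (r t != 0)]; last first.
  by move=> t tS; have := none t; rewrite /= tS /= => /negbFE/eqP.
pose r' t := r t / r s0.
have hr' t : t \in S -> cl (c :: B) (r' t).
  by move=> tS; apply: clM; [apply: hr|apply/clV/hr].
have rel' : \sum_(t in S) r' t * u t = 0.
  by rewrite /r'; under eq_bigr do rewrite mulrAC; rewrite -mulr_suml rel mul0r.
have Dr0 t : t \in S -> D (r' t) = 0.
  apply: (IH (fun t => D (r' t))).
  - rewrite -ltnS; apply: leq_trans hn; rewrite ltnS; apply: proper_card.
    apply/properP; split.
      apply/subsetP => x; rewrite !inE => /andP [xS hx]; rewrite xS /=.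
      by apply: contraNneq hx => rx; rewrite /r' rx mul0r (der0 hD.1).
    exists s0; rewrite !inE s0S //= /r' divff // (der1 hD.1) eqxx //.
  - by move=> x xS; apply: der_cl_stable; apply: hr'.
  - have := der_sum (index_enum T) (mem S) (fun t => r' t * u t) hD.1.
    rewrite rel' (der0 hD.1) => e; apply: etrans (esym e).
    by apply: eq_bigr => x xS; rewrite (derM _ _ hD.1) (hu x xS D hD) mulr0 addr0.
have /eqP := hi r' (fun t tS => der_cl_descend (hr' t tS) (Dr0 t tS)) rel' s0 s0S.
by rewrite /r' divff // oner_eq0.
Qed.
End OneStep.

(** Linear disjointness of the closures of [cs ++ B] and [y ++ B] over that of B. Adjoin the
    elements of [cs] one by one: each is algebraic over what precedes, or transcendental even after
    y is adjoined. The equality of ranks excludes the intermediate case. *)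
Lemma indep_adjoin_free (B y cs : seq K) (T : finType) (S : {set T}) (u : T -> K) :
  rk (y ++ B) cs = rk B cs -> (forall t, t \in S -> cl (y ++ B) (u t)) ->
  indep (cl B) S u -> indep (cl (cs ++ B)) S u.
Proof.
elim: cs B => //= c cs IH B hrk hu hi.
have sub1 : {subset c :: y ++ B <= y ++ c :: B}.
  by move=> a; rewrite !(inE, mem_cat) orbCA.
have sub2 : {subset y ++ c :: B <= c :: y ++ B}.
  by move=> a; rewrite !(inE, mem_cat) orbCA.
have e1 : rk (c :: y ++ B) cs = rk (y ++ c :: B) cs.
  by apply: rk_mem => a; apply/idP/idP; [apply: sub1|apply: sub2].
have l1 : (rk (y ++ c :: B) cs <= rk (c :: B) cs)%N.
  by apply: rk_anti => a h; apply: cl_mem; rewrite mem_cat h orbT.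
have mon : cl B c -> cl (y ++ B) c.
  by apply: cl_subset => a h; rewrite mem_cat h orbT.
have hi' : indep (cl (c :: B)) S u.
  have [hc|hc] := asboolP (cl B c).
    apply: indep_sub hi => z; apply: cl_sub => a.
    by rewrite inE => /orP [/eqP->//|/cl_mem].
  have [hc'|hc'] := asboolP (cl (y ++ B) c).
    move: hrk l1; rewrite e1 (asboolT hc') (asboolF hc) /= add0n add1n => ->.
    by rewrite ltnn.
  have [D hD Dc] := ncl_der hc'.
  exact: (indep_adjoin_trans hD Dc).
have hi2 : indep (cl (cs ++ c :: B)) S u.
  apply: IH => //; last first.
    by move=> t /hu; apply: cl_subset => a h; apply: sub1; rewrite inE h orbT.
  move: hrk; rewrite e1.
  have [hc|hc] := asboolP (cl B c); first by rewrite (asboolT (mon hc)) /= !add0n.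
  have [hc'|hc'] := asboolP (cl (y ++ B) c); last by move=> /= /eqP; rewrite eqn_add2l => /eqP.
  by rewrite /= add0n add1n => h; move: l1; rewrite h ltnn.
apply: indep_sub hi2 => z; apply: cl_subset => a.
by rewrite !(inE, mem_cat) orbCA.
Qed.

Lemma indep_set0 k (T : finType) (u : T -> K) : indep k set0 u.
Proof. by move=> c _ _ t; rewrite inE. Qed.

Lemma indep_maximal A (T : finType) (S0 S : {set T}) (u : T -> K) :
  S0 \subset S -> indep (cl A) S0 u ->
  exists S1 : {set T}, [/\ S0 \subset S1, S1 \subset S, indep (cl A) S1 u &
    forall t, t \in S -> spanned (cl A) S1 u (u t)].
Proof.
move=> sub0 hi0; pose P (X : {set T}) := [&& S0 \subset X, X \subset S & `[< indep (cl A) X u >]].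
have P0 : P S0 by rewrite /P subxx sub0; apply/asboolP.
have [S1 /maxsetP [/and3P [h1 h2 /asboolP h3] hmax] _] := maxset_exists P0.
exists S1; split=> // t tS.
have [tS1|tS1] := boolP (t \in S1).
  exists (fun s => (s == t)%:R); first by move=> s; case: eqP => _; [apply: cl1|apply: cl0].
  rewrite (bigD1 t) //= eqxx mul1r big1 ?addr0 // => s /andP [_ /negPf ->].
  by rewrite mul0r.
have : ~ indep (cl A) (t |: S1) u.
  move=> hi; have := hmax (t |: S1).
  rewrite /P (subset_trans h1) ?subsetUr //= subUset sub1set tS h2 /=.
  rewrite (asboolT hi) => /(_ isT isT) e.
  by move: tS1; rewrite -e setU11.
move=> /existsNP [c] /not_implyP [hc] /not_implyP [rel] /existsNP [s] /not_implyP [sS cs].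
have sum1 : \sum_(x in t |: S1) c x * u x = c t * u t + \sum_(x in S1) c x * u x.
  by rewrite big_setU1.
have ct : c t != 0.
  apply/eqP => ct; apply: cs; move: rel; rewrite sum1 ct mul0r add0r => rel.
  move: sS; rewrite in_setU1 => /orP [/eqP->//|]; apply: h3 => // x xS.
  by apply: hc; rewrite in_setU1 xS orbT.
exists (fun x => if x \in S1 then - (c x / c t) else 0).
  move=> x; case: ifP => xS; last exact: cl0.
  by apply: clN; apply: clM; [apply: hc; rewrite in_setU1 xS orbT|apply/clV/hc/setU11].
move: rel; rewrite sum1 => /eqP; rewrite addr_eq0 => /eqP rel.
apply: (mulfI ct); rewrite rel mulr_sumr -sumrN; apply: eq_bigr => x ->.
by rewrite mulrA mulrN mulNr (mulrC (c t)) divfK.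
Qed.

(** Expanding the relation in the basis [S1] gives one equation over the closure of A for every
    element of [S1]. Each expresses a coefficient indexed by [S1] through those outside, so #|S1|
    coefficients add nothing to the rank. *)
Lemma rk_gain A (T : finType) (S S1 : {set T}) (c u : T -> K) :
  S1 \subset S -> (forall t, t \in S -> spanned (cl A) S1 u (u t)) ->
  indep (cl ([seq c t | t in S] ++ A)) S1 u ->
  \sum_(t in S) c t * u t = 0 ->
  (rk A [seq c t | t in S] + #|S1| <= #|S|)%N.
Proof.
move=> sub hsp hi rel.
have /boolp.choice [m hm] : forall t, exists m : T -> K, t \in S ->
    (forall s, cl A (m s)) /\ u t = \sum_(s in S1) m s * u s.
  move=> t; have [/hsp [m h1 h2]|_] := boolP (t \in S); first by exists m.
  by exists (fun=> 0).
set cs := [seq c t | t in S] in hi *.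
pose cs' := [seq c t | t in S :\: S1].
have szcs' : (size cs' + #|S1| = #|S|)%N.
  by rewrite size_map -cardE cardsD (setIidPr sub) subnK // subset_leq_card.
rewrite -szcs' leq_add2r; apply: leq_trans (rk_size A cs').
apply: rk_le_cl => a /imageP [t tS ->].
have [tS1|tS1] := boolP (t \in S1); last first.
  by apply: cl_mem; rewrite mem_cat /cs' image_f // inE tS1.
(* The coefficient of [u s] once the relation is expanded in the basis. *)
pose e s := c s + \sum_(x in S :\: S1) c x * m x s.
have he : forall s, s \in S1 -> e s = 0.
  apply: hi => [s sS1|].
    have sS := subsetP sub _ sS1; apply: clD.
      by apply: cl_mem; rewrite mem_cat /cs image_f.
    apply: cl_sum => x /setDP [xS _]; apply: clM.
      by apply: cl_mem; rewrite mem_cat /cs image_f.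
    by apply: cl_subset ((hm x xS).1 s) => z h; rewrite mem_cat h orbT.
  apply: etrans rel; rewrite [RHS](big_setID S1) /= (setIidPr sub) /e.
  under eq_bigr do rewrite mulrDl; rewrite big_split /=; congr (_ + _).
  under eq_bigr do rewrite mulr_suml; rewrite exchange_big /=.
  apply: eq_bigr => x /setDP [xS _]; rewrite (hm x xS).2 mulr_sumr.
  by apply: eq_bigr => s _; rewrite mulrA.
have /eqP := he t tS1; rewrite addr_eq0 => /eqP ->.
apply: clN; apply: cl_sum => x xS; apply: clM.
  by apply: cl_mem; rewrite mem_cat /cs' image_f.
have /setDP [xS' _] := xS.
by apply: cl_subset ((hm x xS').1 t) => z h; rewrite mem_cat h orbT.
Qed.

End Disjointness.

(** * Derivations and polynomial relations between field elements *)

Section AlgebraicIndependence.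
Variable K : fieldType.
Hypothesis char0 : forall n, n.+1%:R != 0 :> K.
Implicit Types (D : K -> K) (A : seq K).

Lemma der_monomial D (n : nat) (y : 'I_n -> K) (m : 'X_{1..n}) : derivation D ->
  D ('X_[m]).@[y] = \sum_i (('X_[K, m])^`M(i)).@[y] * D (y i).
Proof.
move=> hD; pose E (p : {mpoly K[n]}) := D p.@[y] = \sum_i (p^`M(i)).@[y] * D (y i).
have E1 : E 1.
  rewrite /E meval1 (der1 hD) big1 // => i _.
  by rewrite -mpolyC1 mderivC meval0 mul0r.
have EX i : E 'X_i.
  rewrite /E mevalXU (bigD1 i) //= mderivX mnm1E eqxx scale1r.
  rewrite -{1}[U_(i)%MM]add0m addmK mpolyX0 meval1 mul1r.
  rewrite big1 ?addr0 // => j ji; rewrite mderivX mnm1E (negPf (_ : i != j)).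
    by rewrite scale0r meval0 mul0r.
  by rewrite eq_sym.
have EM p q : E p -> E q -> E (p * q).
  rewrite /E => hp hq; rewrite mevalM (derM _ _ hD) hp hq mulr_suml mulr_sumr -big_split /=.
  by apply: eq_bigr => i _; rewrite mderivM mevalD !mevalM; ring.
suff : E 'X_[m] by [].
rewrite mpolyXE_id; apply: (big_ind E) => // i _.
by elim: (m i) => [|k IH]; rewrite ?expr0 // exprS; apply: EM.
Qed.

Lemma der_meval D (n : nat) (y : 'I_n -> K) (p : {mpoly K[n]}) : derivation D ->
  (forall m, D p@_m = 0) -> D p.@[y] = \sum_i (p^`M(i)).@[y] * D (y i).
Proof.
move=> hD hp; rewrite {1}[p]mpolyE raddf_sum (der_sum _ _ _ hD) /=.
under eq_bigr => m _.
  rewrite mevalZ (derM _ _ hD) hp mul0r add0r (der_monomial _ _ hD) mulr_sumr; over.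
rewrite exchange_big; apply: eq_bigr => i _.
have -> : p^`M(i) = \sum_(m <- msupp p) p@_m *: ('X_[K, m])^`M(i).
  rewrite [in LHS](mpolyE p) linear_sum /=.
  by apply: eq_bigr => m _; rewrite linearZ.
rewrite raddf_sum mulr_suml /=.
by apply: eq_bigr => m _; rewrite mevalZ mulrA.
Qed.

Lemma mderiv0_const (n : nat) (p : {mpoly K[n]}) :
  (forall i, p^`M(i) = 0) -> p = (p@_0%MM)%:MP.
Proof.
move=> h; apply/mpolyP => m; rewrite mcoeffC.
have [->|m0] := eqVneq m 0%MM; first by rewrite mulr1.
rewrite mulr0; have [i mi] : exists i, m i != 0%N.
  apply/existsP; rewrite -negb_forall; apply: contra m0 => /forallP h0.
  by apply/eqP/mnmP => i; rewrite mnm0E; apply/eqP.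
have /mpolyP /(_ (m - U_(i))%MM) := h i.
rewrite mcoeff_mderiv mcoeff0 submK ?lep1mP // => /eqP.
by rewrite -mulr_natr mulf_eq0 (negPf (char0 _)) orbF => /eqP.
Qed.

(** The derivations dual to y turn p(y) = 0 into the vanishing at y of every partial derivative of
    p. By induction on the degree these are zero polynomials, so p is constant, and its value is
    0. *)
Lemma rk_full_free A (n : nat) (y : 'I_n -> K) (p : {mpoly K[n]}) :
  rk A (codom y) = n -> (forall m, cl A p@_m) -> p.@[y] = 0 -> p = 0.
Proof.
move=> hrk; have [k] := ubnP (msize p); elim: k p => // k IH p szp hp py.
have hd i : p^`M(i) = 0.
  have [->|p0] := eqVneq p 0; first by rewrite linear0.
  apply: IH.
  - have szp' : (0 < msize p)%N by rewrite lt0n mmeasure_poly_eq0.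
    apply: leq_trans (_ : msize p <= k)%N; last exact: szp.
    rewrite -(prednK szp') ltnS msizeE; apply/bigmax_leqP_seq => m.
    rewrite mcoeff_msupp mcoeff_mderiv => hm _.
    have : (m + U_(i))%MM \in msupp p.
      by rewrite mcoeff_msupp; apply: contraNneq hm => ->; rewrite mul0rn.
    by move/msize_mdeg_lt; rewrite mdegD mdeg1 addn1; case: (msize p).
  - move=> m; rewrite mcoeff_mderiv -mulr_natr; apply: clM => //.
    by move=> D hD; apply: der_nat; case: hD.
  - have [D hD Dy] := rk_full_dual i hrk.
    have := der_meval y hD.1 (fun m => hp m D hD); rewrite py (der0 hD.1) => /esym.
    rewrite (bigD1 i) //= Dy eqxx mulr1 big1 ?addr0 // => j ji.
    by rewrite Dy (negPf ji) mulr0.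
have e := mderiv0_const hd; move: py; rewrite e mevalC => ->.
by rewrite mpolyC0.
Qed.

Lemma rk_subfamily A (T : finType) (y : T -> K) :
  exists s : 'I_(rk A (codom y)) -> T, rk A (codom (y \o s)) = rk A (codom y).
Proof.
suff [l rkl] : exists l : seq T, rk A (map y l) = rk A (codom y) /\ size l = rk A (codom y).
  have x0 : 'I_(rk A (codom y)) -> T.
    move=> i; case: l rkl => [[_ h]|x _ _]; last exact: x.
    by case: i => m; rewrite -h.
  exists (fun i => nth (x0 i) l i); rewrite -[RHS]rkl.1; congr (rk A _).
  apply: (@eq_from_nth _ 0) => [|i]; first by rewrite size_codom card_ord size_map rkl.2.
  rewrite size_codom card_ord => hi.
  rewrite (nth_map (Ordinal hi)) ?size_enum_ord //= nth_enum_ord //.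
  rewrite (nth_map (x0 (Ordinal hi))) ?rkl.2 //.
  by congr y; apply: set_nth_default; rewrite rkl.2.
rewrite /codom /image_mem; elim: (enum T) A => [|x l IH] A; first by exists [::].
rewrite /=; have [hx|hx] := asboolP (cl A (y x)) => /=.
  rewrite add0n; have [l' [h1 h2]] := IH (y x :: A); exists l'; split=> //.
  rewrite -h1; apply: rk_eq => a; last first.
    by rewrite inE => /orP [/eqP->//|]; apply: cl_mem.
  by move=> h; apply: cl_mem; rewrite inE h orbT.
have [l' [h1 h2]] := IH (y x :: A); exists (x :: l') => /=.
by rewrite (asboolF hx) h1 h2.
Qed.

End AlgebraicIndependence.

(** * Orders of vanishing along a derivation *)

Section Orders.
Variable K : fieldType.
Hypothesis char0 : forall n, n.+1%:R != 0 :> K.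
Variable D : K -> K.
Hypothesis hD : derivation D.
Implicit Types (V W U : K -> Prop).

(* After extension of scalars, the Taylor map z |-> sum_i D^i(z) e^i / i! turns
   a K-combination of members of V into a power series; V has the order s when
   some such series has valuation s. *)
Definition has_order V (s : nat) := exists r : seq (K * K),
  [/\ forall p, p \in r -> V p.2,
      forall i, (i < s)%N -> \sum_(p <- r) p.1 * iter i D p.2 = 0 &
      \sum_(p <- r) p.1 * iter s D p.2 != 0].

Lemma leibniz a b n :
  iter n D (a * b) = \sum_(i < n.+1) (iter i D a * iter (n - i) D b) *+ 'C(n, i).
Proof.
elim: n => [|n IH]; first by rewrite big_ord_recl big_ord0 addr0 bin0 mulr1n.
rewrite iterS IH (der_sum _ _ _ hD).
under eq_bigr => i _ do rewrite (derMn _ _ hD) (derM _ _ hD) mulrnDl.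
rewrite big_split /=.
rewrite [RHS]big_ord_recl /= bin0 mulr1n ?subn0.
under [X in _ = _ + X]eq_bigr => i _ do rewrite /bump /= add1n subSS binS mulrnDr.
rewrite big_split /= addrA [LHS]addrC; congr (_ + _).
rewrite [LHS]big_ord_recl /= bin0 mulr1n ?subn0; congr (_ + _).
rewrite [RHS]big_ord_recr /= bin_small // mulr0n addr0.
by apply: eq_bigr => i _; rewrite /bump /= !add1n -(subnSK (ltn_ord i)).
Qed.

Lemma bin_char0 m n : (n <= m)%N -> 'C(m, n)%:R != 0 :> K.
Proof. by move=> h; have := bin_gt0 m n; rewrite h; case: 'C(m, n). Qed.

(** By Leibniz' rule the series of the products is the product of the two series. Its coefficient in
    degree s + t is the product of the leading ones and a binomial coefficient, nonzero in
    characteristic 0. *)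
Lemma has_order_mul V W U s t :
  (forall a b, V a -> W b -> U (a * b)) ->
  has_order V s -> has_order W t -> has_order U (s + t).
Proof.
move=> hU [r1 [hV zV nV]] [r2 [hW zW nW]].
pose r := [seq (p.1 * q.1, p.2 * q.2) | p <- r1, q <- r2].
have E n : \sum_(p <- r) p.1 * iter n D p.2 = \sum_(i < n.+1)
    ((\sum_(p <- r1) p.1 * iter i D p.2) * (\sum_(q <- r2) q.1 * iter (n - i) D q.2)) *+ 'C(n, i).
  rewrite big_allpairs_dep.
  under eq_bigr => p _.
    under eq_bigr => q _ do rewrite leibniz mulr_sumr.
    rewrite exchange_big /=; over.
  rewrite exchange_big; apply: eq_bigr => i _ /=.
  rewrite mulr_suml -sumrMnl; apply: eq_bigr => p _.
  rewrite mulr_sumr -sumrMnl; apply: eq_bigr => q _.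
  by rewrite mulrnAr; congr (_ *+ _); ring.
exists r; split.
- by move=> _ /allpairsP [[p q] [pr qr ->]]; apply: hU; [apply: hV|apply: hW].
- move=> n hn; rewrite E big1 // => i _.
  have [hi|hi] := ltnP i s; first by rewrite zV // mul0r mul0rn.
  by rewrite zW ?mulr0 ?mul0rn //; have := ltn_ord i; lia.
have hs : (s < (s + t).+1)%N by lia.
rewrite E (bigD1 (Ordinal hs)) //= addKn [X in _ + X]big1 ?addr0.
  by rewrite -mulr_natr; apply: mulf_neq0; [apply: mulf_neq0|apply/bin_char0/leq_addr].
move=> i /eqP hi; have [hi'|hi'] := ltnP i s; first by rewrite zV // mul0r mul0rn.
rewrite zW ?mulr0 ?mul0rn //.
have : i != s :> nat by apply/eqP => e; apply: hi; apply: val_inj.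
by have := ltn_ord i; lia.
Qed.

Lemma iter_const c a n : D c = 0 -> iter n D (c * a) = c * iter n D a.
Proof. by move=> Dc; elim: n => //= n ->; rewrite (derM _ _ hD) Dc mul0r add0r. Qed.

Lemma iter_der_sum (I : Type) (r : seq I) (P : pred I) (F : I -> K) n :
  iter n D (\sum_(i <- r | P i) F i) = \sum_(i <- r | P i) iter n D (F i).
Proof. by elim: n => //= n ->; rewrite (der_sum _ _ _ hD). Qed.

(** Coefficients killed by D commute with its iterates, so each order below n is attained by a
    combination of the [g t]. The Taylor coefficients of these n combinations form a triangular
    matrix with nonzero diagonal, and this matrix factors through #|S| columns. *)
Lemma has_order_bound V (T : finType) (S : {set T}) (g : T -> K) n :
  (forall v, V v -> spanned (fun c => D c = 0) S g v) ->
  (forall s, (s < n)%N -> has_order V s) -> (n <= #|S|)%N.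
Proof.
move=> hV hord.
have /boolp.choice [w hw] : forall s : 'I_n, exists w : T -> K,
    (forall i, (i < s)%N -> \sum_(t in S) w t * iter i D (g t) = 0) /\
    \sum_(t in S) w t * iter s D (g t) != 0.
  move=> s; have [r [h1 h2 h3]] := hord s (ltn_ord s).
  have /boolp.choice [c hc] : forall v, exists c : T -> K, V v ->
      (forall t, D (c t) = 0) /\ v = \sum_(t in S) c t * g t.
    move=> v; have [/hV [c c1 c2]|nV] := asboolP (V v); first by exists c.
    by exists (fun=> 0).
  have E i : \sum_(p <- r) p.1 * iter i D p.2 =
      \sum_(t in S) (\sum_(p <- r) p.1 * c p.2 t) * iter i D (g t).
    under [RHS]eq_bigr => t _ do rewrite mulr_suml.
    rewrite exchange_big /= big_seq [RHS]big_seq; apply: eq_bigr => p /h1 Vp.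
    rewrite {1}(hc _ Vp).2 iter_der_sum mulr_sumr; apply: eq_bigr => t _.
    by rewrite iter_const ?(hc _ Vp).1 // mulrA.
  exists (fun t => \sum_(p <- r) p.1 * c p.2 t); split; last by rewrite -E.
  by move=> i hi; rewrite -E h2.
pose W := \matrix_(s < n, j < #|S|) w s (enum_val j).
pose G := \matrix_(j < #|S|, i < n) iter i D (g (enum_val j)).
have EWG s i : (W *m G) s i = \sum_(t in S) w s t * iter i D (g t).
  by rewrite mxE [RHS]big_enum_val /=; apply: eq_bigr => j _; rewrite !mxE.
have U : W *m G \in unitmx.
  rewrite unitmxE -det_tr det_trig.
    rewrite unitfE; apply/prodf_neq0 => i _; rewrite mxE EWG.
    exact: (hw i).2.
  by apply/is_trig_mxP => i j ij; rewrite mxE EWG (hw j).1.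
rewrite -(mxrank_unit U); apply: leq_trans (mxrankM_maxl _ _) _.
exact: rank_leq_col.
Qed.

Lemma has_order_powers z : D z = 1 -> forall s, has_order (fun v => exists n, v = z ^+ n) s.
Proof.
move=> Dz; elim=> [|s IH].
  exists [:: (1, 1)]; split=> //; last by rewrite big_seq1 /= mulr1 oner_eq0.
  by move=> p; rewrite inE => /eqP ->; exists 0%N.
pose V v := exists n, v = z ^+ n.
rewrite -addn1; apply: (@has_order_mul V V).
  by move=> _ _ [n1 ->] [n2 ->]; exists (n1 + n2)%N; rewrite exprD.
  exact: IH.
(* The series of z minus its constant term: the scalar -z stands outside the derivation, so the
   order is exactly 1. *)
exists [:: (- z, 1); (1, z)]; split.
- by move=> p; rewrite !inE => /orP [/eqP->|/eqP->]; [exists 0%N|exists 1%N].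
- by case=> // _; rewrite !big_cons big_nil /= mulr1 mul1r addr0 addrC subrr.
- rewrite !big_cons big_nil /= (der1 hD) Dz mulr0 mulr1 add0r addr0.
  exact: oner_neq0.
Qed.

Section Wronskian.
Variables (B : seq K) (z : K).
Hypotheses (hB : der_over B D) (Dz : D z = 1).

(** The coefficients c range over all of K, while independence is assumed only over the closure of
    B. After normalising the last coefficient to 1, every derivation over [z :: B], and D itself,
    must kill the others, which brings them down to the closure of B. *)
Lemma wronskian (n : nat) (u : nat -> K) :
  (forall t, (t < n)%N -> cl (z :: B) (u t)) ->
  (forall c : nat -> K, (forall t, (t < n)%N -> cl B (c t)) ->
     \sum_(t < n) c t * u t = 0 -> forall t, (t < n)%N -> c t = 0) ->
  forall c : nat -> K, (forall s, (s < n)%N -> \sum_(t < n) c t * iter s D (u t) = 0) ->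
  forall t, (t < n)%N -> c t = 0.
Proof.
elim: n => // n IH hu hi c hc.
have {}IH : forall c : nat -> K, (forall s, (s < n)%N -> \sum_(t < n) c t * iter s D (u t) = 0) ->
    forall t, (t < n)%N -> c t = 0.
  apply: IH => [t tn|c' hc' rel t tn]; first by apply/hu/ltnW.
  have := hi (fun t => if t == n then 0 else c' t) _ _ t (ltnW tn).
  rewrite ltn_eqF //; apply=> [x xn|].
    by case: eqP => [_|/eqP e]; [apply: cl0|apply: hc'; rewrite ltn_neqAle e].
  rewrite big_ord_recr /= eqxx mul0r addr0 -[RHS]rel; apply: eq_bigr => i _.
  by rewrite ltn_eqF.
have iterE s x : cl (z :: B) x -> cl (z :: B) (iter s D x).
  by move=> h; elim: s => //= s; apply: (@der_cl_stable _ B [::] z D hB Dz).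
have cn : c n = 0.
  apply/eqP/negPn/negP => cn; pose c' t := c t / c n.
  have c'n : c' n = 1 by rewrite /c' divff.
  have hc' s : (s < n.+1)%N -> \sum_(t < n.+1) c' t * iter s D (u t) = 0.
    move=> hs; rewrite /c'; under eq_bigr do rewrite mulrAC.
    by rewrite -mulr_suml hc // mul0r.
  (* Differentiating the relations removes the last term, whose coefficient is 1. If the terms where
     [D'] hits the [u t] cancel, the derivatives of the other coefficients satisfy the system of
     size n and vanish by induction. For D itself those terms form the next relation of the
     system. *)
  have kill D' : derivation D' ->
      (forall s, (s < n)%N -> \sum_(t < n.+1) c' t * D' (iter s D (u t)) = 0) ->
      forall t, (t < n)%N -> D' (c' t) = 0.
    move=> hD' h; apply: (IH (fun t => D' (c' t))) => s hs.
    have := der_sum (index_enum 'I_n.+1) predT (fun t : 'I_n.+1 => c' t * iter s D (u t)) hD'.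
    rewrite hc' ?ltnS ?(ltnW hs) // (der0 hD').
    under eq_bigr => t _ do rewrite (derM _ _ hD').
    rewrite big_split /= h // addr0 big_ord_recr /= c'n (der1 hD') mul0r addr0.
    by move=> <-.
  have Dc' t : (t < n)%N -> D (c' t) = 0.
    by apply: kill => // s hs; apply: (hc' s.+1); rewrite ltnS.
  have clc' t : (t < n.+1)%N -> cl B (c' t).
    rewrite ltnS leq_eqVlt => /orP [/eqP->|hs]; first by rewrite c'n; apply: cl1.
    apply: (@der_cl_descend _ B [::] z D hB Dz); last exact: Dc'.
    move=> D' hD'; apply: kill hs; first by case: hD'.
    move=> s hs; rewrite big1 // => i _; rewrite (iterE _ _ (hu i (ltn_ord i)) D' hD').
    by rewrite mulr0.
  have /eqP := hi c' clc' (hc' 0%N isT) n (ltnSn n).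
  by rewrite c'n oner_eq0.
move=> t; rewrite ltnS leq_eqVlt => /orP [/eqP->//|]; apply: IH => s hs.
by have := hc s (ltnW hs); rewrite big_ord_recr /= cn mul0r addr0.
Qed.

(** The Wronskian matrix is invertible, so some combination of the [u t] has the s-th unit vector as
    its first Taylor coefficients. *)
Lemma has_order_indep (T : finType) (S : {set T}) (u : T -> K) :
  (forall t, t \in S -> cl (z :: B) (u t)) -> indep (cl B) S u ->
  forall s, (s < #|S|)%N -> has_order (fun v => exists2 t, t \in S & v = u t) s.
Proof.
move=> hu hi s hs; pose n := #|S|; pose i0 := Ordinal hs.
pose v t := u (enum_val (insubd i0 t)).
have vE (i : 'I_n) : v i = u (enum_val i) by rewrite /v valKd.
have W := @wronskian n v.
have hv t : (t < n)%N -> cl (z :: B) (v t) by move=> _; apply/hu/enum_valP.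
have hiv (c : nat -> K) : (forall t, (t < n)%N -> cl B (c t)) ->
    \sum_(t < n) c t * v t = 0 -> forall t, (t < n)%N -> c t = 0.
  move=> hc rel t tn; pose c' x := if insub (enum_rank_in (enum_valP i0) x : nat) is Some i then c (i : 'I_n) else 0.
  have c'E (i : 'I_n) : c' (enum_val i) = c i by rewrite /c' enum_valK_in valK.
  rewrite -[t]/(val (Ordinal tn)) -c'E; apply: hi; last exact: enum_valP.
    by move=> x xS; rewrite /c' valK; apply: hc.
  by rewrite big_enum_val /= -[RHS]rel; apply: eq_bigr => i _; rewrite c'E vE.
pose Wr := \matrix_(t < n, r < n) iter r D (v t).
have WrE i r : Wr i r = iter r D (v i) by rewrite mxE.
have fW : row_free Wr.
  rewrite -kermx_eq0; apply/rowV0P => x /sub_kermxP hx.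
  pose c t := x 0 (insubd i0 t).
  have cE (i : 'I_n) : c i = x 0 i by rewrite /c valKd.
  apply/rowP => i; rewrite mxE -cE; apply: (W hv hiv) => // r hr.
  have := congr1 (fun M : 'rV_n => M 0 (Ordinal hr)) hx; rewrite !mxE => h.
  by rewrite -[RHS]h; apply: eq_bigr => j _; rewrite mxE cE.
have uW : Wr \in unitmx by rewrite -row_free_unit.
pose x : 'rV_n := delta_mx 0 i0 *m invmx Wr.
have hx r : (r < n)%N -> \sum_(i < n) x 0 i * iter r D (v i) = (r == s)%:R.
  move=> hr; have : x *m Wr = delta_mx 0 i0 by rewrite mulmxKV.
  move=> /(congr1 (fun M : 'rV_n => M 0 (Ordinal hr))).
  rewrite [in LHS]mxE [in RHS]mxE eqxx /= => <-.
  by apply: eq_bigr => j _; rewrite WrE.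
exists [seq (x 0 i, v i) | i <- enum 'I_n]; split.
- by move=> p /mapP [i _ ->] /=; exists (enum_val (insubd i0 i)) => //; apply: enum_valP.
- move=> i hi'; rewrite big_map big_enum /= hx ?(ltn_trans hi') //.
  by rewrite (ltn_eqF hi').
by rewrite big_map big_enum /= hx // eqxx oner_eq0.
Qed.
End Wronskian.
End Orders.

(** * Spans of monomials at a point *)

Section MonomialSpans.
Variable K : fieldType.
Hypothesis char0 : forall n, n.+1%:R != 0 :> K.
Variables (N bd : nat) (y : 'I_N -> K).
Implicit Types (A B : seq K).

Definition monv (m : 'X_{1..N}) : K := ('X_[K, m]).@[y].
Definition bmonv (m : 'X_{1..N < bd}) : K := monv m.
Definition degset (j : nat) : {set 'X_{1..N < bd}} := [set m | mdeg (bmnm m) == j].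

Lemma monvD m1 m2 : monv (m1 + m2)%MM = monv m1 * monv m2.
Proof. by rewrite /monv mpolyXD mevalM. Qed.

Lemma monv1 i : monv U_(i)%MM = y i.
Proof. by rewrite /monv mevalXU. Qed.

Lemma monv0 : monv 0%MM = 1.
Proof. by rewrite /monv mpolyX0 meval1. Qed.

Lemma monvMn i j : monv (U_(i) *+ j)%MM = y i ^+ j.
Proof.
by elim: j => [|j IH]; rewrite ?mulm0n ?monv0 // mulmS monvD monv1 IH exprS.
Qed.

Lemma cl_monv A m : (forall i, cl A (y i)) -> cl A (monv m).
Proof. by move=> h; rewrite /monv mevalX; apply: cl_prod => i _; apply: clX. Qed.

Lemma degsetP j (m : 'X_{1..N}) : mdeg m = j -> (j < bd)%N ->
  exists2 m', m' \in degset j & bmnm m' = m.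
Proof.
move=> mj jb; have mb : (mdeg m < bd)%N by rewrite mj.
by exists (BMultinom mb); rewrite // inE /= mj.
Qed.

Lemma rk1_cl A s z : rk A s = 1%N -> z \in s -> ~ cl A z ->
  forall a, a \in s -> cl (z :: A) a.
Proof.
move=> h zs hz a; apply: (@rk0_cl _ (z :: A) s).
have : rk A (z :: s) = 1%N.
  by rewrite -h; apply: rk_eqmem => x; rewrite inE; case: eqP => // ->.
by rewrite /= (asboolF hz) /= add1n => -[].
Qed.

Lemma rk_pos A s : (0 < rk A s)%N -> exists2 z, z \in s & ~ cl A z.
Proof.
move=> h; apply: contrapT => h0; move: h; rewrite rk_cl0 // => a aS.
by apply: contrapT => ha; apply: h0; exists a.
Qed.

Lemma spanned_der A (D : K -> K) (T : finType) (S : {set T}) (g : T -> K) v :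
  der_over A D -> spanned (cl A) S g v -> spanned (fun c => D c = 0) S g v.
Proof. by move=> hD [c hc ->]; exists c => // t; apply: hc. Qed.

(* A finite dimensional function space on a curve takes at least #|beta|
   orders of vanishing at a general point, hence its j-th power at least
   j (#|beta| - 1) + 1. *)
Lemma monomial_span_rk1 A B (beta : {set 'I_N}) j (S : {set 'X_{1..N < bd}}) :
  rk B (codom y) = 1%N -> (0 < #|beta|)%N -> indep (cl B) beta y ->
  (forall a, a \in A -> cl B a) -> (j < bd)%N ->
  (forall m, m \in degset j -> spanned (cl A) S bmonv (bmonv m)) ->
  (j * #|beta|.-1 < #|S|)%N.
Proof.
move=> hrk b0 hi AB jb hsp.
have [z zy hz] : exists2 z, z \in codom y & ~ cl B z by apply: rk_pos; rewrite hrk.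
have ycl i : cl (z :: B) (y i) by apply: (rk1_cl hrk zy hz); apply: codom_f.
have [D hD Dz] := ncl_der hz.
pose V j v := exists2 m : 'X_{1..N}, mdeg m = j & v = monv m.
have ordV i s : (s <= i * #|beta|.-1)%N -> has_order D (V i) s.
  elim: i s => [|i IH] s.
    rewrite mul0n leqn0 => /eqP ->; exists [:: (1, 1)]; split=> //.
      by move=> p; rewrite inE => /eqP ->; exists 0%MM; rewrite ?mdeg0 ?monv0.
    by rewrite big_seq1 /= mulr1 oner_eq0.
  (* Split s into an order already attained in degree i and an order below #|beta| for one further
     coordinate. *)
  move=> hs; pose s1 := minn s (i * #|beta|.-1).
  have -> : s = (s1 + (s - s1))%N by rewrite /s1; lia.
  apply: (has_order_mul char0 hD.1 (V := V i) (W := fun v => exists2 t, t \in beta & v = y t)).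
  - move=> a b [m mi ->] [t _ ->]; exists (m + U_(t))%MM.
      by rewrite mdegD mdeg1 mi addn1.
    by rewrite monvD monv1.
  - by apply: IH; rewrite /s1; lia.
  - by apply: (has_order_indep hD.1 hD Dz) => //; move: hs; rewrite /s1 mulSn; lia.
have hAD : der_over A D by split; [case: hD | move=> a /AB; apply].
apply: (@has_order_bound K D hD.1 (V j) _ S bmonv).
  move=> v [m mj ->]; have [m' m'j <-] := degsetP mj jb.
  by apply: spanned_der hAD _; apply: hsp.
by move=> s hs; apply: ordV.
Qed.

(** Multiplying a coordinate by a power of the coordinate [b0] raises its degree to j without
    changing its value at y. *)
Lemma monomial_indep_degree1 (k : K -> Prop) (beta : {set 'I_N}) b0 j :
  y b0 = 1 -> (0 < j)%N -> (j < bd)%N -> indep k beta y ->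
  exists S : {set 'X_{1..N < bd}}, [/\ S \subset degset j, #|S| = #|beta|, indep k S bmonv &
     forall m, m \in S -> exists2 t, t \in beta & bmonv m = y t].
Proof.
move=> yb0 j0 jb hi.
have hf i : (mdeg (U_(i) + U_(b0) *+ j.-1)%MM < bd)%N.
  by rewrite mdegD mdegMn !mdeg1 mul1n add1n prednK.
pose f i : 'X_{1..N < bd} := BMultinom (hf i).
have inj : injective f.
  move=> i1 i2 /(congr1 (@bmnm _ _)) /= /addIm /eqP; rewrite eq_mnm1 => /eqP //.
have fE i : bmonv (f i) = y i by rewrite /bmonv /= monvD monv1 monvMn yb0 expr1n mulr1.
exists (f @: beta); split.
- apply/subsetP => _ /imsetP [i _ ->]; rewrite inE /= mdegD mdegMn !mdeg1 mul1n add1n.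
  by rewrite prednK.
- by rewrite card_imset.
- move=> c hc; rewrite big_imset /=; last by move=> i1 i2 _ _ /inj.
  under eq_bigr do rewrite fE.
  move=> rel _ /imsetP [i ib ->]; apply: (hi (c \o f)) ib => //= t tb.
  by apply: hc; apply: imset_f.
- by move=> _ /imsetP [i ib ->]; exists i.
Qed.

(* Otherwise multiplication by a non-constant coordinate would preserve the
   span of the coordinates, making that coordinate algebraic. *)
Lemma monomial_span_succ A B (beta : {set 'I_N}) b0 j :
  y b0 = 1 -> b0 \in beta -> (0 < rk B (codom y))%N -> indep (cl B) beta y ->
  (forall a, a \in A -> cl B a) -> (1 < j < bd)%N ->
  exists S : {set 'X_{1..N < bd}}, [/\ S \subset degset j, indep (cl A) S bmonv,
    forall m, m \in degset j -> spanned (cl A) S bmonv (bmonv m) &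
    (#|beta| < #|S|)%N].
Proof.
move=> yb0 b0b hrk hi AB /andP [j1 jb].
have hiA : indep (cl A) beta y by apply: indep_sub hi => z; apply: cl_sub.
have [S0 [sub0 card0 hi0 S0b]] := monomial_indep_degree1 yb0 (ltnW j1) jb hiA.
have [S [subS sub hiS hsp]] := indep_maximal sub0 hi0.
exists S; split=> //; rewrite -card0 ltn_neqAle subset_leq_card // andbT.
apply/negP => /eqP e.
have {e}eS : S = S0 by apply/esym/eqP; rewrite eqEcard subS e leqnn.
subst S.
have spb v : spanned (cl A) S0 bmonv v -> spanned (cl A) beta y v.
  move=> [c hc ->]; have /boolp.choice [g hg] : forall m, exists t, m \in S0 -> t \in beta /\ bmonv m = y t.
    by move=> m; have [/S0b [t tb e]|_] := boolP (m \in S0); [exists t|exists b0].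
  exists (fun t => \sum_(m in S0 | g m == t) c m); first by move=> t; apply: cl_sum.
  rewrite (partition_big g (mem beta)) /=; last by move=> m /hg [].
  apply: eq_bigr => t tb; rewrite mulr_suml; apply: eq_bigr => m /andP [mS /eqP gt].
  by rewrite (hg _ mS).2 gt.
have [_ /codomP [a ->] hz] := rk_pos hrk.
have prod t : spanned (cl A) beta y (y a * y t).
  have := @degsetP j (U_(a) + U_(t) + U_(b0) *+ j.-2)%MM.
  rewrite !mdegD mdegMn !mdeg1 mul1n; case=> //; first by case: (j) j1 => [|[]].
  move=> m mj em; have := spb _ (hsp _ mj); rewrite /bmonv em !monvD !monv1 monvMn yb0.
  by rewrite expr1n mulr1.
have pow n : spanned (cl A) beta y (y a ^+ n).
  elim: n => [|n [c hc e]].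
    exists (fun s => (s == b0)%:R); first by move=> s; case: eqP => _; [apply: cl1|apply: cl0].
    rewrite (bigD1 b0) //= eqxx mul1r yb0 big1 ?addr0 // => s /andP [_ /negPf ->].
    by rewrite mul0r.
  rewrite exprS e mulr_sumr.
  have /boolp.choice [d hd] : forall t, exists d : 'I_N -> K,
      (forall s, cl A (d s)) /\ y a * y t = \sum_(s in beta) d s * y s.
    by move=> t; have [d hd1 hd2] := prod t; exists d.
  exists (fun s => \sum_(t in beta) c t * d t s).
    by move=> s; apply: cl_sum => t _; apply: clM => //; apply: (hd t).1.
  under [RHS]eq_bigr => s _ do rewrite mulr_suml.
  rewrite exchange_big /=; apply: eq_bigr => t tb.
  by rewrite mulrCA (hd t).2 mulr_sumr; apply: eq_bigr => s _; rewrite mulrA.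
have [D hD Dz] := ncl_der hz.
have hAD : der_over A D by split; [case: hD | move=> x /AB; apply].
suff : (#|beta| < #|beta|)%N by rewrite ltnn.
apply: (@has_order_bound K D hD.1 (fun v => exists n, v = y a ^+ n) _ beta y #|beta|.+1); last first.
  by move=> s _; apply: has_order_powers => //; case: hD.
by move=> v [n ->]; apply: spanned_der hAD (pow n).
Qed.

Lemma card_le_pairs n : #|[set p : 'I_n.+1 * 'I_n.+1 | (p.1 <= p.2)%N]| = 'C(n.+2, 2).
Proof.
rewrite -sum1dep_card.
apply: etrans (esym (pair_big_dep predT (fun i j : 'I_n.+1 => (i <= j)%N) (fun _ _ => 1%N))) _.
rewrite /= (exchange_big_dep predT) //= -bin2_sum big_mkord big_ord_recl add0n.
apply: eq_bigr => j _.
by rewrite (big_ord_narrow (ltn_ord j : (j.+1 <= n.+1)%N)) sum1_card card_ord.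
Qed.

(** The positive entries of a sorted pair are read off from their multiplicities and the remaining
    entries are 0. The value 0 is excluded because index 0 will stand for the coordinate equal to 1,
    which leaves no trace in a monomial. *)
Lemma pair_multiset_inj (a b c d e : nat) : (a <= b)%N -> (c <= d)%N ->
  (b < e)%N -> (d < e)%N ->
  (forall v : nat, (0 < v < e)%N -> ((v == a) + (v == b) = (v == c) + (v == d))%N) ->
  a = c /\ b = d.
Proof.
move=> ab cd be de h; have hbd : b = d.
  have [ltbd|ltdb|//] := ltngtP b d.
    have := h d; rewrite de eqxx (gtn_eqF ltbd) (gtn_eqF (leq_ltn_trans ab ltbd)) andbT; case: (d == c); lia.
  have := h b; rewrite be eqxx (gtn_eqF ltdb) (gtn_eqF (leq_ltn_trans cd ltdb)) andbT; case: (b == a); lia.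
subst d; split=> //; have [ac|ca|//] := ltngtP a c.
  by have := h c; rewrite (leq_ltn_trans cd be) eqxx (gtn_eqF ac) /= andbT; case: (c == b); lia.
by have := h a; rewrite (leq_ltn_trans ab be) eqxx (gtn_eqF ca) /= andbT; case: (a == b); lia.
Qed.

(** Among the coordinates choose e algebraically independent ones; with the coordinate [b0], equal
    to 1 at y, the quadratic monomials become all monomials of degree at most 2 in e independent
    quantities. *)
Lemma quadric_span_rk A b0 : y b0 = 1 -> (2 < bd)%N ->
  exists S : {set 'X_{1..N < bd}}, [/\ S \subset degset 2, indep (cl A) S bmonv &
    #|S| = 'C((rk A (codom y)).+2, 2)].
Proof.
move=> yb0 b2; set e := rk A (codom y).
have [s rks] := rk_subfamily A y.
pose s' (i : 'I_e.+1) : 'I_N := if unlift ord0 i is Some j then s j else b0.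
pose w (i : 'I_e.+1) : 'X_{1..e} := if unlift ord0 i is Some j then U_(j)%MM else 0%MM.
have hb (p : 'I_e.+1 * 'I_e.+1) : (mdeg (U_(s' p.1) + U_(s' p.2))%MM < bd)%N.
  by rewrite mdegD !mdeg1.
pose f p : 'X_{1..N < bd} := BMultinom (hb p).
pose P := [set p : 'I_e.+1 * 'I_e.+1 | (p.1 <= p.2)%N].
have wval p : (('X_[K, (w p.1 + w p.2)%MM]) : {mpoly K[e]}).@[y \o s] = bmonv (f p).
  have w1 i : ('X_[K, w i]).@[y \o s] = monv U_(s' i)%MM.
    rewrite /w /s' monv1; case: unlift => [j|]; first by rewrite mevalXU.
    by rewrite mpolyX0 meval1 yb0.
  by rewrite /bmonv monvD mpolyXD mevalM !w1.
have winj : {in P &, injective (fun p => (w p.1 + w p.2)%MM)}.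
  move=> [i1 j1] [i2 j2]; rewrite !inE /= => h1 h2 /mnmP h.
  have E x (i j : 'I_e.+1) : (w i + w j)%MM x = ((lift ord0 x == i) + (lift ord0 x == j))%N.
    have wE (t : 'I_e.+1) : w t x = (lift ord0 x == t).
      rewrite /w; case: unliftP => [t' ->|->]; last by rewrite mnm0E.
      by rewrite mnm1E (inj_eq lift_inj) eq_sym.
    by rewrite mnmDE !wE.
  have H (v : 'I_e.+1) : (0 < v)%N -> ((v == i1) + (v == j1) = (v == i2) + (v == j2))%N.
    move=> v0; have [x ->|e0] := unliftP ord0 v; first by have := h x; rewrite !E.
    by rewrite e0 in v0.
  have H' (v : nat) : (0 < v < e.+1)%N ->
      ((v == i1 :> nat) + (v == j1 :> nat) = (v == i2 :> nat) + (v == j2 :> nat))%N.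
    by move=> /andP [v0 ve]; apply: (H (Ordinal ve)).
  have [e1 e2] : (i1 : nat) = i2 /\ (j1 : nat) = j2.
    exact: (pair_multiset_inj h1 h2 (ltn_ord j1) (ltn_ord j2) H').
  by congr pair; apply: val_inj.
have ind : indep (cl A) P (bmonv \o f).
  move=> c hc rel.
  pose p := \sum_(x in P) c x *: ('X_[K, (w x.1 + w x.2)%MM] : {mpoly K[e]}).
  have pc x : x \in P -> p@_(w x.1 + w x.2) = c x.
    move=> xP; rewrite /p raddf_sum (bigD1 x) //= mcoeffZ mcoeffX eqxx mulr1 big1 ?addr0 //.
    move=> x' /andP [x'P x'x]; rewrite mcoeffZ mcoeffX.
    case: eqP => [/(winj _ _ x'P xP) ex|_]; last by rewrite mulr0.
    by rewrite ex eqxx in x'x.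
  suff p0 : p = 0 by move=> x xP; rewrite -pc // p0 mcoeff0.
  apply: (rk_full_free char0 rks).
    move=> m; rewrite /p raddf_sum; apply: cl_sum => x xP /=.
    rewrite mcoeffZ mcoeffX; apply: clM; first exact: hc.
    by case: eqP => _; [apply: cl1|apply: cl0].
  rewrite -[RHS]rel /p raddf_sum; apply: eq_bigr => x _ /=.
  by rewrite mevalZ wval.
have finj : {in P &, injective f}.
  move=> p q pP qP /(congr1 bmonv) epq; apply: contrapT => npq.
  have := ind (fun x => (x == p)%:R - (x == q)%:R).
  have hc t : t \in P -> cl A ((t == p)%:R - (t == q)%:R).
    by move=> _; apply: clB; case: eqP => _; (exact: cl1 || exact: cl0).
  move=> /(_ hc); rewrite (bigD1 p) //= (bigD1 q) /=; last by rewrite qP; apply/eqP => h; apply: npq.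
  rewrite !eqxx big1; last first.
    by move=> x /andP [/andP [_ /negPf ->] /negPf ->]; rewrite subrr mul0r.
  have -> : (p == q) = false by apply/eqP.
  have -> : (q == p) = false by apply/eqP => h; apply: npq.
  rewrite subr0 sub0r mul1r mulN1r addr0 epq subrr => /(_ erefl p pP) /eqP.
  rewrite eqxx; have -> : (p == q) = false by apply/eqP.
  by rewrite subr0 oner_eq0.
exists (f @: P); split.
- apply/subsetP => _ /imsetP [p _ ->]; rewrite inE /= mdegD !mdeg1 //.
- move=> c hc; rewrite big_imset //= => rel _ /imsetP [p pP ->].
  by apply: (ind (c \o f)) pP => // x xP; apply: hc; apply: imset_f.
- by rewrite card_in_imset // card_le_pairs.
Qed.

End MonomialSpans.

(** * Common zeros of homogeneous forms *)

Section Nullstellensatz.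
Variable K : closedFieldType.
Hypothesis char0 : forall n, n.+1%:R != 0 :> K.
Hypothesis uncount : forall f : nat -> seq K, exists z, forall n, z \notin f n.
Variable n : nat.
Implicit Types (I : {mpoly K[n]} -> Prop).

Definition ideal I :=
  [/\ I 0, forall p q, I p -> I q -> I (p + q) & forall p q, I q -> I (p * q)].

Definition adjoin I (q p : {mpoly K[n]}) := exists a b, I a /\ p = a + b * q.

Lemma idealN I p : ideal I -> I p -> I (- p).
Proof. by move=> [_ _ hM] h; rewrite -mulN1r; apply: hM. Qed.

Lemma ideal_sum I (T : Type) (r : seq T) (P : pred T) (F : T -> {mpoly K[n]}) :
  ideal I -> (forall t, P t -> I (F t)) -> I (\sum_(t <- r | P t) F t).
Proof. by move=> [h0 hD _] h; apply: big_ind. Qed.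

Lemma ideal_adjoin I q : ideal I -> ideal (adjoin I q).
Proof.
move=> [h0 hD hM]; split.
- by exists 0, 0; split=> //; rewrite mul0r addr0.
- move=> _ _ [a [b [Ia ->]]] [c [d [Ic ->]]]; exists (a + c), (b + d).
  by split; [apply: hD|ring].
- move=> p _ [a [b [Ia ->]]]; exists (p * a), (p * b).
  by split; [apply: hM|ring].
Qed.

Lemma adjoin_sub I q p : I p -> adjoin I q p.
Proof. by move=> h; exists p, 0; rewrite mul0r addr0. Qed.

Lemma adjoin_mem I q : ideal I -> adjoin I q q.
Proof. by move=> [h0 _ _]; exists 0, 1; rewrite mul1r add0r. Qed.

Lemma finite_cover (P : K -> Prop) m :
  (forall s : seq K, uniq s -> (forall a, a \in s -> P a) -> (size s <= m)%N) ->
  exists s : seq K, forall a, P a -> a \in s.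
Proof.
move=> h; pose Q k := `[< exists s : seq K, [/\ uniq s, forall a, a \in s -> P a & size s = k] >].
have Q0 : exists k, Q k by exists 0%N; apply/asboolP; exists [::].
have Qm k : Q k -> (k <= m)%N by move=> /asboolP [s [h1 h2 <-]]; apply: h.
have [k /asboolP [s [us Ps sz]] kmax] := ex_maxnP Q0 Qm.
exists s => a Pa; apply/negPn/negP => as_.
suff /kmax : Q k.+1 by rewrite ltnn.
apply/asboolP; exists (a :: s); split; rewrite /= ?us ?as_ ?sz //.
by move=> b; rewrite inE => /orP [/eqP->|/Ps].
Qed.

Section EvalPoly.
Variable i : 'I_n.
Definition poly_at (f : {poly K}) : {mpoly K[n]} := (map_poly (@mpolyC n K) f).['X_i].

Lemma poly_atM f g : poly_at (f * g) = poly_at f * poly_at g.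
Proof. by rewrite /poly_at rmorphM hornerM. Qed.

Lemma poly_at_lin a : poly_at ('X - a%:P) = 'X_i - a%:MP.
Proof. by rewrite /poly_at rmorphB /= map_polyX map_polyC /= hornerXsubC. Qed.

Lemma poly_atZ a f : poly_at (a *: f) = a *: poly_at f.
Proof. by rewrite -mul_polyC poly_atM /poly_at map_polyC hornerC mul_mpolyC. Qed.

Lemma poly_at_sum (T : Type) (r : seq T) (F : T -> {poly K}) :
  poly_at (\sum_(t <- r) F t) = \sum_(t <- r) poly_at (F t).
Proof. by rewrite /poly_at rmorph_sum horner_sum. Qed.

Lemma poly_at_prod (T : Type) (r : seq T) (P : pred T) (F : T -> {poly K}) :
  poly_at (\prod_(t <- r | P t) F t) = \prod_(t <- r | P t) poly_at (F t).
Proof. by rewrite /poly_at rmorph_prod horner_prod. Qed.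
End EvalPoly.

(* If every x_i - a were invertible modulo I, then for some degree bound so
   many of the inverses would have representatives of that degree that they
   would be linearly dependent; clearing denominators puts a nonzero
   polynomial in x_i, a product of units, into I. *)
Lemma proper_adjoin I (i : 'I_n) : ideal I -> ~ I 1 ->
  exists a, ~ adjoin I ('X_i - a%:MP) 1.
Proof.
move=> hI hI1; have [h0 hD hM] := hI; apply: contrapT => no.
have inv a : exists u, I (u * ('X_i - a%:MP) - 1).
  have : adjoin I ('X_i - a%:MP) 1 by apply: contrapT => h; apply: no; exists a.
  move=> [g [h [Ig e]]]; exists h.
  have -> : h * ('X_i - a%:MP) - 1 = - g by rewrite e; ring.
  exact: idealN.
have prodI (rs : seq K) : I (\prod_(r <- rs) ('X_i - r%:MP)) -> I 1.
  elim: rs => [|r rs IH]; rewrite ?big_nil // big_cons => h; apply: IH.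
  have [u hu] := inv r; set Q := \prod_(_ <- _) _ in h *.
  have -> : Q = u * (('X_i - r%:MP) * Q) + (- Q) * (u * ('X_i - r%:MP) - 1) by ring.
  by apply: hD; apply: hM.
pose SD (D : nat) a := exists2 u, (msize u <= D)%N & I (u * ('X_i - a%:MP) - 1).
have [D [s [us hs szs]]] : exists D (s : seq K),
    [/\ uniq s, forall a, a \in s -> SD D a & (#|{: 'X_{1..n < D}}| < size s)%N].
  apply: contrapT => none.
  have cov D : exists s : seq K, forall a, SD D a -> a \in s.
    apply: (@finite_cover _ #|{: 'X_{1..n < D}}|) => s us hs; rewrite leqNgt.
    by apply/negP => h; apply: none; exists D, s.
  have [f hf] := boolp.choice cov.
  have [z hz] := uncount f; have [u hu] := inv z.
  by have := hz (msize u); rewrite hf //; exists u.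
pose m := size s.
have hst (t : 'I_m) : s`_t \in s by rewrite mem_nth.
have /boolp.choice [u hu] : forall t : 'I_m, exists u, (msize u <= D)%N /\ I (u * ('X_i - (s`_t)%:MP) - 1).
  by move=> t; have [u h1 h2] := hs _ (hst t); exists u.
pose M := \matrix_(t < m, j < #|{: 'X_{1..n < D}}|) (u t)@_(bmnm (enum_val j)).
have : kermx M != 0.
  rewrite kermx_eq0 -row_leq_rank -ltnNge.
  by apply: leq_ltn_trans (rank_leq_col M) _.
case/rowV0Pn => c /sub_kermxP cM c0.
have rel : \sum_(t < m) c 0 t *: u t = 0.
  apply/mpolyP => mm; rewrite raddf_sum mcoeff0 /=.
  have [hmm|hmm] := ltnP (mdeg mm) D; last first.
    rewrite big1 // => t _; rewrite mcoeffZ memN_msupp_eq0 ?mulr0 //.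
    by apply: msize_mdeg_ge; apply: leq_trans hmm; case: (hu t).
  have := congr1 (fun A : 'rV_ _ => A 0 (enum_rank (BMultinom hmm))) cM.
  rewrite !mxE => e; rewrite -[RHS]e; apply: eq_bigr => t _.
  by rewrite mcoeffZ mxE enum_rankK.
pose lin (t : 'I_m) : {poly K} := 'X - (s`_t)%:P.
pose f := \sum_(t < m) c 0 t *: \prod_(l < m | l != t) lin l.
have /rV0Pn [t0 ct0] := c0.
have f0 : f != 0.
  apply/eqP => /(congr1 (fun w : {poly K} => w.[s`_t0])); rewrite horner0 /f horner_sum.
  rewrite (bigD1 t0) //= hornerZ horner_prod [X in _ + X]big1.
    rewrite addr0 => /eqP; rewrite mulf_eq0 (negPf ct0) /= => /prodf_eq0 [l lt].
    by rewrite hornerXsubC subr_eq0 nth_uniq // eq_sym (inj_eq val_inj) (negPf lt).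
  move=> t tt0; rewrite hornerZ horner_prod (bigD1 t0) 1?eq_sym //=.
  by rewrite hornerXsubC subrr mul0r mulr0.
have If : I (poly_at i f).
  pose P := \prod_(l < m) ('X_i - (s`_l)%:MP) : {mpoly K[n]}.
  have -> : poly_at i f = \sum_(t < m) (- c 0 t *: \prod_(l < m | l != t) ('X_i - (s`_l)%:MP)) *
       (u t * ('X_i - (s`_t)%:MP) - 1).
    have z : P * (\sum_(t < m) c 0 t *: u t) = 0 by rewrite rel mulr0.
    rewrite /f poly_at_sum -[LHS]subr0 -[X in _ - X]z mulr_sumr -sumrB.
    apply: eq_bigr => t _; rewrite poly_atZ poly_at_prod /P [\prod_(l < m) _](bigD1 t) //=.
    under eq_bigr => l _ do rewrite /lin poly_at_lin.
    rewrite -!mul_mpolyC mpolyCN; ring.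
  by apply: ideal_sum => // t _; apply: hM; case: (hu t).
have [rs e] := closed_field_poly_normal f.
apply: hI1; apply: (prodI rs).
have lf : lead_coef f != 0 by rewrite lead_coef_eq0.
have -> : \prod_(r <- rs) ('X_i - r%:MP) = (lead_coef f)^-1%:MP * poly_at i f.
  rewrite {2}e poly_atZ poly_at_prod mul_mpolyC scalerA mulVf // scale1r.
  by apply: eq_bigr => r _; rewrite poly_at_lin.
exact: hM.
Qed.

(** Adjoining a suitable ['X_i - a] for each coordinate keeps the ideal proper and makes every
    polynomial congruent to its value at the point v of the chosen a; a nonzero value on I would put
    a unit into the ideal. *)
Lemma weak_nullstellensatz I : ideal I -> ~ I 1 ->
  exists v : 'I_n -> K, forall p, I p -> p.@[v] = 0.
Proof.
move=> hI hI1.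
have [J [hJ hJ1 IJ hJX]] : exists J, [/\ ideal J, ~ J 1, forall p, I p -> J p &
    forall i, i \in enum 'I_n -> exists a, J ('X_i - a%:MP)].
  elim: (enum 'I_n) => [|i s [J [hJ hJ1 IJ hs]]]; first by exists I.
  have [a ha] := proper_adjoin i hJ hJ1; exists (adjoin J ('X_i - a%:MP)); split=> //.
  - exact: ideal_adjoin.
  - by move=> p /IJ; apply: adjoin_sub.
  - move=> j; rewrite inE => /orP [/eqP->|/hs [b hb]]; last by exists b; apply: adjoin_sub.
    by exists a; apply: adjoin_mem.
have [v hv] := boolp.choice (fun i => hJX i (mem_enum _ i)); exists v.
have [J0 JD JM] := hJ.
pose R p := J (p - (p.@[v])%:MP).
have RM p q : R p -> R q -> R (p * q).
  rewrite /R => hp hq; have -> : p * q - (p * q).@[v]%:MP =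
      q * (p - p.@[v]%:MP) + p.@[v]%:MP * (q - q.@[v]%:MP).
    by rewrite mevalM mpolyCM; ring.
  by apply: JD; apply: JM.
have RD p q : R p -> R q -> R (p + q).
  rewrite /R => hp hq; have -> : p + q - (p + q).@[v]%:MP =
      (p - p.@[v]%:MP) + (q - q.@[v]%:MP) by rewrite mevalD mpolyCD; ring.
  exact: JD.
have RC c : R c%:MP by rewrite /R mevalC subrr.
have R1 : R 1 by rewrite -mpolyC1.
have Rall p : R p.
  rewrite [p]mpolyE; apply: big_ind => [||m _]; first by rewrite -mpolyC0.
    exact: RD.
  rewrite -mul_mpolyC; apply: (RM) => //; rewrite mpolyXE_id.
  apply: (big_ind R R1 RM) => j _; elim: (m j) => [|k IH]; rewrite ?expr0 //.
  by rewrite exprS; apply: RM => //; rewrite /R mevalXU.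
move=> p /IJ Jp; apply/eqP/negPn/negP => pv; apply: hJ1.
have Jc : J (p.@[v])%:MP.
  have -> : (p.@[v])%:MP = p + - (p - (p.@[v])%:MP) :> {mpoly K[n]} by ring.
  by apply: JD => //; apply: idealN => //; apply: Rall.
have -> : 1 = ((p.@[v])^-1)%:MP * (p.@[v])%:MP :> {mpoly K[n]}.
  by rewrite -mpolyCM mulVf.
exact: JM.
Qed.

Section Homogeneous.
Variables (r : nat) (g : 'I_r -> {mpoly K[n]}) (e : 'I_r -> nat).
Hypothesis e0 : forall j, (0 < e j)%N.
Hypothesis hg : forall j, g j \is (e j).-homog.

Lemma homog_meval d (p : {mpoly K[n]}) (c : K) (v : 'I_n -> K) : p \is d.-homog ->
  p.@[fun i => c * v i] = c ^+ d * p.@[v].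
Proof.
move=> hp; rewrite !mevalE mulr_sumr; apply: eq_big_seq => m mp.
rewrite [RHS]mulrCA; congr (_ * _); under eq_bigr => i _ do rewrite exprMn.
rewrite big_split /= -expr_sum; congr (_ ^+ _ * _).
by rewrite -mdegE (dhomogP _ _ _ hp _ mp).
Qed.

Lemma msize_sum_le (T : eqType) (s : seq T) (F : T -> {mpoly K[n]}) b :
  (forall t, t \in s -> (msize (F t) <= b)%N) -> (msize (\sum_(t <- s) F t)%R <= b)%N.
Proof.
elim: s => [|t s IH] h; first by rewrite big_nil msize0.
rewrite big_cons; apply: leq_trans (msizeD_le _ _) _; rewrite geq_max h ?inE ?eqxx //=.
by apply: IH => x xs; apply: h; rewrite inE xs orbT.
Qed.

Definition only_trivial_zero :=
  forall v : 'I_n -> K, (forall j, (g j).@[v] = 0) -> forall i, v i = 0.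

(** Without a common zero on the hyperplane x_i = 1, the number 1 is a combination of the g_j and of
    x_i - 1; rehomogenise with powers of x_i. Since [msize] is the degree plus one, the bound says
    that every multiplier has degree below D, and this makes the later reduction terminate. *)
Lemma homog_nullstellensatz (i : 'I_n) : only_trivial_zero ->
  exists (D : nat) (G : 'I_r -> {mpoly K[n]}), (forall j, (msize (G j) <= D)%N) /\
    forall v : 'I_n -> K, v i ^+ D = \sum_j (G j).@[v] * (g j).@[v].
Proof.
move=> triv.
pose I p := exists (H : 'I_r -> {mpoly K[n]}) h, p = \sum_j H j * g j + h * ('X_i - 1).
have hI : ideal I.
  split.
  - by exists (fun=> 0), 0; rewrite mul0r addr0 big1 // => j _; rewrite mul0r.
  - move=> _ _ [H1 [h1 ->]] [H2 [h2 ->]]; exists (fun j => H1 j + H2 j), (h1 + h2).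
    under [in RHS]eq_bigr do rewrite mulrDl.
    by rewrite big_split /=; ring.
  - move=> p _ [H1 [h1 ->]]; exists (fun j => p * H1 j), (p * h1).
    by rewrite mulrDr mulr_sumr mulrA; congr (_ + _); apply: eq_bigr => j _; rewrite mulrA.
have [H [h e1]] : I 1.
  apply: contrapT => /(weak_nullstellensatz hI) [v hv].
  have vi : v i = 1.
    have : I ('X_i - 1).
      exists (fun=> 0), 1; rewrite mul1r big1 ?add0r // => j _; rewrite mul0r //.
    by move/hv; rewrite mevalB mevalXU meval1 => /eqP; rewrite subr_eq0 => /eqP.
  suff /triv /(_ i) /eqP : forall j, (g j).@[v] = 0 by rewrite vi oner_eq0.
  move=> j; apply: hv; exists (fun j' => (j' == j)%:R), 0.
  rewrite mul0r addr0 (bigD1 j) //= eqxx mul1r big1 ?addr0 // => j' /negPf ->.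
  by rewrite mul0r.
pose E := (\max_j msize (H j))%N; pose dm := (\max_j e j)%N.
(* This exponent pads all terms of [H j] to degree E + dm - e_j + 1, which the factor g_j completes
   to D = E + dm + 1. The final 1 makes both sides vanish when x_i = 0. *)
pose ex j (m : 'X_{1..n}) := (E - mdeg m + (dm - e j + 1))%N.
pose Hh j : {mpoly K[n]} :=
  \sum_(m <- msupp (H j)) (H j)@_m *: 'X_[(m + U_(i) *+ ex j m)%MM].
have szH j m : m \in msupp (H j) -> (mdeg m < E)%N.
  by move=> /msize_mdeg_lt h1; apply: leq_trans h1 _; apply: (leq_bigmax j).
have HhE j (v : 'I_n -> K) : v i != 0 ->
    (Hh j).@[v] = v i ^+ (dm - e j + 1) * (v i ^+ E * (H j).@[fun l => (v i)^-1 * v l]).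
  move=> vi; rewrite /Hh raddf_sum mevalE !mulr_sumr /=; apply: eq_big_seq => m mH.
  rewrite mevalZ -/(monv v _) monvD monvMn {1}/monv mevalX.
  under [in RHS]eq_bigr => l _ do rewrite exprMn.
  rewrite big_split /= -expr_sum -mdegE exprVn /ex exprD.
  rewrite -[in RHS](subnK (ltnW (szH _ _ mH))) (exprD _ (E - mdeg m)).
  have t0 : v i ^+ mdeg m != 0 by rewrite expf_neq0.
  have key (a p x z t t' : K) : t * t' = 1 -> a * (p * (x * z)) = z * (x * t * (a * (t' * p))).
    by move=> tt; rewrite -[LHS]mulr1 -tt; ring.
  by apply: key; rewrite mulfV.
exists (E + dm + 1)%N, Hh; split.
  move=> j; apply: msize_sum_le => m mH; apply: leq_trans (msizeZ_le _ _) _.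
  rewrite msizeX mdegD mdegMn mdeg1 mul1n /ex.
  have := szH _ _ mH; have := e0 j; have : (e j <= dm)%N by apply: leq_bigmax.
  by lia.
move=> v; have [vi|vi] := eqVneq (v i) 0.
  rewrite vi addn1 expr0n /= big1 // => j _.
  rewrite /Hh raddf_sum /= big1 ?mul0r // => m _.
  rewrite mevalZ -/(monv v _) monvD monvMn vi /ex addnA addn1 expr0n /=.
  by rewrite !mulr0.
pose w l := (v i)^-1 * v l.
have e2 : 1 = \sum_j (H j).@[w] * (g j).@[w].
  have := congr1 (meval w) e1; rewrite meval1 mevalD mevalM mevalB mevalXU meval1.
  have -> : w i = 1 by rewrite /w mulVf.
  rewrite subrr mulr0 addr0 raddf_sum => /= e2; apply: etrans e2 _.
  by apply: eq_bigr => j _; rewrite /= mevalM.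
rewrite -[LHS]mulr1 [X in _ * X]e2 mulr_sumr; apply: eq_bigr => j _.
rewrite HhE // -/w.
have -> : (g j).@[v] = v i ^+ e j * (g j).@[w].
  rewrite -homog_meval //; apply: meval_eq => l.
  by rewrite /w mulrA mulfV // mul1r.
have -> : (E + dm + 1 = E + (dm - e j + 1) + e j)%N.
  have : (e j <= dm)%N by apply: leq_bigmax.
  by lia.
have key (a b c x z : K) : a * b * c * (x * z) = b * (a * x) * (c * z) by ring.
by rewrite exprD (exprD _ E) key.
Qed.

Section Spanning.
Variables (Pt : Type) (vv : Pt -> 'I_n -> K) (kk : (Pt -> K) -> Prop).
Variables (D : 'I_n -> nat) (G : 'I_n -> 'I_r -> {mpoly K[n]}).
Hypothesis kkC1 : kk (fun=> 1).
Hypothesis kkC0 : kk (fun=> 0).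
Hypothesis kkD : forall f1 f2, kk f1 -> kk f2 -> kk (fun p => f1 p + f2 p).
Hypothesis kkM : forall f1 f2, kk f1 -> kk f2 -> kk (fun p => f1 p * f2 p).
Hypothesis kkG : forall i j m, kk (fun=> (G i j)@_m).
Hypothesis kkg : forall j, kk (fun p => (g j).@[vv p]).
Hypothesis szG : forall i j, (msize (G i j) <= D i)%N.
Hypothesis GE : forall p i, vv p i ^+ D i = \sum_j (G i j).@[vv p] * (g j).@[vv p].

Definition red_bound := (\sum_i D i).+1.

(** A monomial of degree above the sum of the [D i] is divisible by some x_i^(D i). Replacing that
    power by the combination of the g_j lowers the degree, at the price of scalars g_j(v). The
    abstract ring [kk] of scalar functions allows two uses: a single generic point, with scalars in
    a closed subfield, and all points of height one, with constant scalars. *)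
Lemma monomials_reduce (m : 'X_{1..n}) :
  exists c : 'X_{1..n < red_bound} -> Pt -> K, (forall b, kk (c b)) /\
    forall p, monv (vv p) m = \sum_b c b p * monv (vv p) (bmnm b).
Proof.
pose Q (f : Pt -> K) := exists c : 'X_{1..n < red_bound} -> Pt -> K, (forall b, kk (c b)) /\
    forall p, f p = \sum_b c b p * monv (vv p) (bmnm b).
have Q0 : Q (fun=> 0).
  by exists (fun _ _ => 0); split=> // p; rewrite big1 // => b _; rewrite mul0r.
have QD f1 f2 : Q f1 -> Q f2 -> Q (fun p => f1 p + f2 p).
  move=> [c1 [h1 e1]] [c2 [h2 e2]]; exists (fun b p => c1 b p + c2 b p); split.
    by move=> b; apply: kkD.
  by move=> p; rewrite e1 e2 -big_split; apply: eq_bigr => b _; rewrite mulrDl.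
have QZ f1 f2 : kk f1 -> Q f2 -> Q (fun p => f1 p * f2 p).
  move=> h [c [h1 e1]]; exists (fun b p => f1 p * c b p); split.
    by move=> b; apply: kkM.
  by move=> p; rewrite e1 mulr_sumr; apply: eq_bigr => b _; rewrite mulrA.
have Qsum (T : eqType) (s : seq T) (F : T -> Pt -> K) :
    (forall t, t \in s -> Q (F t)) -> Q (fun p => \sum_(t <- s) F t p).
  elim: s => [|t s IH] h.
    suff -> : (fun p => \sum_(t <- [::]) F t p) = (fun=> 0) by [].
    by apply: funext => p; rewrite big_nil.
  suff -> : (fun p => \sum_(t <- t :: s) F t p) =
      (fun p => F t p + \sum_(t <- s) F t p).
    by apply: QD; [apply: h; rewrite inE eqxx|apply: IH => x xs; apply: h; rewrite inE xs orbT].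
  by apply: funext => p; rewrite big_cons.
suff : forall k m, (mdeg m < k)%N -> Q (fun p => monv (vv p) m).
  by move=> h; apply: (h (mdeg m).+1).
move=> k; elim: k => // k IH {}m hm.
have [hb|hb] := ltnP (mdeg m) red_bound.
  exists (fun b _ => (b == BMultinom hb)%:R); split.
    by move=> b; case: eqP.
  move=> p; rewrite (bigD1 (BMultinom hb)) //= eqxx mul1r big1 ?addr0 //.
  by move=> b /negPf ->; rewrite mul0r.
have [i hi] : exists i, (D i <= m i)%N.
  apply/existsP; rewrite -[[exists _, _]]negbK negb_exists; apply/negP => /forallP h.
  move: hb; rewrite /red_bound ltnNge => /negP; apply; rewrite mdegE.
  by apply: leq_sum => i _; rewrite ltnW // ltnNge.
pose m' := (m - U_(i) *+ D i)%MM.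
have em : m = (m' + U_(i) *+ D i)%MM.
  rewrite /m' submK //; apply/mnm_lepP => l; rewrite mulmnE mnm1E.
  by case: eqP => [<-|_]; rewrite ?mul1n ?mul0n.
have dm : mdeg m = (mdeg m' + D i)%N by rewrite {1}em mdegD mdegMn mdeg1 mul1n.
have -> : (fun p => monv (vv p) m) = (fun p => \sum_(j <- enum 'I_r) (g j).@[vv p] *
    \sum_(x <- msupp (G i j)) (G i j)@_x * monv (vv p) (m' + x)%MM).
  apply: funext => p; rewrite {1}em monvD monvMn GE mulr_sumr big_enum /=.
  apply: eq_bigr => j _; rewrite mulrA mulrC; congr (_ * _).
  rewrite [in LHS](mpolyE (G i j)) raddf_sum mulr_sumr; apply: eq_bigr => x _ /=.
  by rewrite mevalZ monvD mulrCA.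
apply: (Qsum) => j _; apply: (QZ (fun p => (g j).@[vv p])) => //.
apply: Qsum => x xG; apply: (QZ (fun=> (G i j)@_x)) => //.
apply: IH; have := msize_mdeg_lt xG; have := szG i j.
by rewrite mdegD; move: hm; rewrite dm; lia.
Qed.
End Spanning.

(** Otherwise, at a generic y, all monomials lie in a finite-dimensional space over the closure of
    the values g_j(y). These r values cannot make n independent coordinates algebraic, so some
    coordinate is moved by a derivation killing them, and its powers take infinitely many orders. *)
Lemma common_zero : (r < n)%N ->
  exists v : 'I_n -> K, (forall j, (g j).@[v] = 0) /\ exists i, v i != 0.
Proof.
move=> rn; apply: contrapT => none.
have triv : only_trivial_zero.
  move=> v hv i; apply/eqP/negPn/negP => vi; apply: none; exists v.
  by split=> //; exists i.
have /boolp.choice [D hD] := fun i => homog_nullstellensatz i triv.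
have {hD} /boolp.choice [G hG] := hD.
pose coefs (p : {mpoly K[n]}) : seq K := [seq p@_m | m <- msupp p].
have coefs_cl (A : seq K) (p : {mpoly K[n]}) m : {subset coefs p <= A} -> cl A p@_m.
  move=> h; have [mp|mp] := boolP (m \in msupp p).
    by apply/cl_mem/h; apply: map_f.
  by rewrite memN_msupp_eq0 //; apply: cl0.
pose Ga := flatten [seq coefs (G ij.1 ij.2) | ij : 'I_n * 'I_r] ++
            flatten [seq coefs (g j) | j : 'I_r].
have [y hy] := exists_generic char0 uncount Ga n.
pose gl := [seq (g j).@[y] | j : 'I_r].
have : (0 < rk (gl ++ Ga) (codom y))%N.
  have := rk_sym Ga gl (codom y); rewrite hy.
  have szgl : size gl = r by rewrite size_map -cardE card_ord.
  by have := rk_size Ga gl; rewrite szgl; move: (rk Ga gl) (rk (gl ++ Ga) _) => u w; lia.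
case/rk_pos => _ /codomP [a ->] hz; have [E hE Ez] := ncl_der hz.
set A := gl ++ Ga in hz hE.
have GaA x : x \in Ga -> x \in A by move=> h; rewrite mem_cat h orbT.
pose S := [set: 'X_{1..n < red_bound D}].
suff : (#|S| < #|S|)%N by rewrite ltnn.
apply: (@has_order_bound K E hE.1 (fun v => exists s, v = y a ^+ s) _ S
   (fun b => monv y (bmnm b))); last by move=> s _; apply: has_order_powers => //; case: hE.
move=> _ [s ->].
have [||||||||c [hc ec]] := @monomials_reduce unit (fun=> y) (fun f => cl A (f tt)) D G
   _ _ _ _ _ _ _ _ (U_(a) *+ s)%MM.
- exact: cl1.
- exact: cl0.
- by move=> f1 f2; apply: clD.
- by move=> f1 f2; apply: clM.
- move=> i j m; apply: coefs_cl => x hx; apply: GaA; rewrite mem_cat; apply/orP; left.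
  by apply/flattenP; exists (coefs (G i j)) => //; apply: (image_f (fun ij => coefs (G ij.1 ij.2)) (x := (i, j))).
- by move=> j; apply: cl_mem; rewrite mem_cat; apply/orP; left; apply: image_f.
- by move=> i; case: (hG i).
- by move=> p i; case: (hG i).
exists (fun b => c b tt); first by move=> b; apply: hc.
rewrite -monvMn (ec tt); apply: eq_bigl => b; by rewrite inE.
Qed.

(* [h] plays the role of the hyperplane at infinity. *)
Lemma finite_at_height_one (h : 'I_r) : only_trivial_zero ->
  forall i, exists2 P : {poly K}, P != 0 &
   forall v, (forall j, j != h -> (g j).@[v] = 0) -> (g h).@[v] = 1 -> P.[v i] = 0.
Proof.
move=> triv a.
have /boolp.choice [D hD] := fun i => homog_nullstellensatz i triv.
have {hD} /boolp.choice [G hG] := hD.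
pose Pt := {v : 'I_n -> K | (forall j, j != h -> (g j).@[v] = 0) /\ (g h).@[v] = 1}.
pose kk (f : Pt -> K) := exists c, forall p, f p = c.
have red s : exists c : 'X_{1..n < red_bound D} -> K,
    forall p : Pt, sval p a ^+ s = \sum_b c b * monv (sval p) (bmnm b).
  have [||||||||c [hc ec]] := @monomials_reduce Pt sval kk D G
     _ _ _ _ _ _ _ _ (U_(a) *+ s)%MM.
  - by exists 1.
  - by exists 0.
  - by move=> f1 f2 [c1 h1] [c2 h2]; exists (c1 + c2) => p; rewrite h1 h2.
  - by move=> f1 f2 [c1 h1] [c2 h2]; exists (c1 * c2) => p; rewrite h1 h2.
  - by move=> i j m; exists (G i j)@_m.
  - move=> j; have [->|jh] := eqVneq j h; first by exists 1 => p; case: (svalP p).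
    by exists 0 => p; case: (svalP p) => h1 _; apply: h1.
  - by move=> i; case: (hG i).
  - by move=> p i; case: (hG i).
  have [c' hc'] := boolp.choice hc; exists c' => p.
  by rewrite -monvMn ec; apply: eq_bigr => b _; rewrite hc'.
have [c hc] := boolp.choice red.
pose d := #|{: 'X_{1..n < red_bound D}}|.
(* The first d + 1 powers of the coordinate are expressed by d monomials with coefficients
   independent of the point, so a kernel vector gives one polynomial relation valid at all the
   points. *)
pose M := \matrix_(s < d.+1, b < d) c s (enum_val b).
have : kermx M != 0.
  rewrite kermx_eq0 -row_leq_rank -ltnNge.
  by apply: leq_ltn_trans (rank_leq_col M) _.
case/rowV0Pn => x /sub_kermxP xM x0.
exists (\poly_(s < d.+1) x 0 (inord s)).
  apply: contra x0 => /eqP e1; apply/eqP/rowP => s; rewrite mxE.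
  have := congr1 (fun p : {poly K} => p`_s) e1.
  by rewrite coef_poly ltn_ord coef0 inord_val.
move=> v hv1 hv2; pose p : Pt := exist _ v (conj hv1 hv2).
rewrite horner_poly; transitivity (\sum_(s < d.+1) x 0 s * sval p a ^+ s).
  by apply: eq_bigr => s _; rewrite inord_val.
under eq_bigr => s _ do rewrite hc mulr_sumr.
rewrite exchange_big big1 //= => b _.
transitivity ((x *m M) 0 (enum_rank b) * monv v (bmnm b)).
  rewrite mxE mulr_suml; apply: eq_bigr => s _.
  by rewrite mxE enum_rankK mulrA.
by rewrite xM mxE mul0r.
Qed.
End Homogeneous.

End Nullstellensatz.

(** * First-order definability *)

Section Definability.
Variable K : closedFieldType.
Local Notation form := (GRing.formula K).
Local Notation term := (GRing.term K).

Definition env n (e : seq K) : 'I_n -> K := fun i => e`_i.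
Arguments env n e : clear implicits.

(** [rformula] excludes inverses: atoms are polynomial equations, to which quantifier elimination
    over a closed field applies. *)
Definition definable n (P : ('I_n -> K) -> Prop) :=
  exists2 f : form, GRing.rformula f & forall e, GRing.holds e f <-> P (env n e).

Definition polyfun n (g : ('I_n -> K) -> K) :=
  exists2 t : term, GRing.rterm t & forall e, GRing.eval e t = g (env n e).

Lemma polyfun_ext n (g1 g2 : ('I_n -> K) -> K) : g1 =1 g2 -> polyfun g1 -> polyfun g2.
Proof. by move=> h [t rt ht]; exists t => // e; rewrite ht h. Qed.

Lemma polyfun_const n c : @polyfun n (fun=> c).
Proof. by exists (GRing.Const c). Qed.

Lemma polyfun_var n i : @polyfun n (fun v => v i).
Proof. by exists (GRing.Var K i). Qed.

Lemma polyfunD n (g1 g2 : ('I_n -> K) -> K) :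
  polyfun g1 -> polyfun g2 -> polyfun (fun v => g1 v + g2 v).
Proof.
move=> [t1 r1 h1] [t2 r2 h2]; exists (GRing.Add t1 t2); rewrite /= ?r1 //.
by move=> e; rewrite h1 h2.
Qed.

Lemma polyfunM n (g1 g2 : ('I_n -> K) -> K) :
  polyfun g1 -> polyfun g2 -> polyfun (fun v => g1 v * g2 v).
Proof.
move=> [t1 r1 h1] [t2 r2 h2]; exists (GRing.Mul t1 t2); rewrite /= ?r1 //.
by move=> e; rewrite h1 h2.
Qed.

Lemma polyfun_sum n (I : Type) (r : seq I) (P : pred I) (g : I -> ('I_n -> K) -> K) :
  (forall i, P i -> polyfun (g i)) -> polyfun (fun v => \sum_(i <- r | P i) g i v).
Proof.
move=> h; elim: r => [|i r IH].
  by apply: polyfun_ext (polyfun_const n 0) => v; rewrite big_nil.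
apply: (@polyfun_ext n (fun v => if P i then g i v + \sum_(j <- r | P j) g j v
  else \sum_(j <- r | P j) g j v)) => [v|]; first by rewrite big_cons.
by case Pi : (P i) => //; apply: polyfunD => //; apply: h.
Qed.

Lemma polyfun_prod n (I : Type) (r : seq I) (P : pred I) (g : I -> ('I_n -> K) -> K) :
  (forall i, P i -> polyfun (g i)) -> polyfun (fun v => \prod_(i <- r | P i) g i v).
Proof.
move=> h; elim: r => [|i r IH].
  by apply: polyfun_ext (polyfun_const n 1) => v; rewrite big_nil.
apply: (@polyfun_ext n (fun v => if P i then g i v * \prod_(j <- r | P j) g j v
  else \prod_(j <- r | P j) g j v)) => [v|]; first by rewrite big_cons.
by case Pi : (P i) => //; apply: polyfunM => //; apply: h.
Qed.

Lemma polyfunX n (g : ('I_n -> K) -> K) k : polyfun g -> polyfun (fun v => g v ^+ k).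
Proof.
by move=> [t rt ht]; exists (GRing.Exp t k) => //= e; rewrite ht.
Qed.

Lemma definable_ext n (P Q : ('I_n -> K) -> Prop) :
  (forall v, P v <-> Q v) -> definable P -> definable Q.
Proof. by move=> h [f rf hf]; exists f => // e; rewrite hf h. Qed.

Lemma definable_eq n (g1 g2 : ('I_n -> K) -> K) :
  polyfun g1 -> polyfun g2 -> definable (fun v => g1 v = g2 v).
Proof.
move=> [t1 r1 h1] [t2 r2 h2]; exists (GRing.Equal t1 t2); rewrite /= ?r1 //.
by move=> e; rewrite h1 h2.
Qed.

Lemma definable_not n (P : ('I_n -> K) -> Prop) :
  definable P -> definable (fun v => ~ P v).
Proof. by move=> [f rf hf]; exists (GRing.Not f) => // e /=; rewrite hf. Qed.

Lemma definable_imp n (P Q : ('I_n -> K) -> Prop) :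
  definable P -> definable Q -> definable (fun v => P v -> Q v).
Proof.
move=> [f rf hf] [g rg hg]; exists (GRing.Implies f g); rewrite /= ?rf //.
by move=> e; rewrite /= hf hg.
Qed.

Lemma definable_and n (P Q : ('I_n -> K) -> Prop) :
  definable P -> definable Q -> definable (fun v => P v /\ Q v).
Proof.
move=> [f rf hf] [g rg hg]; exists (GRing.And f g); rewrite /= ?rf //.
by move=> e; rewrite /= hf hg.
Qed.

Lemma definable_true n : @definable n (fun=> True).
Proof. by exists (GRing.Bool true). Qed.

Lemma definable_all n (I : finType) (P : I -> ('I_n -> K) -> Prop) :
  (forall i, definable (P i)) -> definable (fun v => forall i, P i v).
Proof.
move=> h.
apply: (@definable_ext n (fun v => forall i, i \in enum I -> P i v)).
  by move=> v; split=> [hv i|hv i _ //]; apply: hv; rewrite mem_enum.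
elim: (enum I) => [|i r IH].
  by apply: definable_ext (definable_true n) => v; split.
apply: definable_ext (definable_and (h i) IH) => v; split.
  by move=> [h1 h2] j; rewrite inE => /orP [/eqP->|/h2].
by move=> hv; split=> [|j jr]; apply: hv; rewrite inE ?eqxx ?jr ?orbT.
Qed.

Fixpoint setv (e : seq K) i (w : seq K) : seq K :=
  if w is x :: w' then setv (set_nth 0 e i x) i.+1 w' else e.

Lemma nth_setv e i w j :
  (setv e i w)`_j = if (i <= j < i + size w)%N then w`_(j - i) else e`_j.
Proof.
elim: w e i => [|x w IH] e i /=.
  by rewrite addn0; case: ifP => // /andP [h1 h2]; lia.
rewrite IH nth_set_nth /= addSnnS.
have [->|ji] := eqVneq j i; first by rewrite ltnn /= leqnn subnn /= ifT //; lia.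
have [h|h] := boolP (i < j < i + (size w).+1)%N; last first.
  by rewrite ifF //; apply/negbTE; apply: contra h => /andP [h1 ->]; rewrite ltn_neqAle eq_sym ji h1.
by have /andP [h1 h2] := h; rewrite (ltnW h1) h2 /= -(subnSK h1).
Qed.

(** The m quantified variables occupy the positions n, ..., n + m - 1, just after the free ones. *)
Lemma definable_ex n m (Q : ('I_n -> K) -> ('I_m -> K) -> Prop) :
  definable (fun u : 'I_(n + m) -> K => Q (u \o lshift m) (u \o @rshift n m)) ->
  definable (fun v => exists w, Q v w).
Proof.
move=> [f rf hf]; pose ex := foldr (fun i g => GRing.Exists i g) f (iota n m).
have rex : GRing.rformula ex by rewrite /ex; elim: (iota n m).
have hex e : GRing.holds e ex <-> exists w, size w = m /\ GRing.holds (setv e n w) f.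
  rewrite /ex; elim: m n e {Q hf ex rex} => [|m IH] n e /=.
    split=> [h|[w [/size0nil -> //]]]; by exists [::].
  split.
    by move=> [x /IH [w [sw h]]]; exists (x :: w); rewrite /= sw.
  case=> [[|x w]] /= [sw h] //; case: sw => sw.
  by exists x; apply/IH; exists w.
exists ex => // e; rewrite hex.
have E w : size w = m -> (env (n + m) (setv e n w) \o lshift m = env n e) /\
    (env (n + m) (setv e n w) \o @rshift n m = fun t => w`_t).
  move=> sw; split; apply: funext => i; rewrite /env /= nth_setv.
    by rewrite leqNgt ltn_ord.
  by rewrite leq_addr ltn_add2l sw ltn_ord addKn.
split=> [[w [sw]]|[w hw]].
  by rewrite hf; have [-> ->] := E w sw => h; exists (fun t => w`_t).
have sw : size (codom w) = m by rewrite size_codom card_ord.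
exists (codom w); split=> //; rewrite hf; have [-> ->] := E _ sw.
suff -> : (fun t : 'I_m => (codom w)`_t) = w by [].
apply: funext => t; rewrite (nth_map t) ?size_enum_ord //; congr w.
exact: (nth_ord_enum t t).
Qed.

Lemma definable_forall n m (Q : ('I_n -> K) -> ('I_m -> K) -> Prop) :
  definable (fun u : 'I_(n + m) -> K => Q (u \o lshift m) (u \o @rshift n m)) ->
  definable (fun v => forall w, Q v w).
Proof.
move=> h.
have /definable_not := @definable_ex n m (fun v w => ~ Q v w) (definable_not h).
apply: definable_ext => v; split=> [h' w|h' [w]]; last by apply.
by apply: contrapT => hw; apply: h'; exists w.
Qed.

(** Variables beyond n become 0, in agreement with the default value used when a term is evaluated
    in a list of length n. Inverses get a dummy value and are ruled out by [rterm]. *)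
Fixpoint term_mpoly n (t : term) : {mpoly K[n]} :=
  match t with
  | GRing.Var i => if insub i is Some j then 'X_(j : 'I_n) else 0
  | GRing.Const c => c%:MP
  | GRing.NatConst k => k%:R%:MP
  | GRing.Add t1 t2 => term_mpoly n t1 + term_mpoly n t2
  | GRing.Opp t1 => - term_mpoly n t1
  | GRing.NatMul t1 k => term_mpoly n t1 *+ k
  | GRing.Mul t1 t2 => term_mpoly n t1 * term_mpoly n t2
  | GRing.Inv _ => 0
  | GRing.Exp t1 k => term_mpoly n t1 ^+ k
  end.

Lemma nth_codom n (v : 'I_n -> K) (i : 'I_n) : (codom v)`_i = v i.
Proof.
rewrite (nth_map i) ?size_enum_ord //; congr v; exact: (nth_ord_enum i i).
Qed.

Lemma env_codom n (v : 'I_n -> K) : env n (codom v) = v.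
Proof. by apply: funext => i; rewrite /env nth_codom. Qed.

Lemma term_mpolyE n (t : term) (v : 'I_n -> K) : GRing.rterm t ->
  GRing.eval (codom v) t = (term_mpoly n t).@[v].
Proof.
elim: t => //=.
- move=> i _; case: insubP => [j ij <-|ni]; first by rewrite nth_codom mevalXU.
  by rewrite meval0 nth_default // size_codom card_ord leqNgt.
- by move=> c _; rewrite mevalC.
- by move=> c _; rewrite mevalC.
- by move=> t1 IH1 t2 IH2 /andP [r1 r2]; rewrite mevalD IH1 // IH2.
- by move=> t1 IH1 r1; rewrite mevalN IH1.
- by move=> t1 IH1 k r1; rewrite mevalMn IH1.
- by move=> t1 IH1 t2 IH2 /andP [r1 r2]; rewrite mevalM IH1 // IH2.
- by move=> t1 IH1 k r1; rewrite rmorphXn /= IH1.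
Qed.

(** Off the zeros of the product of the atoms that are not identities, each atom has a fixed truth
    value, and so has the formula. *)
Lemma qf_generic n (f : form) : GRing.qf_form f -> GRing.rformula f ->
  exists2 s : {mpoly K[n]}, s != 0 & exists b, forall v, s.@[v] != 0 ->
    GRing.qf_eval (codom v) f = b.
Proof.
have bin (f1 f2 : form) (op : bool -> bool -> bool) :
    (exists2 s : {mpoly K[n]}, s != 0 & exists b, forall v, s.@[v] != 0 ->
      GRing.qf_eval (codom v) f1 = b) ->
    (exists2 s : {mpoly K[n]}, s != 0 & exists b, forall v, s.@[v] != 0 ->
      GRing.qf_eval (codom v) f2 = b) ->
    exists2 s : {mpoly K[n]}, s != 0 & exists b, forall v, s.@[v] != 0 ->
      op (GRing.qf_eval (codom v) f1) (GRing.qf_eval (codom v) f2) = b.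
  move=> [s1 n1 [b1 h1]] [s2 n2 [b2 h2]]; exists (s1 * s2); first by rewrite mulf_neq0.
  exists (op b1 b2) => v; rewrite mevalM mulf_eq0 negb_or => /andP [v1 v2].
  by rewrite h1 ?h2.
elim: f => //=.
- by move=> b _ _; exists 1; rewrite ?oner_neq0 //; exists b.
- move=> t1 t2 _ /andP [r1 r2]; pose p := term_mpoly n t1 - term_mpoly n t2.
  have E v : (GRing.eval (codom v) t1 == GRing.eval (codom v) t2) = (p.@[v] == 0).
    by rewrite !term_mpolyE // mevalB subr_eq0.
  have [p0|p0] := eqVneq p 0.
    exists 1; rewrite ?oner_neq0 //; exists true => v _.
    by rewrite E p0 meval0 eqxx.
  by exists p => //; exists false => v /negPf pv; rewrite E.
- by move=> f1 IH1 f2 IH2 /andP [q1 q2] /andP [r1 r2]; apply: (bin f1 f2 andb); auto.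
- by move=> f1 IH1 f2 IH2 /andP [q1 q2] /andP [r1 r2]; apply: (bin f1 f2 orb); auto.
- by move=> f1 IH1 f2 IH2 /andP [q1 q2] /andP [r1 r2]; apply: (bin f1 f2 implb); auto.
- move=> f1 IH1 q1 r1; have [s s0 [b hb]] := IH1 q1 r1.
  by exists s => //; exists (~~ b) => v /hb ->.
Qed.

Lemma definable_generic n (P : ('I_n -> K) -> Prop) : definable P ->
  exists2 s : {mpoly K[n]}, s != 0 &
    (forall v, s.@[v] != 0 -> P v) \/ (forall v, s.@[v] != 0 -> ~ P v).
Proof.
move=> [f rf hf]; pose g := GRing.quantifier_elim (@ClosedFieldQE.ex_elim K) f.
have wf := @ClosedFieldQE.wf_ex_elim K.
have ok := @ClosedFieldQE.holds_ex_elim K (@solve_monicpoly K).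
have /andP [qg rg] := GRing.quantifier_elim_wf wf rf.
have [s s0 [b hb]] := qf_generic n qg rg; exists s => //.
have E v : P v <-> GRing.qf_eval (codom v) g.
  rewrite -{1}(env_codom v) -hf; split.
    by move=> h; apply/(GRing.quantifier_elim_rformP wf ok _ rf).
  by move/(GRing.quantifier_elim_rformP wf ok _ rf).
by case: b hb => hb; [left|right] => v /hb; rewrite E => ->.
Qed.

End Definability.

(** * Affine charts *)

Section LocalCoefficients.
Variable K : closedFieldType.
Hypothesis char0 : forall n, n.+1%:R != 0 :> K.
Hypothesis uncount : forall f : nat -> seq K, exists z, forall n, z \notin f n.
Implicit Types (A : seq K).

Definition clp A n (p : {mpoly K[n]}) := forall m, cl A p@_m.

Lemma clpC A n c : cl A c -> clp A (c%:MP_[n]).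
Proof.
by move=> h m; rewrite mcoeffC; case: eqP => _; rewrite ?mulr1 // mulr0; apply: cl0.
Qed.

Lemma clpX A n m : clp A ('X_[m] : {mpoly K[n]}).
Proof. by move=> m'; rewrite mcoeffX; case: eqP => _; [apply: cl1|apply: cl0]. Qed.

Lemma clpD A n (p q : {mpoly K[n]}) : clp A p -> clp A q -> clp A (p + q).
Proof. by move=> hp hq m; rewrite mcoeffD; apply: clD. Qed.

Lemma clpM A n (p q : {mpoly K[n]}) : clp A p -> clp A q -> clp A (p * q).
Proof. by move=> hp hq m; rewrite mcoeffM; apply: cl_sum => x _; apply: clM. Qed.

Lemma clp1 A n : clp A (1 : {mpoly K[n]}).
Proof. by rewrite -mpolyC1; apply/clpC/cl1. Qed.

Lemma clp0 A n : clp A (0 : {mpoly K[n]}).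
Proof. by rewrite -mpolyC0; apply/clpC/cl0. Qed.

Lemma clp_exp A n (p : {mpoly K[n]}) k : clp A p -> clp A (p ^+ k).
Proof.
by move=> h; elim: k => [|k IH]; rewrite ?exprS ?expr0; [apply: clp1|apply: clpM].
Qed.

Lemma clp_prod A n (I : Type) (r : seq I) (F : I -> {mpoly K[n]}) :
  (forall i, clp A (F i)) -> clp A (\prod_(i <- r) F i).
Proof. by move=> h; apply: big_ind => //; [apply: clp1|apply: clpM]. Qed.

Definition degle n (e : nat) (p : {mpoly K[n]}) := forall m, (e < mdeg m)%N -> p@_m = 0.

Lemma degleM n e1 e2 (p q : {mpoly K[n]}) :
  degle e1 p -> degle e2 q -> degle (e1 + e2) (p * q).
Proof.
move=> hp hq m hm; rewrite mcoeffM big1 // => x /eqP e.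
have [h|h] := ltnP e1 (mdeg (bmnm x.1)); first by rewrite hp // mul0r.
have em : mdeg m = (mdeg (bmnm x.1) + mdeg (bmnm x.2))%N by rewrite {1}e mdegD.
have aux (a b c : nat) : (e1 + e2 < c -> c = a + b -> a <= e1 -> e2 < b)%N by lia.
by rewrite hq ?mulr0 //; apply: aux hm em h.
Qed.

Lemma degleC n c : degle 0 (c%:MP_[n]).
Proof.
by move=> m; rewrite lt0n mdeg_eq0 mcoeffC => /negPf ->; rewrite mulr0.
Qed.

Lemma mcoeff0_meval n (p : {mpoly K[n]}) : p@_0%MM = p.@[fun=> 0].
Proof.
rewrite [p in RHS]mpolyE raddf_sum /=.
have E m : (p@_m *: 'X_[m]).@[fun=> 0 : K] = p@_m * (m == 0%MM)%:R.
  rewrite mevalZ mevalX; congr (_ * _).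
  have [->|m0] := eqVneq m 0%MM; first by rewrite big1 // => i _; rewrite mnm0E expr0.
  have [i mi] : exists i, m i != 0%N.
    apply/existsP; rewrite -negb_forall; apply: contra m0 => /forallP h0.
    by apply/eqP/mnmP => i; rewrite mnm0E; apply/eqP.
  by rewrite (bigD1 i) //= expr0n (negPf mi) mul0r.
under eq_bigr do rewrite E.
have [h|h] := boolP (0%MM \in msupp p).
  rewrite (bigD1_seq 0%MM) ?msupp_uniq //= eqxx mulr1 big1 ?addr0 // => m /negPf ->.
  by rewrite mulr0.
rewrite memN_msupp_eq0 // big_seq big1 // => m mp.
by case: eqP => [e|_]; rewrite ?mulr0 //; rewrite -e mp in h.
Qed.

Section Chart.
Variables (N : nat) (j : 'I_N.+1) (x : 'I_N.+1 -> K).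

(** This is [chart_subst] with the chart index j as a parameter and the point already normalised, so
    that a formula can quantify over both. *)
Definition gsubst : N.+1.-tuple {mpoly K[N]} :=
  [tuple (x t)%:MP + (if unlift j t is Some s then 'X_s else 0) | t < N.+1].

Definition loc (F : {mpoly K[N.+1]}) : {mpoly K[N]} := F \mPo gsubst.

Definition smono (m : 'X_{1..N.+1}) : {mpoly K[N]} :=
  \prod_(t < N.+1) tnth gsubst t ^+ m t.

Lemma locE (F : {mpoly K[N.+1]}) : loc F = \sum_(m <- msupp F) F@_m *: smono m.
Proof. by rewrite /loc comp_mpolyE. Qed.

Lemma clp_smono A m : (forall t, cl A (x t)) -> clp A (smono m).
Proof.
move=> hx; apply: clp_prod => t; apply: clp_exp; rewrite tnth_mktuple.
apply: clpD; first exact: clpC.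
by case: unlift => [s|]; [apply: clpX|apply: clp0].
Qed.

Lemma cl_loc A F : (forall t, cl A (x t)) -> clp A F -> clp A (loc F).
Proof.
move=> hx hF m; rewrite locE raddf_sum; apply: cl_sum => m' _ /=.
by rewrite mcoeffZ; apply: clM => //; apply: clp_smono.
Qed.

Lemma degle_smono m : degle (mdeg m) (smono m).
Proof.
rewrite mdegE /smono; elim/big_rec2: _ => [|t e p _ hp].
  by rewrite -mpolyC1; apply: degleC.
apply: degleM => //; rewrite tnth_mktuple.
elim: (m t) => [|k IH]; first by rewrite expr0 -mpolyC1; apply: degleC.
rewrite exprS -add1n; apply: degleM => // m' hm'.
rewrite mcoeffD (@degleC _ (x t)) ?(ltn_trans _ hm') // add0r.
case: unlift => [s|]; last by rewrite mcoeff0.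
rewrite mcoeffX; case: eqP => // e1; move: hm'; rewrite -e1 mdeg1 //.
Qed.

Lemma degle_loc d F : F \is d.-homog -> degle d (loc F).
Proof.
move=> hF m hm; rewrite locE raddf_sum big_seq big1 // => m' m'F /=.
rewrite mcoeffZ (degle_smono (m := m')) ?mulr0 //.
by rewrite (dhomogP _ _ _ hF _ m'F).
Qed.

Lemma loc0 F : (loc F)@_0%MM = F.@[x].
Proof.
rewrite mcoeff0_meval /loc comp_mpoly_meval; apply: meval_eq => t.
rewrite tnth_mktuple mevalD mevalC; case: unlift => [s|]; last by rewrite meval0 addr0.
by rewrite mevalXU addr0.
Qed.

(** A form is recovered from its dehomogenisation. Apply to the coefficients of F a derivation D
    over A: the result G is a form of the same degree, and its local equation is 0 because the
    substitution is constant for D. Hence G vanishes wherever the j-th coordinate is nonzero, in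
    particular at a generic point. *)
Lemma cl_from_loc A d F : x j = 1 -> (forall t, cl A (x t)) -> F \is d.-homog ->
  clp A (loc F) -> clp A F.
Proof.
move=> xj hx hF hl m D hD.
have [mF|mF] := boolP (m \in msupp F); last by rewrite memN_msupp_eq0 // (der0 hD.1).
pose G : {mpoly K[N.+1]} := \sum_(m <- msupp F) D (F@_m) *: 'X_[m].
have Gm : G@_m = D (F@_m).
  rewrite /G raddf_sum (bigD1_seq m) ?msupp_uniq //= mcoeffZ mcoeffX eqxx mulr1.
  rewrite big1 ?addr0 // => m' /negPf h; rewrite mcoeffZ mcoeffX h mulr0 //.
suff G0 : G = 0 by rewrite -Gm G0 mcoeff0.
have hG : G \is d.-homog.
  rewrite /G big_seq; apply: rpred_sum => m' m'F; apply: rpredZ.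
  by rewrite dhomogX; apply/eqP; apply: (dhomogP _ _ _ hF _ m'F).
have Gloc : G \mPo gsubst = 0.
  apply/mpolyP => m'; rewrite mcoeff0.
  have := hl m' D hD; rewrite locE raddf_sum (der_sum _ _ _ hD.1) => e.
  rewrite /G (raddf_sum (comp_mpoly gsubst)) raddf_sum; apply: etrans e; apply: eq_bigr => m1 _ /=.
  rewrite comp_mpolyZ comp_mpolyX !mcoeffZ (derM _ _ hD.1).
  by rewrite (@clp_smono A m1 hx m' D hD) mulr0 addr0.
have Gv (v : 'I_N.+1 -> K) : v j != 0 -> G.@[v] = 0.
  move=> vj; pose z s := (v j)^-1 * v (lift j s) - x (lift j s).
  have -> : G.@[v] = G.@[fun t => v j * (tnth gsubst t).@[z]].
    apply: meval_eq => t; rewrite tnth_mktuple mevalD mevalC.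
    case: unliftP => [s ->|->]; last by rewrite meval0 addr0 xj mulr1.
    by rewrite mevalXU /z addrC subrK mulrA mulfV // mul1r.
  by rewrite (homog_meval _ _ hG) -comp_mpoly_meval Gloc meval0 mulr0.
have [v hv] := exists_generic char0 uncount [seq G@_m | m <- msupp G] N.+1.
apply: (rk_full_free char0 hv).
  move=> m'; have [m'G|m'G] := boolP (m' \in msupp G).
    by apply: cl_mem; apply: map_f.
  by rewrite memN_msupp_eq0 //; apply: cl0.
apply: Gv; apply/eqP => vj.
have [E hE Ev] := rk_full_dual j hv.
have := Ev j; rewrite vj (der0 hE.1) eqxx => /esym /eqP.
by rewrite oner_eq0.
Qed.

End Chart.
End LocalCoefficients.

(** * The inequalities that contradict the count *)

Section Arithmetic.
Local Open Scope nat_scope.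

(** B is the dimension of the span of y. On the left of the inequality q stands for the vanishing
    constant terms, [k * B] for the gain of the linear blocks and G for that of the others; on the
    right are the parameters of the point and of the span. *)
Lemma gain_budget (M k N B q G : nat) : N = M + k -> B <= M -> k <= q ->
  q + k * B + G <= N + (N - B) * B -> G <= M + (M - B) * B.
Proof.
move=> -> BM kq h; have e : (M + k - B) * B = (M - B) * B + k * B.
  by rewrite -mulnDl; congr (_ * _); lia.
by move: h; rewrite e; move: ((M - B) * B) (k * B) => u w; lia.
Qed.

(** The rank of y falls from at most B - 1 to no less than 2, so at most B - 3 of the M - 2 blocks
    lower it. The other M - B + 1 or more gain B + 1 each, and (B + 1)(M - B + 1) exceeds the budget
    by one. *)
Lemma surface_arithmetic (M B G2 G3 t2 t3 l2 l3 e e0 em e5 : nat) :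
  B <= M -> G2 + G3 <= M + (M - B) * B -> 1 < e -> e <= e5 -> l2 + l3 = M - 2 ->
  t2 <= l2 -> t3 <= l3 -> l2 - t2 + em <= e0 -> l3 - t3 + e5 <= em -> e0 < B ->
  B.+1 * t2 <= G2 -> B.+1 * t3 <= G3 -> False.
Proof.
move=> BM hG e1 e5e lM t2l t3l h2 h3 e0B g2 g3.
have ht : M - B + 1 <= t2 + t3 by lia.
have h : B.+1 * (M - B + 1) <= G2 + G3.
  apply: leq_trans (leq_add g2 g3); rewrite -mulnDr leq_mul2l ht orbT //.
have : B.+1 * (M - B + 1) = (M - B) * B + M + 1.
  by rewrite mulSn mulnDr muln1 mulnC; lia.
by move: hG h; move: ((M - B) * B) => u; lia.
Qed.

(** At least M - B blocks do not lower the rank, and each gains 2(B - 1) + 1 or more, which is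
    enough if 2 < B < M - 1. If B = 2, no block lowers the rank and the many blocks of degree at
    least 3 gain 4 each. If B = M - 1, one such block suffices; if all of them lower the rank, it is
    at least M - 1 - k after the quadrics, and the binomial bound for a quadric decides. *)
Lemma curve_arithmetic (M k B G2 G3 t2 t3 l2 l3 e0 em e5 : nat) :
  2 <= k -> 3 * k + 4 <= M -> B < M -> G2 + G3 <= M + (M - B) * B -> 1 <= e5 ->
  l2 <= k -> l2 + l3 = M - 2 ->
  t2 <= l2 -> t3 <= l3 -> l2 - t2 + em <= e0 -> l3 - t3 + e5 <= em -> e0 < B ->
  maxn (2 * B.-1).+1 'C(em.+2, 2) * t2 <= G2 -> (3 * B.-1).+1 * t3 <= G3 -> False.
Proof.
move=> k2 HM BM hG e5p l2k lM t2l t3l h2 h3 e0B g2 g3.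
have [b eB] : exists b, B = b.+2 by exists (B - 2); lia.
subst B; rewrite /= in g2 g3 hG.
have [c eM] : exists c, M = b.+2 + c.+1 by exists (M - b.+3); lia.
have eMB : M - b.+2 = c.+1 by lia.
rewrite eMB in hG.
have ht : c.+1 <= t2 + t3 by lia.
have g2' : (2 * b.+1).+1 * t2 <= G2.
  by apply: leq_trans g2; rewrite leq_mul2r leq_maxl orbT.
have [b0|b0] := posnP b.
  subst b; have [e2 e3] : t2 = l2 /\ t3 = l3 by lia.
  by subst t2 t3; rewrite /= in g2' g3; lia.
have [c0|c0] := posnP c; last first.
  have : (2 * b.+1).+1 * c.+1 <= G2 + G3.
    apply: leq_trans (leq_add g2' g3); apply: leq_trans (_ : (2 * b.+1).+1 * (t2 + t3) <= _).
      by rewrite leq_mul2l ht orbT.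
    by rewrite mulnDr leq_add2l leq_mul2r; apply/orP; right; lia.
  by nia.
subst c; rewrite mul1n in hG.
have [t30|t30] := posnP t3; last by nia.
subst t3; have t2p : 0 < t2 by lia.
have g2q : 'C(em.+2, 2) <= G2.
  apply: leq_trans g2; apply: leq_trans (leq_pmulr _ t2p); exact: leq_maxr.
have hem : M - 1 - k <= em by lia.
have : 'C(em.+2, 2).*2 = em.+2 * em.+1.
  by rewrite bin2 -[RHS]odd_double_half oddM /=; case: (odd em).
by nia.
Qed.
End Arithmetic.

(** * The parameter count *)

Section Counting.
Variable K : closedFieldType.
Hypothesis char0 : forall n, n.+1%:R != 0 :> K.
Variables (N k bd : nat) (d : 'I_k -> nat).
Variable c : 'I_k -> 'X_{1..N} -> K.
Variables Fl xl : seq K.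
Local Notation blk := ('I_k * nat)%type.
Implicit Types (L : seq blk) (A : seq K) (y : 'I_N -> K).

(** A block (i, j) stands for the homogeneous part q_{i,j}, with coefficients c. [Fl] and [xl] stand
    for the coefficients of F and the coordinates of the point. *)
Definition nmono (j : nat) : nat := #|degset N bd j|.
Definition cfb (b : blk) : seq K := [seq c b.1 (bmnm m) | m in degset N bd b.2].
Definition cf L : seq K := flatten (map cfb L).
Definition weight L : nat := (\sum_(b <- L) nmono b.2)%N.
Definition all_blocks : seq blk :=
  [seq (i, j) | i <- enum 'I_k, j <- iota 0 (d i).+1].
Definition blocks j : seq blk := [seq (i, j) | i <- enum 'I_k].

Lemma cf_cat L1 L2 : cf (L1 ++ L2) = cf L1 ++ cf L2.
Proof. by rewrite /cf map_cat flatten_cat. Qed.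

Lemma rk_cfb A b : (rk A (cfb b) <= nmono b.2)%N.
Proof. by apply: leq_trans (rk_size _ _) _; rewrite size_map -cardE. Qed.

Lemma rk_cf_cons A b L :
  rk A (cf (b :: L)) = (rk A (cfb b) + rk (cfb b ++ A) (cf L))%N.
Proof. by rewrite /cf /= rk_cat. Qed.

Lemma rk_cf A L : (rk A (cf L) <= weight L)%N.
Proof.
elim: L A => [|b L IH] A; first by rewrite /weight big_nil.
rewrite /cf /= rk_cat /weight big_cons; apply: leq_add; [exact: rk_cfb|exact: IH].
Qed.

Lemma mem_cf L1 L2 : {subset L1 <= L2} -> {subset cf L1 <= cf L2}.
Proof.
move=> h a /flattenP [s /mapP [b bL ->] as_]; apply/flattenP.
by exists (cfb b) => //; apply/map_f/h.
Qed.

(** By [rk_sym], a block that does not lower the rank of y is free over y. The basis S then remains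
    independent over its coefficients, and the relation at y removes #|S| of them from the rank. *)
Lemma zero_drop_gain y A b (S : {set 'X_{1..N < bd}}) :
  rk (cfb b ++ A) (codom y) = rk A (codom y) ->
  \sum_(m in degset N bd b.2) c b.1 (bmnm m) * bmonv y m = 0 ->
  S \subset degset N bd b.2 -> indep (cl A) S (@bmonv _ _ bd y) ->
  (forall m, m \in degset N bd b.2 -> spanned (cl A) S (@bmonv _ _ bd y) (bmonv y m)) ->
  (rk A (cfb b) + #|S| <= nmono b.2)%N.
Proof.
move=> zd rel sub hi hsp; apply: rk_gain sub hsp _ rel.
apply: (indep_adjoin_free (y := codom y)) hi.
  by have := rk_sym A (cfb b) (codom y); rewrite zd addnC => /addnI.
move=> t _; apply: cl_monv => i; apply: cl_mem.
by rewrite mem_cat codom_f.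
Qed.

(* [t] counts the blocks whose addition does not lower the rank of y. *)
Lemma blocks_gain y A L gam :
  (forall A' b, b \in L -> {subset A <= A'} -> {subset A' <= cf L ++ A} ->
     rk (cfb b ++ A') (codom y) = rk A' (codom y) ->
     (rk A' (cfb b) + gam <= nmono b.2)%N) ->
  exists t, [/\ (t <= size L)%N, (rk A (cf L) + gam * t <= weight L)%N &
    (size L - t + rk (cf L ++ A) (codom y) <= rk A (codom y))%N].
Proof.
elim: L A => [|b L IH] A h.
  by exists 0%N; rewrite /cf /= muln0.
have [|t [t1 t2 t3]] := IH (cfb b ++ A).
  move=> A' b' b'L s1 s2; apply: h; first by rewrite inE b'L orbT.
    by move=> a aA; apply: s1; rewrite mem_cat aA orbT.
  by move=> a /s2; rewrite /cf /= !mem_cat orbCA orbA.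
have sz := rk_cf_cons A b L.
have ey : rk (cf (b :: L) ++ A) (codom y) = rk (cf L ++ cfb b ++ A) (codom y).
  by apply: rk_mem => a; rewrite /cf /= !mem_cat orbCA orbA.
have sw : weight (b :: L) = (nmono b.2 + weight L)%N by rewrite /weight big_cons.
have le1 : (rk (cfb b ++ A) (codom y) <= rk A (codom y))%N.
  by apply: rk_anti => a aA; apply: cl_mem; rewrite mem_cat aA orbT.
have [zd|nzd] := eqVneq (rk (cfb b ++ A) (codom y)) (rk A (codom y)).
  exists t.+1; split; rewrite /= ?ltnS //.
    rewrite sz sw mulnS; have := h A b; rewrite inE eqxx => /(_ isT) h1.
    have {h1} : (rk A (cfb b) + gam <= nmono b.2)%N.
      by apply: h1 => // a aA; rewrite mem_cat aA orbT.
    by move: t2; lia.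
  by rewrite ey subSS -zd.
exists t; split; rewrite /=; first exact: leqW.
  by rewrite sz sw; have := rk_cfb A b; lia.
rewrite ey; move: le1 nzd; rewrite leq_eqVlt => /orP [->//|lt _].
by rewrite subSn // addSn; apply: leq_ltn_trans t3 lt.
Qed.

Hypothesis bd3 : (2 < bd)%N.
(** What is used of a generic F: its coefficients are independent, they are recovered from the point
    and the local coefficients, and these are in turn algebraic over F and the point. The point
    depends on N parameters, and it lies on V by [Hc0]. *)
Hypothesis HF : (weight all_blocks <= rk [::] Fl)%N.
Hypothesis HFc : forall a, a \in Fl -> cl (xl ++ cf all_blocks) a.
Hypothesis Hc : forall i m, cl (Fl ++ xl) (c i m).
Hypothesis Hx : (rk [::] xl <= N)%N.
Hypothesis Hc0 : forall i, c i 0%MM = 0.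

Lemma nmono0 : (0 < nmono 0)%N.
Proof.
have [m hm _] := @degsetP N bd 0 0%MM (@mdeg0 _) (ltnW (ltnW bd3)).
by rewrite card_gt0; apply/set0Pn; exists m.
Qed.

Lemma nmono1 : (N <= nmono 1)%N.
Proof.
have h (i : 'I_N) : exists m : 'X_{1..N < bd}, m \in degset N bd 1 /\ bmnm m = U_(i)%MM.
  by have [m h1 h2] := @degsetP N bd 1 _ (mdeg1 i) (ltnW bd3); exists m.
have [f hf] := boolp.choice h.
have finj : injective f.
  move=> i j /(congr1 (@bmnm _ _)); rewrite (hf i).2 (hf j).2 => /eqP.
  by rewrite eq_mnm1 => /eqP.
rewrite -[leqLHS]card_ord -cardsT -(card_imset _ finj); apply: subset_leq_card.
by apply/subsetP => _ /imsetP [i _ ->]; case: (hf i).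
Qed.

Lemma cfb1_mem i a : a \in cfb (i, 1%N) -> exists t, a = c i U_(t)%MM.
Proof.
move=> /imageP [m]; rewrite inE /= => /mdeg1P [t /eqP e] ->.
by exists t; rewrite e.
Qed.

Lemma rk_blocks0 A : rk A (cf (blocks 0)) = 0%N.
Proof.
apply: rk_cl0 => a /flattenP [s /mapP [b /mapP [i _ ->] ->]] /imageP [m].
by rewrite inE /= mdeg_eq0 => /eqP -> ->; rewrite Hc0; apply: cl0.
Qed.

Lemma weight_blocks j : weight (blocks j) = (k * nmono j)%N.
Proof.
by rewrite /weight big_map /= big_const_seq iter_addn_0 count_predT size_enum_ord mulnC.
Qed.

Section Partition.
Variables L2 L3 LR : seq blk.
Hypothesis part : perm_eq all_blocks (blocks 0 ++ blocks 1 ++ L2 ++ L3 ++ LR).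

Lemma weight_parts : weight all_blocks =
  (k * nmono 0 + (k * nmono 1 + (weight L2 + (weight L3 + weight LR))))%N.
Proof.
rewrite /weight (perm_big _ part) /= !big_cat /= -!weight_blocks.
by rewrite /weight.
Qed.

(** Otherwise one linear part is determined by the others and k - 1 ratios. Its at least N
    coefficients and the k or more constant terms are then saved, while the point and the ratios
    supply only N + k - 1 parameters. *)
Lemma linear_parts_indep (mu : 'I_k -> K) :
  (forall s, \sum_i mu i * c i U_(s)%MM = 0) -> forall i, mu i = 0.
Proof.
move=> rel i0; apply/eqP/negPn/negP => mi0.
pose nu i := mu i / mu i0.
have nrel s : c i0 U_(s)%MM = - \sum_(i | i != i0) nu i * c i U_(s)%MM.
  apply/eqP; rewrite -addr_eq0 -[X in X + _]mul1r -(mulfV mi0) -/(nu i0).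
  rewrite -(bigD1 i0 (P := predT) (F := fun i => nu i * c i U_(s)%MM)) //=.
  rewrite /nu; under eq_bigr do rewrite mulrAC.
  by rewrite -mulr_suml rel mul0r.
pose ml := [seq nu i | i <- enum 'I_k & i != i0].
have szml : (size ml).+1 = k.
  rewrite size_map size_filter -[RHS](size_enum_ord k) -(count_predC (pred1 i0)).
  by rewrite count_uniq_mem ?enum_uniq // mem_enum add1n.
pose Lrest := [seq b <- all_blocks | (b.2 != 0%N) && (b != (i0, 1%N))].
have [p0 p1] : weight all_blocks = (weight [seq b <- all_blocks | b.2 == 0%N] +
    (weight [seq b <- all_blocks | b == (i0, 1%N)] + weight Lrest))%N /\
    (nmono 1 + k * nmono 0 <= weight [seq b <- all_blocks | b.2 == 0%N] +
     weight [seq b <- all_blocks | b == (i0, 1%N)])%N.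
  split.
    rewrite /weight !big_filter (bigID (fun b : blk => b.2 == 0%N)) /=; congr (_ + _)%N.
    rewrite (bigID (fun b : blk => b == (i0, 1%N))) /=; congr (_ + _)%N.
    by apply: eq_bigl => b; case: (b =P (i0, 1%N)) => [->|_]; rewrite ?andbT ?andbF.
  rewrite addnC; apply: leq_add; rewrite /weight big_filter (perm_big _ part) !big_cat /=.
    apply: leq_trans (leq_addr _ _); rewrite -weight_blocks /weight !big_map /=.
    by rewrite leqnn.
  apply: leq_trans (leq_addl _ _); apply: leq_trans (leq_addr _ _).
  rewrite big_map big_mkcond /= (bigD1_seq i0) ?mem_enum ?enum_uniq //= eqxx.
  exact: leq_addr.
suff : (weight all_blocks <= N + size ml + weight Lrest)%N.
  by have := nmono0; have := nmono1; move: p1; rewrite p0; nia.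
apply: leq_trans HF _.
apply: leq_trans (_ : rk [::] (xl ++ ml ++ cf Lrest) <= _)%N.
  apply: rk_le_cl => a aF; apply: cl_sub (HFc aF) => z.
  have sub A' : {subset A' <= xl ++ ml ++ cf Lrest} -> {subset A' <= (xl ++ ml ++ cf Lrest) ++ [::]}.
    by move=> h x /h; rewrite cats0.
  rewrite cats0 mem_cat => /orP [zx|]; first by apply: cl_mem; rewrite mem_cat zx.
  move=> /flattenP [s /mapP [b bL ->] zb].
  have [b0|b0] := eqVneq b.2 0%N.
    move: zb => /imageP [m]; rewrite inE b0 mdeg_eq0 => /eqP -> ->.
    by rewrite Hc0; apply: cl0.
  have inrest (b' : blk) z' : b' \in all_blocks -> b'.2 != 0%N -> b' != (i0, 1%N) -> z' \in cfb b' ->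
      cl (xl ++ ml ++ cf Lrest) z'.
    move=> h1 h2 h3 h4; apply: cl_mem; rewrite !mem_cat; apply/orP; right; apply/orP; right.
    by apply/flattenP; exists (cfb b') => //; apply: map_f; rewrite mem_filter h2 h3.
  have [b1|b1] := eqVneq b (i0, 1%N); last exact: inrest zb.
  move: zb; rewrite b1 => /cfb1_mem [t ->]; rewrite nrel; apply: clN.
  apply: cl_sum => i ii0; apply: clM.
    apply: cl_mem; rewrite !mem_cat; apply/orP; right; apply/orP; left.
    by apply: map_f; rewrite mem_filter ii0 mem_enum.
  apply: (inrest (i, 1%N)) => //.
  - by rewrite (perm_mem part) !mem_cat; apply/orP; right; apply/orP; left; apply: map_f; rewrite mem_enum.
  - by apply: contra ii0 => /eqP [->].
  - have [m h1 h2] := @degsetP N bd 1 _ (mdeg1 t) (ltnW bd3).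
    by apply/imageP; exists m; rewrite // h2.
rewrite !rk_cat addnA; apply: leq_add; last exact: rk_cf.
by apply: leq_add; [exact: Hx|exact: rk_size].
Qed.

Section Main.
Variables (M : nat) (y : 'I_N -> K) (b0 : 'I_N) (ll v : 'I_N -> K).
Hypotheses (HN : N = (M + k)%N) (Hk : (2 <= k)%N) (HM : (3 * k + 4 <= M)%N).
Hypothesis sz2 : (size L2 <= k)%N.
Hypothesis deg2 : forall b, b \in L2 -> b.2 = 2%N.
Hypothesis deg3 : forall b, b \in L3 -> (2 < b.2 < bd)%N.
Hypothesis szL : (size L2 + size L3 = M - 2)%N.
Hypothesis yb0 : y b0 = 1.
Hypothesis rel1 : forall i, \sum_t c i U_(t)%MM * y t = 0.
Hypothesis rel23 : forall b, b \in L2 ++ L3 ->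
  \sum_(m in degset N bd b.2) c b.1 (bmnm m) * bmonv y m = 0.
(** [rky] is the form in which excess dimension enters: y is not algebraic, even after the
    coefficients of the linear form [ll] are adjoined. [Tv] and [lv] ensure that [ll] is not a
    combination of the linear parts. *)
Hypothesis rell : \sum_t ll t * y t = 0.
Hypothesis rky : (0 < rk (codom ll ++ (Fl ++ xl)) (codom y))%N.
Hypothesis Tv : forall i, \sum_t c i U_(t)%MM * v t = 0.
Hypothesis lv : \sum_t ll t * v t != 0.

Let K0 := Fl ++ xl.

Section Basis.
Variables (beta : {set 'I_N}) (lam : 'I_N -> 'I_N -> K).
Hypothesis b0b : b0 \in beta.
Hypothesis hib : indep (cl K0) beta y.
Hypothesis lamK : forall t s, cl K0 (lam t s).
Hypothesis ylam : forall t, y t = \sum_(s in beta) lam t s * y s.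

(** Normalised to be the identity on [beta], so that only the rows outside [beta] are parameters. *)
Let Lam t s : K := if t \in beta then (t == s)%:R else lam t s.

Let LamK t s : cl K0 (Lam t s).
Proof. by rewrite /Lam; case: ifP => // _; case: eqP => _; [apply: cl1|apply: cl0]. Qed.

Let yLam t : y t = \sum_(s in beta) Lam t s * y s.
Proof.
rewrite /Lam; case tb : (t \in beta); last exact: ylam.
rewrite (bigD1 t) //= eqxx mul1r big1 ?addr0 //.
by move=> s /andP [_ /negPf h]; rewrite eq_sym h mul0r.
Qed.

(* The quotients lam describe the linear span of y, a point of a Grassmannian
   of dimension (N - #|beta|) * #|beta|. *)
Let lamlist : seq K := [seq lam p.1 p.2 | p in setX (~: beta) beta].

Let size_lamlist : size lamlist = ((N - #|beta|) * #|beta|)%N.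
Proof. by rewrite size_map -cardE cardsX cardsCs setCK card_ord. Qed.

Let Lam_list A t s : {subset lamlist <= A} -> s \in beta -> cl A (Lam t s).
Proof.
move=> h sb; rewrite /Lam; case: ifP => tb; first by case: eqP => _; [apply: cl1|apply: cl0].
by apply/cl_mem/h/imageP; exists (t, s); rewrite // !inE tb.
Qed.

(** A form over the closure of B that vanishes at y vanishes on the whole span, because the basis
    coordinates of y are independent over that closure. *)
Let linear_form_vanishes B (a : 'I_N -> K) : (forall x, x \in K0 -> cl B x) ->
  (forall t, cl B (a t)) -> indep (cl B) beta y -> \sum_t a t * y t = 0 ->
  forall s, s \in beta -> \sum_t a t * Lam t s = 0.
Proof.
move=> hB ha hi rel; apply: (hi (fun s => \sum_t a t * Lam t s)).
  move=> s _; apply: cl_sum => t _; apply: clM => //.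
  by apply: cl_sub (LamK t s).
rewrite -[RHS]rel; under eq_bigr => s _ do rewrite mulr_suml.
rewrite exchange_big; apply: eq_bigr => t _ /=.
by rewrite [in RHS]yLam mulr_sumr; apply: eq_bigr => s _; rewrite mulrA.
Qed.

Let LamM : 'M[K]_(N, #|beta|) := \matrix_(t, s) Lam t (enum_val s).

Let rank_LamM : \rank LamM = #|beta|.
Proof.
apply/eqP; rewrite eqn_leq rank_leq_col /=.
pose P : 'M[K]_(#|beta|, N) := \matrix_(s, t) (t == enum_val s)%:R.
have PL : P *m LamM = 1%:M.
  apply/matrixP => s s'; rewrite !mxE (bigD1 (enum_val s)) //= !mxE eqxx mul1r.
  rewrite big1 ?addr0; last by move=> t /negPf h; rewrite !mxE h mul0r.
  by rewrite /Lam enum_valP (inj_eq enum_val_inj).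
by rewrite -[leqLHS](mxrank1 K) -PL mxrankM_maxr.
Qed.

Let rank_bound r (Q : 'M[K]_(r, N)) : row_free Q ->
  (forall i s, s \in beta -> \sum_t Q i t * Lam t s = 0) -> (r + #|beta| <= N)%N.
Proof.
move=> /eqP rQ h; rewrite -rQ -rank_LamM; apply: mulmx0_rank_max.
apply/matrixP => i s; rewrite !mxE -[RHS](h i (enum_val s) (enum_valP s)).
by apply: eq_bigr => t _; rewrite mxE.
Qed.

Let Q : 'M[K]_(k, N) := \matrix_(i, t) c i U_(t)%MM.

Let Q_free : row_free Q.
Proof.
rewrite -kermx_eq0; apply/rowV0P => x /sub_kermxP hx; apply/rowP => i; rewrite mxE.
apply: (linear_parts_indep (mu := fun i => x 0 i)) => s.
have := congr1 (fun A : 'rV_N => A 0 s) hx; rewrite !mxE => e.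
by rewrite -[RHS]e; apply: eq_bigr => j _; rewrite mxE.
Qed.

Let Q_vanishes i s : s \in beta -> \sum_t Q i t * Lam t s = 0.
Proof.
move=> sb; have := @linear_form_vanishes K0 (fun t => c i U_(t)%MM) _ _ hib (rel1 i) s sb.
move=> e; rewrite -[RHS]e; last by move=> t; apply: Hc.
  by apply: eq_bigr => t _; rewrite mxE.
by move=> x; apply: cl_mem.
Qed.

Let beta_le : (#|beta| <= M)%N.
Proof. by have := rank_bound Q_free Q_vanishes; move: HN; move: #|beta| => x; lia. Qed.

(** The rank 1 of y cannot fall when [ll] is adjoined, so by symmetry [ll] is free over y, and the
    basis coordinates stay independent over its coefficients. Hence [ll] vanishes on the span too,
    and it is independent of the k linear parts. *)
Let beta_le_curve : rk K0 (codom y) = 1%N -> (#|beta| < M)%N.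
Proof.
move=> e1.
have l1 : (rk (codom ll ++ K0) (codom y) <= rk K0 (codom y))%N.
  by apply: rk_anti => a aK; apply: cl_mem; rewrite mem_cat aK orbT.
have e2 : rk (codom ll ++ K0) (codom y) = rk K0 (codom y).
  by apply/eqP; rewrite eqn_leq l1 e1; exact: rky.
have hil : indep (cl (codom ll ++ K0)) beta y.
  apply: (indep_adjoin_free (y := codom y)) hib.
    by have := rk_sym K0 (codom ll) (codom y); rewrite e2 addnC => /addnI.
  by move=> t _; apply: cl_mem; rewrite mem_cat codom_f.
have llv s : s \in beta -> \sum_t ll t * Lam t s = 0.
  apply: (@linear_form_vanishes (codom ll ++ K0)) => //.
    by move=> x xK; apply: cl_mem; rewrite mem_cat xK orbT.
  by move=> t; apply: cl_mem; rewrite mem_cat codom_f.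
pose lr : 'rV[K]_N := \row_t ll t.
have nsub : ~~ (lr <= Q)%MS.
  apply/negP => /submxP [D eD]; move/eqP: lv; apply.
  pose vc : 'cV[K]_N := \col_t v t.
  have Qv : Q *m vc = 0.
    apply/matrixP => i j; rewrite !mxE -[RHS](Tv i).
    by apply: eq_bigr => t _; rewrite !mxE.
  have : (lr *m vc) 0 0 = 0 by rewrite eD -mulmxA Qv mulmx0 mxE.
  by rewrite mxE => e; rewrite -[RHS]e; apply: eq_bigr => t _; rewrite !mxE.
have free : row_free (col_mx Q lr).
  have lt : (\rank Q < \rank (col_mx Q lr))%N.
    apply: rank_ltmx; rewrite ltmxE; apply/andP; split.
      by apply: submx_trans (addsmxSl _ lr) _; rewrite addsmxE.
    by apply: contra nsub => h; apply: submx_trans h; rewrite -addsmxE addsmxSr.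
  rewrite /row_free eqn_leq rank_leq_row /=; apply: leq_trans lt.
  by rewrite (eqP Q_free) addn1.
have h i s : s \in beta -> \sum_t (col_mx Q lr) i t * Lam t s = 0.
  move=> sb; case: (splitP i) => [i' ei|i' ei].
    have -> : i = lshift 1 i' by apply: val_inj.
    rewrite -[RHS](Q_vanishes i' sb).
    by apply: eq_bigr => t _; rewrite col_mxEu.
  have -> : i = rshift k i' by apply: val_inj.
  rewrite -[RHS](llv s sb); apply: eq_bigr => t _.
  by rewrite col_mxEd mxE.
by have := rank_bound free h; move: HN; move: #|beta| => x; lia.
Qed.

(** Linear blocks gain #|beta| whether or not they lower the rank of y: [beta] is a basis over the
    closure of K0, which contains their coefficients, and the expansion of y in it is already known
    over A. *)
Let rk_cfb1 A i : (forall a, a \in A -> cl K0 a) -> {subset lamlist <= A} ->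
  (rk A (cfb (i, 1%N)) + #|beta| <= nmono 1)%N.
Proof.
move=> AK lA; apply: leq_trans nmono1.
pose cs := [seq c i U_(t)%MM | t in [set: 'I_N]].
have h : (rk A (cfb (i, 1%N)) <= rk A cs)%N.
  apply: rk_le_sub => a /cfb1_mem [t ->].
  by apply: (image_f (fun t => c i U_(t)%MM)); rewrite inE.
rewrite -[leqRHS]card_ord -cardsT.
apply: leq_trans (_ : rk A cs + #|beta| <= _)%N; first by rewrite leq_add2r.
apply: (@rk_gain _ A _ _ _ (fun t => c i U_(t)%MM) y).
- exact: subsetT.
- move=> t _; exists (fun s => if s \in beta then Lam t s else 0).
    by move=> s; case: ifP => sb; [apply: Lam_list|apply: cl0].
  by rewrite {1}yLam; apply: eq_bigr => s ->.
- apply: indep_sub hib => z; apply: cl_sub => a; rewrite mem_cat => /orP [|/AK//].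
  by move=> /imageP [t _ ->]; apply: Hc.
- by rewrite -[RHS](rel1 i); apply: eq_bigl => t; rewrite inE.
Qed.

Let rk_blocks1 A : (forall a, a \in A -> cl K0 a) -> {subset lamlist <= A} ->
  (rk A (cf (blocks 1)) + k * #|beta| <= k * nmono 1)%N.
Proof.
rewrite -[X in (_ + X * _ <= X * _)%N](size_enum_ord k) /blocks.
elim: (enum 'I_k) A => [|i r IH] A AK lA; first by rewrite /cf.
rewrite map_cons rk_cf_cons [size _]/= !mulSn; have := rk_cfb1 i AK lA.
have K' a : a \in cfb (i, 1%N) ++ A -> cl K0 a.
  by rewrite mem_cat => /orP [/imageP [m _ ->]|/AK//]; apply: Hc.
have l' : {subset lamlist <= cfb (i, 1%N) ++ A}.
  by move=> a /lA h; rewrite mem_cat h orbT.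
by move=> h1; rewrite addnACA; apply: leq_add h1 (IH _ K' l').
Qed.

(** The order of adjunction: point, span, constant terms, linear parts, quadrics. The rank of y over
    [A4] is what the quadrics leave for the blocks of higher degree. *)
Let A0 := xl ++ [::].
Let A1 := lamlist ++ A0.
Let A2 := cf (blocks 0) ++ A1.
Let A3 := cf (blocks 1) ++ A2.
Let A4 := cf L2 ++ A3.

Let cf_K L a : a \in cf L -> cl K0 a.
Proof. by move=> /flattenP [s /mapP [b _ ->] /imageP [m _ ->]]; apply: Hc. Qed.

Let A1_K a : a \in A1 -> cl K0 a.
Proof.
rewrite !mem_cat orbF => /orP [/imageP [p _ ->]|ax]; first exact: lamK.
by apply: cl_mem; rewrite mem_cat ax orbT.
Qed.

Let A2_K a : a \in A2 -> cl K0 a.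
Proof. by rewrite mem_cat => /orP [/cf_K|/A1_K]. Qed.
Let A3_K a : a \in A3 -> cl K0 a.
Proof. by rewrite mem_cat => /orP [/cf_K|/A2_K]. Qed.
Let A4_K a : a \in A4 -> cl K0 a.
Proof. by rewrite mem_cat => /orP [/cf_K|/A3_K]. Qed.

Let lam_A1 : {subset lamlist <= A1}.
Proof. by move=> a h; rewrite mem_cat h. Qed.

(** Once the span is known, y depends on its #|beta| basis coordinates, of which the one at [b0] is
    1. *)
Let rk_A3_y : (rk A3 (codom y) < #|beta|)%N.
Proof.
have h : (rk A3 (codom y) <= rk A3 [seq y s | s in beta :\ b0])%N.
  apply: rk_le_cl => _ /codomP [t ->]; rewrite yLam; apply: cl_sum => s sb; apply: clM.
    apply: Lam_list => // a /lam_A1 h.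
    by rewrite mem_cat [a \in A3]mem_cat [a \in A2]mem_cat h !orbT.
  have [->|sb0] := eqVneq s b0; first by rewrite yb0; apply: cl1.
  by apply: cl_mem; rewrite mem_cat image_f // !inE sb0.
apply: leq_ltn_trans h _; apply: leq_ltn_trans (rk_size _ _) _.
by rewrite size_map -cardE [in ltnRHS](cardsD1 b0) b0b.
Qed.

(** Adds up the ranks of all blocks along this order; those left out of I, gathered in [LR], are
    charged their full weight. *)
Let main_bound : (k * nmono 0 + k * #|beta| + (weight L2 - rk A3 (cf L2)) +
  (weight L3 - rk A4 (cf L3)) <= N + (N - #|beta|) * #|beta|)%N.
Proof.
have le : (rk [::] Fl <= rk [::] (xl ++ lamlist ++ cf (blocks 0) ++ cf (blocks 1) ++
    cf L2 ++ cf L3 ++ cf LR))%N.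
  apply: rk_le_cl => a aF; rewrite cats0; apply: cl_subset (HFc aF) => z.
  rewrite !mem_cat => /orP [->//|].
  have h : {subset all_blocks <= blocks 0 ++ blocks 1 ++ L2 ++ L3 ++ LR}.
    by move=> b; rewrite (perm_mem part).
  by move=> /(mem_cf h); rewrite !cf_cat !mem_cat => ->; rewrite !orbT.
have := leq_trans HF le; rewrite weight_parts !rk_cat rk_blocks0 -/A0 -/A1 -/A2 -/A3 -/A4.
have := size_lamlist; have := rk_size A0 lamlist.
have lA2 : {subset lamlist <= A2} by move=> a /lam_A1 h; rewrite mem_cat h orbT.
have := rk_blocks1 A2_K lA2.
have := rk_cf A3 L2; have := rk_cf A4 L3; have := rk_cf (cf L3 ++ A4) LR.
have := Hx.
have aux (rx n rR wR r3 w3 r2 w2 rB kb q1 rl sl nb q0 : nat) : (rx <= n -> rR <= wR ->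
    r3 <= w3 -> r2 <= w2 -> rB + kb <= q1 -> rl <= sl -> sl = nb ->
    q0 + (q1 + (w2 + (w3 + wR))) <= rx + (rl + (0 + (rB + (r2 + (r3 + rR))))) ->
    q0 + kb + (w2 - r2) + (w3 - r3) <= n + nb)%N by lia.
exact: aux.
Qed.

Let e := rk K0 (codom y).

Let e_pos : (0 < e)%N.
Proof.
apply: leq_trans rky _; apply: rk_anti => a aK.
by apply: cl_mem; rewrite mem_cat aK orbT.
Qed.

Let e_le A : (forall a, a \in A -> cl K0 a) -> (e <= rk A (codom y))%N.
Proof. exact: rk_anti. Qed.

Let sub_K L A A' : (forall a, a \in A -> cl K0 a) -> {subset A' <= cf L ++ A} ->
  forall a, a \in A' -> cl K0 a.
Proof. by move=> h s a /s; rewrite mem_cat => /orP [/cf_K|/h]. Qed.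

Let gain_surface A L : (1 < e)%N -> (forall a, a \in A -> cl K0 a) ->
  {subset L <= L2 ++ L3} -> forall A' b, b \in L ->
  {subset A' <= cf L ++ A} -> rk (cfb b ++ A') (codom y) = rk A' (codom y) ->
  (rk A' (cfb b) + #|beta|.+1 <= nmono b.2)%N.
Proof.
move=> e1 AK sL A' b bL sA zd; have AK' := sub_K AK sA.
have hd : (1 < b.2 < bd)%N.
  have := sL b bL; rewrite mem_cat => /orP [/deg2 ->|/deg3 /andP [h1 h2]]; first exact: bd3.
  by rewrite h2 ltnW.
have [S [h1 h2 h3 h4]] := monomial_span_succ char0 yb0 b0b e_pos hib AK' hd.
apply: leq_trans (zero_drop_gain zd (rel23 (sL b bL)) h1 h2 h3).
by rewrite leq_add2l.
Qed.

Let gain_curve A L : e = 1%N -> (forall a, a \in A -> cl K0 a) ->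
  {subset L <= L2 ++ L3} -> forall A' b, b \in L ->
  {subset A' <= cf L ++ A} -> rk (cfb b ++ A') (codom y) = rk A' (codom y) ->
  (rk A' (cfb b) + (b.2 * #|beta|.-1).+1 <= nmono b.2)%N.
Proof.
move=> e1 AK sL A' b bL sA zd; have AK' := sub_K AK sA.
have hd : (b.2 < bd)%N.
  by have := sL b bL; rewrite mem_cat => /orP [/deg2 ->|/deg3 /andP [h1 h2]].
have [S [_ h1 h2 h3]] := indep_maximal (sub0set (degset N bd b.2)) (@indep_set0 K (cl A') _ (@bmonv _ _ bd y)).
apply: leq_trans (zero_drop_gain zd (rel23 (sL b bL)) h1 h2 h3).
rewrite leq_add2l; apply: (monomial_span_rk1 char0 e1 _ hib AK' hd h3).
by rewrite card_gt0; apply/set0Pn; exists b0.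
Qed.

(** While quadrics are being adjoined, the rank of y is at least what it will be after all of
    them. *)
Let gain_quadric A' b : b \in L2 -> {subset A' <= A4} ->
  rk (cfb b ++ A') (codom y) = rk A' (codom y) ->
  (rk A' (cfb b) + 'C((rk A4 (codom y)).+2, 2) <= nmono b.2)%N.
Proof.
move=> bL sA zd.
have [S0 [h0 h1 h2]] := quadric_span_rk char0 A' yb0 bd3.
have b2 := deg2 bL.
have sL : b \in L2 ++ L3 by rewrite mem_cat bL.
have := zero_drop_gain zd (rel23 sL); rewrite b2.
have [S [h3 h4 h5 h6]] := indep_maximal h0 h1.
move=> /(_ S h4 h5 h6); apply: leq_trans; rewrite leq_add2l.
apply: leq_trans (subset_leq_card h3); rewrite h2.
by apply: leq_bin2l; rewrite !ltnS; apply: rk_anti => a /sA; apply: cl_mem.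
Qed.

Lemma beta_contradiction : False.
Proof.
have bound := main_bound; have ble := beta_le.
have k0n : (k <= k * nmono 0)%N by rewrite leq_pmulr // nmono0.
rewrite -addnA in bound; have {bound}budget := gain_budget HN ble k0n bound.
have sL2 : {subset L2 <= L2 ++ L3} by move=> b; rewrite mem_cat => ->.
have sL3 : {subset L3 <= L2 ++ L3} by move=> b; rewrite mem_cat orbC => ->.
have A5K a : a \in cf L3 ++ A4 -> cl K0 a by rewrite mem_cat => /orP [/cf_K|/A4_K].
have eA5 := e_le A5K; have e0 := rk_A3_y.
have toG w r g : (r + g <= w -> g <= w - r)%N by lia.
have [e1|e1] := ltnP 1 e.
  have [t2 [t2a /toG t2b t2c]] := blocks_gain (fun A' b bL _ => gain_surface e1 A3_K sL2 bL).
  have [t3 [t3a /toG t3b t3c]] := blocks_gain (fun A' b bL _ => gain_surface e1 A4_K sL3 bL).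
  exact: surface_arithmetic ble budget e1 eA5 szL t2a t3a t2c t3c e0 t2b t3b.
have {}e1 : e = 1%N by apply/eqP; rewrite eqn_leq e1.
have g2 A' b : b \in L2 -> {subset A3 <= A'} -> {subset A' <= cf L2 ++ A3} ->
    rk (cfb b ++ A') (codom y) = rk A' (codom y) ->
    (rk A' (cfb b) + maxn (2 * #|beta|.-1).+1 'C((rk A4 (codom y)).+2, 2) <= nmono b.2)%N.
  move=> bL _ sA zd; rewrite addn_maxr geq_max (gain_quadric bL sA zd) andbT.
  by have := gain_curve e1 A3_K sL2 bL sA zd; rewrite (deg2 bL).
have g3 A' b : b \in L3 -> {subset A4 <= A'} -> {subset A' <= cf L3 ++ A4} ->
    rk (cfb b ++ A') (codom y) = rk A' (codom y) ->
    (rk A' (cfb b) + (3 * #|beta|.-1).+1 <= nmono b.2)%N.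
  move=> bL _ sA zd; apply: leq_trans (gain_curve e1 A4_K sL3 bL sA zd).
  by rewrite leq_add2l ltnS leq_mul2r; have /andP [-> _] := deg3 bL; rewrite orbT.
have [t2 [t2a /toG t2b t2c]] := blocks_gain g2.
have [t3 [t3a /toG t3b t3c]] := blocks_gain g3.
rewrite e1 in eA5.
exact: curve_arithmetic Hk HM (beta_le_curve e1) budget eA5 sz2 szL t2a t3a t2c t3c e0 t2b t3b.
Qed.

End Basis.

Lemma no_excess_point : False.
Proof.
have hi0 : indep (cl K0) [set b0] y.
  move=> a _; rewrite big_set1 yb0 mulr1 => h t; rewrite inE => /eqP -> //.
have [beta [b0b _ hib hsp]] := indep_maximal (subsetT [set b0]) hi0.
have /boolp.choice [lam hlam] : forall t, exists l : 'I_N -> K, (forall s, cl K0 (l s)) /\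
    y t = \sum_(s in beta) l s * y s.
  by move=> t; have [l h1 h2] := hsp t (in_setT t); exists l.
apply: (@beta_contradiction beta lam) => //.
- by rewrite -sub1set.
- by move=> t; case: (hlam t).
- by move=> t; case: (hlam t).
Qed.
End Main.

End Partition.
End Counting.

(** * The generic system and its local coefficients *)

Section GenericSystem.
Variable K : closedFieldType.
Hypothesis char0 : forall n, n.+1%:R != 0 :> K.
Hypothesis uncount : forall f : nat -> seq K, exists z, forall n, z \notin f n.
Variables (N k bd : nat) (d : 'I_k -> nat).
Hypothesis bd3 : (2 < bd)%N.
Hypothesis dbd : forall i, (d i < bd)%N.

(** Only monomials of degree exactly d_i are indexed. The larger [coef_idx] also has monomials of
    other degrees, whose coefficients vanish on forms and so cannot be independent. *)
Definition cidx : finType := {p : 'I_k * 'X_{1..N.+1 < bd} | mdeg (bmnm p.2) == d p.1}.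
Definition ncidx : nat := #|{: cidx}|.

Definition system (w : 'I_ncidx -> K) (i : 'I_k) : {mpoly K[N.+1]} :=
  \sum_(p : cidx | (val p).1 == i) w (enum_rank p) *: 'X_[bmnm (val p).2].

Lemma system_homog w i : system w i \is (d i).-homog.
Proof.
apply: rpred_sum => p /eqP pi; apply: rpredZ; rewrite dhomogX.
by rewrite -pi; apply: (valP p).
Qed.

Lemma system_coef w (p : cidx) : (system w (val p).1)@_(bmnm (val p).2) = w (enum_rank p).
Proof.
rewrite /system raddf_sum (bigD1 p) //= mcoeffZ mcoeffX eqxx mulr1 big1 ?addr0 //.
move=> q /andP [/eqP e qp]; rewrite mcoeffZ mcoeffX; case: eqP => [em|_]; last by rewrite mulr0.
case/negP: qp; apply/eqP/val_inj => /=.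
rewrite [sval q]surjective_pairing [sval p]surjective_pairing; congr pair; first exact: e.
by apply: val_inj; rewrite /= em.
Qed.

Lemma system_coefs_cl A w i : (forall t, cl A (w t)) -> clp A (system w i).
Proof.
move=> hw m; rewrite /system raddf_sum; apply: cl_sum => p _ /=.
by rewrite mcoeffZ mcoeffX; apply: clM => //; case: eqP => _; [apply: cl1|apply: cl0].
Qed.

Lemma system_of (F : 'I_k -> {mpoly K[N.+1]}) (w : 'I_ncidx -> K) :
  (forall i, F i \is (d i).-homog) ->
  (forall p, w (enum_rank p) = (F (val p).1)@_(bmnm (val p).2)) ->
  forall i, system w i = F i.
Proof.
move=> hF hw i; apply/mpolyP => m.
have [hm|hm] := eqVneq (mdeg m) (d i); last first.
  rewrite !memN_msupp_eq0 //; apply: contraNN hm => hm; apply/eqP.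
    exact: (dhomogP _ _ _ (hF i) _ hm).
  exact: (dhomogP _ _ _ (system_homog w i) _ hm).
have hb : (mdeg m < bd)%N by rewrite hm.
pose q : 'I_k * 'X_{1..N.+1 < bd} := (i, BMultinom hb).
have hq : mdeg (bmnm q.2) == d q.1 by apply/eqP.
have := system_coef w (exist _ q hq); rewrite /= => ->.
by rewrite hw.
Qed.

Definition lc (j : 'I_N.+1) (x : 'I_N.+1 -> K) (w : 'I_ncidx -> K) (i : 'I_k)
  (m : 'X_{1..N}) : K := (loc j x (system w i))@_m.

(** Homogenising with the coordinate 0 injects the local monomials of degree at most d_i into the
    monomials of degree d_i. *)
Lemma weight_le_ncidx : (weight N bd (all_blocks d) <= ncidx)%N.
Proof.
rewrite /weight /all_blocks big_allpairs_dep big_enum /=.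
have -> : (\sum_i \sum_(j <- iota 0 (d i).+1) nmono N bd j)%N =
    #|[set p : 'I_k * 'X_{1..N < bd} | (mdeg (bmnm p.2) <= d p.1)%N]|.
  rewrite -sum1dep_card.
  rewrite -(pair_big_dep predT (fun i (m : 'X_{1..N < bd}) => (mdeg (bmnm m) <= d i)%N)
     (fun _ _ => 1%N)).
  apply: eq_bigr => i _; rewrite -[iota _ _]/(index_iota 0 (d i).+1).
  rewrite big_mkord (partition_big (fun m : 'X_{1..N < bd} => inord (mdeg (bmnm m)) : 'I_(d i).+1) predT) //=.
  apply: eq_bigr => j _; rewrite /nmono -sum1_card; apply: eq_bigl => m.
  rewrite inE; apply/eqP/andP => [e|[h /eqP <-]]; last by rewrite inordK.
  by rewrite e -ltnS ltn_ord; split=> //; apply/eqP/val_inj; rewrite /= inordK.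
pose f (p : 'I_k * 'X_{1..N < bd}) : 'X_{1..N.+1} :=
  [multinom if unlift ord0 t is Some s then bmnm p.2 s else (d p.1 - mdeg (bmnm p.2))%N | t < N.+1].
have fdeg p : (mdeg (bmnm p.2) <= d p.1)%N -> mdeg (f p) = d p.1.
  move=> h; rewrite mdegE big_ord_recl mnmE unlift_none.
  under eq_bigr => t _ do rewrite mnmE liftK.
  by rewrite -mdegE subnK.
have h p : exists q : cidx, (mdeg (bmnm p.2) <= d p.1)%N -> (val q).1 = p.1 /\ bmnm (val q).2 = f p.
  have [hp|hp] := boolP (mdeg (bmnm p.2) <= d p.1)%N; last first.
    have hb : (mdeg (U_(ord0) *+ d p.1 : 'X_{1..N.+1})%MM < bd)%N by rewrite mdegMn mdeg1 mul1n.
    have hq : mdeg (bmnm (p.1, BMultinom hb).2) == d (p.1, BMultinom hb).1.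
      by rewrite /= mdegMn mdeg1 mul1n.
    by exists (exist _ (p.1, BMultinom hb) hq).
  have hb : (mdeg (f p) < bd)%N by rewrite fdeg.
  have hq : mdeg (bmnm (p.1, BMultinom hb).2) == d (p.1, BMultinom hb).1 by rewrite /= fdeg.
  by exists (exist _ (p.1, BMultinom hb) hq).
have [g hg] := boolp.choice h.
rewrite -(card_in_imset (f := g)); first exact: max_card.
move=> [i1 m1] [i2 m2]; rewrite !inE /= => h1 h2 e.
have [a1 b1] := hg (i1, m1) h1; have [a2 b2] := hg (i2, m2) h2.
have ei : i1 = i2 by rewrite /= in a1 a2; rewrite -a1 -a2 e.
have em : f (i1, m1) = f (i2, m2) by rewrite -b1 -b2 e.
congr pair => //; apply: val_inj; apply/mnmP => s.
have /mnmP /(_ (lift ord0 s)) := em.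
by rewrite !mnmE liftK.
Qed.

Section AtPoint.
Variables (j : 'I_N.+1) (x : 'I_N.+1 -> K) (w : 'I_ncidx -> K).
Hypothesis xj : x j = 1.
Hypothesis onx : forall i, (system w i).@[x] = 0.
Hypothesis wgen : rk [::] (codom w) = ncidx.
Variables L2 L3 LR : seq ('I_k * nat).
Hypothesis part : perm_eq (all_blocks d) (blocks k 0 ++ blocks k 1 ++ L2 ++ L3 ++ LR).

Let HF : (weight N bd (all_blocks d) <= rk [::] (codom w))%N.
Proof. by rewrite wgen weight_le_ncidx. Qed.

Let HFc a : a \in codom w -> cl (codom x ++ cf bd (lc j x w) (all_blocks d)) a.
Proof.
move=> /codomP [t ->]; rewrite -(enum_valK t) -system_coef.
set A := _ ++ _; set i := (val _).1.
have xA s : cl A (x s) by apply: cl_mem; rewrite mem_cat codom_f.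
apply: (cl_from_loc char0 uncount xj xA (system_homog w i)) => m.
have [hm|hm] := ltnP (d i) (mdeg m).
  by rewrite (degle_loc j x (system_homog w i)) //; apply: cl0.
apply: cl_mem; rewrite mem_cat; apply/orP; right.
apply/flattenP; exists (cfb bd (lc j x w) (i, mdeg m)).
  by apply: map_f; apply/allpairsPdep; exists i, (mdeg m); rewrite mem_enum mem_iota /= add0n ltnS.
have [m' h1 h2] := @degsetP N bd _ m erefl (leq_ltn_trans hm (dbd i)).
by apply/imageP; exists m'; rewrite // h2.
Qed.

Let Hc i m : cl (codom w ++ codom x) (lc j x w i m).
Proof.
apply: cl_loc => t; first by apply: cl_mem; rewrite mem_cat codom_f orbT.
by apply: system_coefs_cl => s; apply: cl_mem; rewrite mem_cat codom_f.
Qed.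

Let Hx : (rk [::] (codom x) <= N)%N.
Proof.
apply: leq_trans (_ : rk [::] [seq x (lift j s) | s <- enum 'I_N] <= _)%N.
  apply: rk_le_cl => _ /codomP [t ->]; case: (unliftP j t) => [s ->|->].
    by apply: cl_mem; rewrite cats0; apply: map_f; rewrite mem_enum.
  by rewrite xj; apply: cl1.
by apply: leq_trans (rk_size _ _) _; rewrite size_map size_enum_ord.
Qed.

Let Hc0 i : lc j x w i 0%MM = 0.
Proof. by rewrite /lc loc0. Qed.

Lemma generic_smooth (mu : 'I_k -> K) :
  (forall s, \sum_i mu i * lc j x w i U_(s)%MM = 0) -> forall i, mu i = 0.
Proof. exact: (linear_parts_indep bd3 HF HFc Hx Hc0 part). Qed.

Hypothesis sz2 : (size L2 <= k)%N.
Hypothesis deg2 : forall b, b \in L2 -> b.2 = 2%N.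
Hypothesis deg3 : forall b, b \in L3 -> (2 < b.2 < bd)%N.
Hypothesis Hk : (2 <= k)%N.
Variable M : nat.
Hypothesis HN : N = (M + k)%N.
Hypothesis HM : (3 * k + 4 <= M)%N.
Hypothesis szL : (size L2 + size L3 = M - 2)%N.

(** Take h generic over the coefficients of F, x and l. A nonzero common zero, scaled to have a
    coordinate 1, cannot be algebraic over those data, so that [no_excess_point] excludes it. *)
Lemma generic_hyperplane (l v : 'I_N -> K) :
  (forall i, \sum_t lc j x w i U_(t)%MM * v t = 0) -> \sum_t l t * v t != 0 ->
  exists h : 'I_N -> K, forall y : 'I_N -> K,
    (forall i, \sum_t lc j x w i U_(t)%MM * y t = 0) ->
    (forall b, b \in L2 ++ L3 ->
       \sum_(m in degset N bd b.2) lc j x w b.1 (bmnm m) * bmonv y m = 0) ->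
    \sum_t l t * y t = 0 -> \sum_t h t * y t = 0 -> forall t, y t = 0.
Proof.
move=> Tv lv; pose K0 := codom w ++ codom x.
have [h hh] := exists_generic char0 uncount (codom l ++ K0) N.
exists h => y r1 r23 rl rh t0; apply/eqP/negPn/negP => yt0.
pose y' t := (y t0)^-1 * y t.
have y't0 : y' t0 = 1 by rewrite /y' mulVf.
have lin (a : 'I_N -> K) : \sum_t a t * y t = 0 -> \sum_t a t * y' t = 0.
  move=> e; rewrite /y'; under eq_bigr do rewrite mulrCA.
  by rewrite -mulr_sumr e mulr0.
apply: (no_excess_point char0 bd3 HF HFc Hc Hx Hc0 part HN Hk HM sz2 deg2 deg3 szL
  y't0 _ _ (lin _ rl) _ Tv lv).
- by move=> i; apply: lin.
- move=> b bL; have := r23 b bL => e.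
  have -> : \sum_(m in degset N bd b.2) lc j x w b.1 (bmnm m) * bmonv y' m =
      (y t0)^-1 ^+ b.2 * \sum_(m in degset N bd b.2) lc j x w b.1 (bmnm m) * bmonv y m.
    rewrite mulr_sumr; apply: eq_bigr => m; rewrite inE => /eqP hm.
    rewrite mulrCA; congr (_ * _); rewrite /bmonv /monv /y' -(homog_meval _ _ (d := b.2)) //.
    by rewrite dhomogX; apply/eqP.
  by rewrite e mulr0.
rewrite lt0n; apply/eqP => rk0.
(* If y' were algebraic, the derivation dual to [h t0] would kill it; differentiating the equation
   of the hyperplane would then give [y' t0 = 0]. *)
have [D hD Dh] := rk_full_dual t0 hh.
have Dy t : D (y' t) = 0 by apply: (rk0_cl rk0) hD; apply: codom_f.
have := lin _ rh => e; have := der0 hD.1; rewrite -{1}e (der_sum _ _ _ hD.1).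
under eq_bigr => t _ do rewrite (derM _ _ hD.1) Dy mulr0 addr0 Dh.
rewrite (bigD1 t0) //= eqxx mul1r y't0 big1 ?addr0; last first.
  by move=> t /negPf ->; rewrite mul0r.
by move/eqP; rewrite oner_eq0.
Qed.
End AtPoint.
End GenericSystem.

(** * Regularity as a first-order condition on the coefficients *)

Section ChartFormula.
Variable K : closedFieldType.

Definition mpolyfun n k (p : ('I_n -> K) -> {mpoly K[k]}) :=
  forall m, polyfun (fun u => (p u)@_m).

Lemma mpolyfun_const n k (q : {mpoly K[k]}) : mpolyfun (fun _ : 'I_n -> K => q).
Proof. by move=> m; apply: polyfun_const. Qed.

Lemma mpolyfunC n k (g : ('I_n -> K) -> K) :
  polyfun g -> mpolyfun (fun u => (g u)%:MP_[k]).
Proof.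
move=> h m; apply: (@polyfun_ext _ _ (fun u => g u * (m == 0%MM)%:R)).
  by move=> u; rewrite mcoeffC.
by apply: polyfunM => //; apply: polyfun_const.
Qed.

Lemma mpolyfunD n k (p q : ('I_n -> K) -> {mpoly K[k]}) :
  mpolyfun p -> mpolyfun q -> mpolyfun (fun u => p u + q u).
Proof.
move=> hp hq m; apply: (@polyfun_ext _ _ (fun u => (p u)@_m + (q u)@_m)).
  by move=> u; rewrite mcoeffD.
exact: polyfunD.
Qed.

Lemma mpolyfunM n k (p q : ('I_n -> K) -> {mpoly K[k]}) :
  mpolyfun p -> mpolyfun q -> mpolyfun (fun u => p u * q u).
Proof.
move=> hp hq m; apply: polyfun_ext (fun u => esym (mcoeffM _ _ _)) _.
by apply: polyfun_sum => b _; apply: polyfunM.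
Qed.

Lemma mpolyfun_prod n k (I : Type) (r : seq I) (F : I -> ('I_n -> K) -> {mpoly K[k]}) :
  (forall i, mpolyfun (F i)) -> mpolyfun (fun u => \prod_(i <- r) F i u).
Proof.
move=> h; elim: r => [|i r IH].
  suff -> : (fun u => \prod_(i <- [::]) F i u) = (fun=> 1) by apply: mpolyfun_const.
  by apply: funext => u; rewrite big_nil.
suff -> : (fun u => \prod_(j <- i :: r) F j u) = (fun u => F i u * \prod_(j <- r) F j u).
  exact: mpolyfunM.
by apply: funext => u; rewrite big_cons.
Qed.

Lemma mpolyfunX n k (p : ('I_n -> K) -> {mpoly K[k]}) e :
  mpolyfun p -> mpolyfun (fun u => p u ^+ e).
Proof.
move=> h; elim: e => [|e IH].
  suff -> : (fun u => p u ^+ 0) = (fun=> 1) by apply: mpolyfun_const.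
  by apply: funext => u; rewrite expr0.
suff -> : (fun u => p u ^+ e.+1) = (fun u => p u * p u ^+ e) by apply: mpolyfunM.
by apply: funext => u; rewrite exprS.
Qed.

Variables (N k bd : nat) (d : 'I_k -> nat).

Section Terms.
Variables (n : nat) (X : ('I_n -> K) -> 'I_N.+1 -> K) (W : ('I_n -> K) -> 'I_(ncidx N bd d) -> K).
Hypothesis pX : forall t, polyfun (fun u => X u t).
Hypothesis pW : forall t, polyfun (fun u => W u t).

Lemma polyfun_lc j i m : polyfun (fun u => lc j (X u) (W u) i m).
Proof.
apply: (@polyfun_ext _ _ (fun u => \sum_(p : cidx N bd d | (val p).1 == i)
   W u (enum_rank p) * (smono j (X u) (bmnm (val p).2))@_m)).
  move=> u; rewrite /lc /system /loc (raddf_sum (comp_mpoly (gsubst j (X u)))).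
  rewrite raddf_sum /=; apply: eq_bigr => p _.
  by rewrite comp_mpolyZ comp_mpolyX mcoeffZ.
apply: polyfun_sum => p _; apply: polyfunM => //.
suff : mpolyfun (fun u => smono j (X u) (bmnm (val p).2)) by apply.
apply: mpolyfun_prod => t; apply: mpolyfunX.
have -> : (fun u => tnth (gsubst j (X u)) t) =
    (fun u => (X u t)%:MP + (if unlift j t is Some s then 'X_s else 0)).
  by apply: funext => u; rewrite tnth_mktuple.
by apply: mpolyfunD; [apply: mpolyfunC|apply: mpolyfun_const].
Qed.

Lemma polyfun_system i : polyfun (fun u => (system (W u) i).@[X u]).
Proof.
apply: (@polyfun_ext _ _ (fun u => \sum_(p : cidx N bd d | (val p).1 == i)
   W u (enum_rank p) * \prod_t X u t ^+ (bmnm (val p).2 t))).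
  move=> u; rewrite /system raddf_sum /=; apply: eq_bigr => p _.
  by rewrite mevalZ mevalX.
apply: polyfun_sum => p _; apply: polyfunM => //.
by apply: polyfun_prod => t _; apply: polyfunX.
Qed.
End Terms.

Lemma polyfun_dot n (a b : ('I_n -> K) -> 'I_N -> K) :
  (forall t, polyfun (fun u => a u t)) -> (forall t, polyfun (fun u => b u t)) ->
  polyfun (fun u => \sum_t a u t * b u t).
Proof. by move=> ha hb; apply: polyfun_sum => t _; apply: polyfunM. Qed.

(* First order in w, so that quantifier elimination applies: h is a hyperplane
   meeting {q = l = 0} only at the origin, i.e. the latter has dimension at
   most 1. *)
Definition good_charts (L : seq ('I_k * nat)) (w : 'I_(ncidx N bd d) -> K) :=
  forall (j : 'I_N.+1) (x : 'I_N.+1 -> K), x j = 1 ->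
  (forall i, (system w i).@[x] = 0) ->
  forall l v : 'I_N -> K, (forall i, \sum_t lc j x w i U_(t)%MM * v t = 0) ->
  ~ \sum_t l t * v t = 0 ->
  exists h : 'I_N -> K, forall y : 'I_N -> K,
    (forall i, \sum_t lc j x w i U_(t)%MM * y t = 0) ->
    (forall b : 'I_(size L), \sum_(m in degset N bd (tnth (in_tuple L) b).2)
       lc j x w (tnth (in_tuple L) b).1 (bmnm m) * bmonv y m = 0) ->
    \sum_t l t * y t = 0 -> \sum_t h t * y t = 0 -> forall t, y t = 0.

Lemma good_charts_definable L : definable (@good_charts L).
Proof.
apply: definable_all => j; apply: definable_forall.
apply: definable_imp; first by apply: definable_eq; [apply: polyfun_var|apply: polyfun_const].
apply: definable_imp.
  apply: definable_all => i; apply: definable_eq; last exact: polyfun_const.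
  by apply: polyfun_system => t; apply: polyfun_var.
apply: definable_forall; apply: definable_forall.
apply: definable_imp.
  apply: definable_all => i; apply: definable_eq; last exact: polyfun_const.
  apply: polyfun_dot => t; last exact: polyfun_var.
  by apply: polyfun_lc => s; apply: polyfun_var.
apply: definable_imp.
  apply: definable_not; apply: definable_eq; last exact: polyfun_const.
  by apply: polyfun_dot => t; apply: polyfun_var.
apply: definable_ex; apply: definable_forall.
apply: definable_imp.
  apply: definable_all => i; apply: definable_eq; last exact: polyfun_const.
  apply: polyfun_dot => t; last exact: polyfun_var.
  by apply: polyfun_lc => s; apply: polyfun_var.
apply: definable_imp.
  apply: definable_all => b; apply: definable_eq; last exact: polyfun_const.
  apply: polyfun_sum => m _; apply: polyfunM.
    by apply: polyfun_lc => s; apply: polyfun_var.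
  apply: (@polyfun_ext _ _ (fun u => \prod_t (u \o @rshift _ N) t ^+ bmnm m t)).
    by move=> u; rewrite /bmonv /monv mevalX.
  by apply: polyfun_prod => t _; apply: polyfunX; apply: polyfun_var.
apply: definable_imp.
  by apply: definable_eq; [apply: polyfun_dot => t; apply: polyfun_var|apply: polyfun_const].
apply: definable_imp.
  by apply: definable_eq; [apply: polyfun_dot => t; apply: polyfun_var|apply: polyfun_const].
by apply: definable_all => t; apply: definable_eq; [apply: polyfun_var|apply: polyfun_const].
Qed.

(** Relates the local linear parts to the Jacobian matrix in homogeneous coordinates, for
    non-singularity. *)
Lemma loc_linear_part (j : 'I_N.+1) (x : 'I_N.+1 -> K) (F : {mpoly K[N.+1]}) s :
  (loc j x F)@_U_(s)%MM = (F^`M(lift j s)).@[x].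
Proof.
have D0 (p : {mpoly K[N]}) : p@_U_(s)%MM = (p^`M(s)).@[fun=> 0].
  by rewrite -mcoeff0_meval mcoeff_mderiv add0m mnm0E mulr1n.
pose E (G : {mpoly K[N.+1]}) := ((loc j x G)^`M(s)).@[fun=> 0] = (G^`M(lift j s)).@[x].
have V G : (loc j x G).@[fun=> 0] = G.@[x] by rewrite -mcoeff0_meval loc0.
have locM p q : loc j x (p * q) = loc j x p * loc j x q by rewrite /loc rmorphM.
have EM p q : E p -> E q -> E (p * q).
  by rewrite /E => hp hq; rewrite locM !mderivM !mevalD !mevalM !V hp hq.
have E1 : E 1.
  by rewrite /E /loc rmorph1 -!mpolyC1 !mderivC !meval0.
have UU q (r : 'I_q) : (U_(r) - U_(r))%MM = 0%MM by rewrite -{1}[U_(r)%MM]add0m addmK.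
have EX t : E 'X_t.
  rewrite /E /loc comp_mpolyXU -tnth_nth tnth_mktuple mderivD mderivC add0r.
  rewrite [in RHS]mderivX mnm1E mevalZ.
  have [->|ts] := eqVneq t (lift j s).
    by rewrite liftK mderivX mnm1E eqxx mevalZ !UU !mpolyX0 !meval1.
  rewrite mul0r; case: unliftP => [s' es|_]; last by rewrite mderiv0 meval0.
  rewrite mderivX mnm1E; case: eqP => [e|_]; last by rewrite scale0r meval0.
  by move: ts; rewrite es e eqxx.
have EXm m : E 'X_[m].
  rewrite mpolyXE_id; apply: (big_ind E) => // t _.
  by elim: (m t) => [|e IH]; rewrite ?expr0 // exprS; apply: EM.
rewrite D0; suff : E F by [].
rewrite [F]mpolyE; apply: (big_ind E) => [|p q|m _].
- by rewrite /E /loc comp_mpoly0 !mderiv0 !meval0.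
- by rewrite /E /loc comp_mpolyD !mderivD !mevalD => -> ->.
- by have := EXm m; rewrite /E /loc comp_mpolyZ !mderivZ !mevalZ => ->.
Qed.

End ChartFormula.

(** * The index set I *)

Section IndexSet.
Variables (k : nat) (d : 'I_k -> nat).
Hypothesis k2 : (2 <= k)%N.
Hypothesis d2 : forall i, (2 <= d i)%N.
Hypothesis dmono : forall i j : 'I_k, (i <= j)%N -> (d i <= d j)%N.

Lemma last_lt : (k.-1 < k)%N. Proof. by case: k k2. Qed.
Lemma prev_lt : (k.-2 < k)%N. Proof. by case: k k2 => [|[]]. Qed.
Definition ilast : 'I_k := Ordinal last_lt.
Definition iprev : 'I_k := Ordinal prev_lt.

Lemma is_lastE i : is_last i = (i == ilast). Proof. by []. Qed.
Lemma is_prevE i : is_prev i = (i == iprev). Proof. by []. Qed.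

Lemma last_neq_prev : ilast != iprev.
Proof. by apply/eqP => /(congr1 val) /=; case: k k2 => [|[]] // n _ /=; lia. Qed.

Lemma top_equalE : top_equal d = (d ilast == d iprev).
Proof.
apply/existsP/eqP => [[i /existsP [i' /and3P [h1 h2 /eqP h3]]]|h].
  by move: h1 h2 h3; rewrite is_lastE is_prevE => /eqP -> /eqP ->.
by exists ilast; apply/existsP; exists iprev; rewrite is_lastE is_prevE !eqxx h eqxx.
Qed.

Lemma not_top : ~~ top_equal d -> (2 < d ilast)%N.
Proof.
rewrite top_equalE => h; apply: leq_ltn_trans (d2 iprev) _.
rewrite ltn_neqAle eq_sym h /=; apply: dmono => /=.
by case: k k2 => [|[]].
Qed.

Definition removed1 : 'I_k * nat := (ilast, d ilast).
Definition removed2 : 'I_k * nat :=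
  if top_equal d then (iprev, d iprev) else (ilast, (d ilast).-1).

Lemma removedE i j : removed d i j = ((i, j) \in [:: removed1; removed2]).
Proof.
rewrite /removed /removed2 !inE is_lastE is_prevE; case: ifP => _; rewrite !xpair_eqE.
  have [->|_] := eqVneq i ilast; first by rewrite (negPf last_neq_prev) /= orbF.
  by have [->|_] := eqVneq i iprev.
by have [->|] //= := eqVneq i ilast.
Qed.

Lemma removed1_neq : removed1 != removed2.
Proof.
rewrite /removed2; case: ifP => _; rewrite xpair_eqE.
  by rewrite (negPf last_neq_prev).
by rewrite eqxx /=; have := d2 ilast; case: (d ilast) => // n _; rewrite gtn_eqF /=.
Qed.

Lemma removed_range b : b \in [:: removed1; removed2] -> (1 < b.2 <= d b.1)%N.
Proof.
rewrite !inE => /orP [/eqP->|/eqP->] /=; first by rewrite d2 leqnn.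
rewrite /removed2; case: ifP => [_|/negbT /not_top h] /=; first by rewrite d2 leqnn.
by move: h; case: (d ilast) => // n h; rewrite /= -ltnS h leqnSn.
Qed.

Lemma inI1 i : inI d i 1.
Proof.
rewrite /inI removedE /= (ltnW (d2 i)) /=; apply/negP => /removed_range.
by rewrite ltnn.
Qed.

Let allb := all_blocks d.
Definition quadric_blocks := [seq b <- allb | inI d b.1 b.2 & b.2 == 2%N].
Definition high_blocks := [seq b <- allb | inI d b.1 b.2 & (2 < b.2)%N].
Definition removed_blocks := [seq b <- allb | removed d b.1 b.2].

Lemma mem_all_blocks b : (b \in allb) = (b.2 <= d b.1)%N.
Proof.
apply/allpairsPdep/idP => [[i [j [_ hj ->]]]|h].
  by move: hj; rewrite mem_iota add0n ltnS.
by exists b.1, b.2; rewrite mem_enum mem_iota add0n ltnS h -surjective_pairing.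
Qed.

Lemma uniq_all_blocks : uniq allb.
Proof.
apply: allpairs_uniq_dep; first exact: enum_uniq.
  by move=> i _; apply: iota_uniq.
by move=> [i1 j1] [i2 j2] _ _ /= [-> ->].
Qed.

Lemma mem_blocks j (b : 'I_k * nat) : (b \in blocks k j) = (b.2 == j).
Proof.
apply/mapP/eqP => [[i _ ->] //|<-].
by exists b.1; rewrite ?mem_enum -?surjective_pairing.
Qed.

Lemma uniq_blocks j : uniq (blocks k j).
Proof. by rewrite map_inj_uniq ?enum_uniq // => i1 i2 []. Qed.

Lemma size_blocks j : size (blocks k j) = k.
Proof. by rewrite size_map size_enum_ord. Qed.

Lemma blocks_partition :
  perm_eq allb (blocks k 0 ++ blocks k 1 ++ quadric_blocks ++ high_blocks ++ removed_blocks).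
Proof.
apply: uniq_perm; first exact: uniq_all_blocks.
  have U p : uniq [seq b <- allb | p b] by rewrite filter_uniq ?uniq_all_blocks.
  rewrite !cat_uniq !U !uniq_blocks /= !andbT -!all_predC.
  have R b : b \in removed_blocks -> (1 < b.2)%N /\ ~~ inI d b.1 b.2.
    rewrite mem_filter => /andP [h _]; split; last by rewrite /inI h !andbF.
    by move: h; rewrite removedE -surjective_pairing => /removed_range /andP [].
  have Q b : b \in quadric_blocks -> inI d b.1 b.2 /\ b.2 = 2%N.
    by rewrite mem_filter => /andP [/andP [-> /eqP]].
  have H b : b \in high_blocks -> inI d b.1 b.2 /\ (2 < b.2)%N.
    by rewrite mem_filter => /andP [/andP []].
  apply/and4P; split; apply/allP => b; rewrite ?mem_cat /=.
  - rewrite !mem_blocks => /or4P [/eqP->//|/Q [_ ->]//|/H [_]|/R [+ _]]; by case: (b.2) => [|[]].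
  - rewrite !mem_blocks => /or3P [/Q [_ ->]//|/H [_]|/R [+ _]]; by case: (b.2) => [|[]].
  - move=> /orP [/H [_ h]|/R [_ h]]; apply/negP => /Q [h1 h2]; first by rewrite h2 in h.
    by rewrite h1 in h.
  - by move=> /R [_ h]; apply/negP => /H [h1 _]; rewrite h1 in h.
move=> b; rewrite !mem_cat !mem_blocks !mem_filter mem_all_blocks.
case hb: (b.2 <= d b.1)%N; rewrite ?andbT ?andbF ?orbF.
  case e0 : (b.2 == 0%N) => //=; case e1 : (b.2 == 1%N) => //=.
  rewrite /inI hb /= lt0n e0 /=.
  case: (removed d b.1 b.2); rewrite ?orbT //= orbF.
  by symmetry; have := e0; have := e1; case: (b.2) => [|[|[|n]]].
symmetry; apply/negbTE; rewrite negb_or; apply/andP; split.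
  by apply/eqP => h; rewrite h in hb.
by apply/eqP => h; move: hb; rewrite h ltnW // d2.
Qed.

Lemma size_removed_blocks : size removed_blocks = 2%N.
Proof.
rewrite -[RHS]/(size [:: removed1; removed2]); apply: perm_size; apply: uniq_perm.
- by rewrite filter_uniq ?uniq_all_blocks.
- by rewrite /= inE andbT removed1_neq.
move=> b; rewrite mem_filter removedE -surjective_pairing mem_all_blocks.
by case h: (b \in _) => //=; have /andP [_ ->] := removed_range h.
Qed.

Lemma size_all_blocks : size allb = (\sum_i d i + k)%N.
Proof.
rewrite size_allpairs_dep sumnE big_map big_enum /=.
under eq_bigr => i _ do rewrite size_iota -addn1.
by rewrite big_split /= sum1_card card_ord.
Qed.

Lemma size_index_blocks : (size quadric_blocks + size high_blocks + k + 2 = \sum_i d i)%N.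
Proof.
have := perm_size blocks_partition; rewrite size_all_blocks !size_cat !size_blocks.
by rewrite size_removed_blocks; move: (\sum_i d i)%N (size _) (size _) => s a b; lia.
Qed.

Lemma size_quadric_blocks : (size quadric_blocks <= k)%N.
Proof.
apply: leq_trans (_ : size (blocks k 2) <= _)%N; last by rewrite size_blocks.
apply: uniq_leq_size.
  by rewrite filter_uniq ?uniq_all_blocks.
by move=> b; rewrite mem_filter mem_blocks => /andP [/andP []].
Qed.

Lemma d_lt_Ibound i : (d i < Ibound d)%N.
Proof. by rewrite ltnS (bigD1 i) //= leq_addr. Qed.

(** As N is the sum of the d_i, the required codimension #I + 1 is N - 1: the cones to be studied
    are curves. *)
Lemma card_IE : (card_I d + 2 = \sum_i d i)%N.
Proof.
rewrite -size_index_blocks; congr (_ + _)%N.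
pose f (p : 'I_k * 'I_(Ibound d)) : 'I_k * nat := (p.1, val p.2).
have finj : injective f by move=> [i j] [i' j'] [-> /val_inj ->].
rewrite /card_I cardE -(size_map f).
have /perm_size -> : perm_eq [seq f p | p <- enum [set ij | inI d ij.1 (ij : 'I_k * 'I_(Ibound d)).2]]
    (blocks k 1 ++ (quadric_blocks ++ high_blocks)).
  have part := blocks_partition.
  apply: uniq_perm.
  - by rewrite map_inj_uniq ?enum_uniq.
  - have := perm_uniq part; rewrite uniq_all_blocks => /esym.
    rewrite cat_uniq => /and3P [_ _]; rewrite !catA cat_uniq => /and3P [h _ _].
    exact: h.
  move=> b; rewrite !mem_cat mem_blocks !mem_filter mem_all_blocks.
  apply/mapP/idP => [[p]|].
    rewrite mem_enum inE => h ->; rewrite /= h /=.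
    have /and3P [h1 h2 _] := h; rewrite h2 !andbT.
    by move: h1; case: (val p.2) => [|[|[|n]]].
  move=> hb; have hI : inI d b.1 b.2.
    case/or3P: hb => [/eqP ->|/andP [/andP []]|/andP [/andP []]] //; exact: inI1.
  have /and3P [_ h2 _] := hI.
  exists (b.1, Ordinal (leq_ltn_trans h2 (d_lt_Ibound b.1))).
    by rewrite mem_enum inE.
  by rewrite /f /= -surjective_pairing.
by rewrite !size_cat size_blocks addnC.
Qed.

End IndexSet.

(** * Homogeneous parts and restriction to a line *)

Section HomogeneousParts.
Variable K : closedFieldType.
Variables (n bd : nat).

Definition hp (e : nat) (p : {mpoly K[n]}) : {mpoly K[n]} :=
  \sum_(m <- msupp p | mdeg m == e) p@_m *: 'X_[m].

Lemma hp_homog e p : hp e p \is e.-homog.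
Proof. by apply: rpred_sum => m me; apply: rpredZ; rewrite dhomogX. Qed.

Lemma hp_meval e p (y : 'I_n -> K) : (e < bd)%N ->
  (hp e p).@[y] = \sum_(m in degset n bd e) p@_(bmnm m) * bmonv y m.
Proof.
move=> eb; rewrite /hp raddf_sum /=.
transitivity (\sum_(m <- msupp p | mdeg m == e) p@_m * monv y m).
  by apply: eq_bigr => m _; rewrite mevalZ.
pose G := [seq bmnm m | m <- enum (degset n bd e)].
have -> : \sum_(m in degset n bd e) p@_(bmnm m) * bmonv y m = \sum_(m <- G) p@_m * monv y m.
  by rewrite big_map big_enum.
have uG : uniq G by rewrite map_inj_uniq ?enum_uniq //; apply: val_inj.
have memG m : (m \in G) = (mdeg m == e).
  apply/mapP/eqP => [[m' ]|me]; first by rewrite mem_enum inE => /eqP + ->.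
  by have [m' h1 h2] := degsetP me eb; exists m'; rewrite ?mem_enum.
rewrite -big_filter [RHS](bigID (mem (msupp p))) /= [X in _ + X]big1 ?addr0; last first.
  by move=> m /memN_msupp_eq0 ->; rewrite mul0r.
rewrite -[RHS]big_filter; apply: perm_big; apply: uniq_perm.
- by rewrite filter_uniq // msupp_uniq.
- by rewrite filter_uniq.
by move=> m; rewrite !mem_filter memG andbC.
Qed.

Lemma sum_degset1 (f : 'X_{1..n} -> K) (y : 'I_n -> K) : (1 < bd)%N ->
  \sum_(m in degset n bd 1) f (bmnm m) * bmonv y m = \sum_t f U_(t)%MM * y t.
Proof.
move=> b1.
have h (t : 'I_n) : exists m : 'X_{1..n < bd}, m \in degset n bd 1 /\ bmnm m = U_(t)%MM.
  by have [m h1 h2] := degsetP (mdeg1 t) b1; exists m.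
have [g hg] := boolp.choice h.
have ginj : injective g.
  move=> i j /(congr1 (@bmnm _ _)); rewrite (hg i).2 (hg j).2 => /eqP.
  by rewrite eq_mnm1 => /eqP.
have -> : degset n bd 1 = g @: [set: 'I_n].
  apply/setP => m; apply/idP/imsetP => [|[t _ ->]]; last by case: (hg t).
  rewrite inE => /mdeg1P [t /eqP e]; exists t; rewrite ?inE //.
  by apply: val_inj; rewrite /= e (hg t).2.
rewrite big_imset /=; last by move=> i j _ _ /ginj.
rewrite big_mkcond; apply: eq_bigr => t _; rewrite inE (hg t).2.
by rewrite /bmonv (hg t).2 monv1.
Qed.

Lemma mderiv_homog d (p : {mpoly K[n]}) i : p \is d.+1.-homog -> p^`M(i) \is d.-homog.
Proof.
move=> hp'; apply/dhomogP => m; rewrite mcoeff_msupp mcoeff_mderiv => hm.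
have : (m + U_(i))%MM \in msupp p.
  by rewrite mcoeff_msupp; apply: contraNneq hm => ->; rewrite mul0rn.
by move=> hm'; have /eqP := dhomogP _ _ _ hp' _ hm'; rewrite /= mdegD mdeg1 addn1 eqSS => /eqP.
Qed.

Definition line_poly (p : {mpoly K[n]}) (z : 'I_n -> K) : {poly K} :=
  \sum_(m <- msupp p) (p@_m * \prod_i z i ^+ m i) *: 'X^(mdeg m).

Lemma line_polyE p z t : (line_poly p z).[t] = p.@[fun i => t * z i].
Proof.
rewrite /line_poly horner_sum mevalE; apply: eq_bigr => m _.
rewrite hornerZ hornerXn -mulrA; congr (_ * _).
under [in RHS]eq_bigr => i _ do rewrite exprMn.
by rewrite big_split /= -expr_sum -mdegE mulrC.
Qed.

Lemma poly_nonroot (P : {poly K}) : P != 0 -> exists t, P.[t] != 0.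
Proof.
by move=> /closed_nonrootP [t]; rewrite rootE; exists t.
Qed.
End HomogeneousParts.

(** * Uncountability of the reals *)

Section Reals.
Local Notation R := Rdefinitions.R.

Lemma reals_uncountable (u : nat -> R) : exists r, forall m, u m != r.
Proof.
(* Nested intervals avoiding [u i]. The second choice is the left quarter rather than the left half,
   so that the midpoint itself is avoided too. *)
pose step (i : nat) (ab : R * R) : R * R :=
  if u i < (ab.1 + ab.2) / 2%:R then ((ab.1 + ab.2) / 2%:R, ab.2)
  else (ab.1, (ab.1 + (ab.1 + ab.2) / 2%:R) / 2%:R).
pose J m := iteri m step (0, 1).
have JS m : J m.+1 = step m (J m) by [].
have lt m : (J m).1 < (J m).2.
  elim: m => [|m IH]; first by rewrite /J /= ltr01.
  by rewrite JS /step; move: IH; case: ifP => _ /=; lra.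
have mono m : (J m).1 <= (J m.+1).1 /\ (J m.+1).2 <= (J m).2.
  by rewrite JS /step; have := lt m; case: ifP => _ /= h; split; lra.
have avoid m : u m < (J m.+1).1 \/ (J m.+1).2 < u m.
  rewrite JS /step; have := lt m; case: ifP => /= hu h; first by left.
  by right; move/negbT: hu; rewrite -leNgt; lra.
have mono1 m l : (J m).1 <= (J (m + l)%N).1.
  elim: l => [|l IH]; first by rewrite addn0.
  by rewrite addnS; apply: le_trans IH _; case: (mono (m + l)%N).
have mono2 m l : (J (m + l)%N).2 <= (J m).2.
  elim: l => [|l IH]; first by rewrite addn0.
  by rewrite addnS; apply: le_trans IH; case: (mono (m + l)%N).
have cross m l : (J m).1 <= (J l).2.
  apply: le_trans (mono1 m l) _; apply: le_trans (ltW (lt _)) _.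
  by rewrite addnC; apply: mono2.
pose E r := exists m, r = (J m).1.
have bE : Raxioms.bound E.
  by exists (J 0%N).2 => r [m ->]; apply/RleP.
have [c [c1 c2]] := Raxioms.completeness E bE (ex_intro E _ (ex_intro _ 0%N erefl)).
exists c => m; apply/eqP => e.
have l1 l : (J l).1 <= c by apply/RleP/c1; exists l.
have l2 l : c <= (J l).2 by apply/RleP/c2 => r [m' ->]; apply/RleP.
by case: (avoid m); rewrite e; have := l1 m.+1; have := l2 m.+1; lra.
Qed.
End Reals.

(** * Dimension of complex cones *)

Section ComplexDimension.
Local Notation R := Rdefinitions.R.
Definition Cc : closedFieldType := complex R.

Lemma Cc_char0 n : n.+1%:R != 0 :> Cc.
Proof. exact: (negbT (@pnatr_eq0 (complex R) n.+1)). Qed.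

Lemma Cc_uncountable (f : nat -> seq Cc) : exists z, forall n, z \notin f n.
Proof.
pose u m : R := if unpickle m is Some p then complex.Re (nth 0 (f p.1) p.2) else 0.
have [r hr] := reals_uncountable u.
exists (Complex r 0 : complex R) => n; apply/negP => /(nthP 0) [j _ e].
by have := hr (pickle (n, j)); rewrite /u pickleK /= e eqxx.
Qed.

Variable n : nat.
Implicit Types (Y Z : ('I_n -> C) -> Prop) (p : {mpoly C[n]}).

Lemma zclosed_zero p : zclosed (fun v => p.@[v] = 0).
Proof. by exists (fun q => q = p) => v; split=> [h q -> //|]; apply. Qed.

Lemma zclosed_or Z1 Z2 : zclosed Z1 -> zclosed Z2 -> zclosed (fun v => Z1 v \/ Z2 v).
Proof.
move=> [S1 h1] [S2 h2]; exists (fun p => exists p1 p2, [/\ S1 p1, S2 p2 & p = p1 * p2]) => v.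
split=> [hv p [p1 [p2 [s1 s2 ->]]]|h].
  rewrite mevalM; case: hv => [/h1|/h2] hv; first by rewrite (hv p1 s1) mul0r.
  by rewrite (hv p2 s2) mulr0.
apply: contrapT => hn; have [n1 n2] : ~ Z1 v /\ ~ Z2 v by split=> h'; apply: hn; [left|right].
apply: n1; apply/h1 => p1 s1; apply: contrapT => e1.
apply: n2; apply/h2 => p2 s2; apply: contrapT => e2.
have := h (p1 * p2); rewrite mevalM => /(_ (ex_intro _ p1 (ex_intro _ p2 (And3 s1 s2 erefl)))).
by move/eqP; rewrite mulf_eq0 => /orP [/eqP|/eqP].
Qed.

Lemma zclosed_has (I : eqType) (s : seq I) (q : I -> {mpoly C[n]}) :
  zclosed (fun v => exists2 c, c \in s & (q c).@[v] = 0).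
Proof.
elim: s => [|c s [S IH]].
  exists (fun=> True) => v; split=> [[c] //|h].
  by have /eqP := h 1 Logic.I; rewrite meval1 oner_eq0.
have [S' h'] := zclosed_or (zclosed_zero (q c)) (ex_intro _ S IH).
exists S' => v; rewrite -h'; split=> [[c' ]|[h|[c' h1 h2]]].
- by rewrite inE => /orP [/eqP ->|h1 h2]; [left|right; exists c'].
- by exists c; rewrite ?mem_head.
by exists c'; rewrite // inE h1 orbT.
Qed.

Lemma zirreducible_has Y (I : eqType) (s : seq I) (q : I -> {mpoly C[n]}) :
  zirreducible Y -> (forall v, Y v -> exists2 c, c \in s & (q c).@[v] = 0) ->
  exists c, forall v, Y v -> (q c).@[v] = 0.
Proof.
move=> [_ [v0 Yv0] irr]; elim: s => [|c s IH] h; first by case: (h v0 Yv0).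
case: (irr _ _ (zclosed_zero (q c)) (zclosed_has s q)) => [v Yv| |].
- have [c'] := h v Yv; rewrite inE => /orP [/eqP ->|h1 h2]; first by left.
  by right; exists c'.
- by move=> h'; exists c.
by move=> h'; apply: IH.
Qed.

Definition line (z : 'I_n -> C) (v : 'I_n -> C) : Prop := exists t, v = fun i => t * z i.

(** On a line, equations become polynomials in the parameter. If neither closed set contained the
    line, the product of two nonzero such polynomials would have a non-root, giving a point outside
    both. *)
Lemma zirreducible_line (z : 'I_n -> C) : zirreducible (line z).
Proof.
split.
- exists (fun p => forall t, p.@[fun i => t * z i] = 0) => v; split=> [[t ->] p //|h].
  have [/existsP [i0 zi0]|z0] := boolP [exists i, z i != 0]; last first.
    have zi i : z i = 0.
      by apply/eqP; apply: contraNT z0 => zi; apply/existsP; exists i.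
    exists 0; apply: boolp.funext => i; rewrite mul0r.
    by have := h 'X_i; rewrite mevalXU; apply => t; rewrite mevalXU zi mulr0.
  exists (v i0 / z i0); apply: boolp.funext => i.
  have := h (z i0 *: 'X_i - z i *: 'X_i0); rewrite mevalB !mevalZ !mevalXU => e.
  rewrite mulrAC; apply: (canRL (mulfK zi0)); rewrite mulrC [RHS]mulrC.
  by apply/eqP; rewrite -subr_eq0 e // => t; rewrite mevalB !mevalZ !mevalXU mulrCA [z i * _]mulrCA [z i * _]mulrC subrr.
- by exists (fun i => 0 * z i), 0.
move=> Z1 Z2 [S1 h1] [S2 h2] h.
apply: contrapT => hn.
have nline Z S : (forall v, Z v <-> zset S v) -> ~ subs (line z) Z ->
    exists2 p, S p & line_poly (p : {mpoly Cc[n]}) z != 0.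
  move=> hS hZ; apply: contrapT => np; apply: hZ => _ [t ->]; apply/hS => p Sp.
  apply: contrapT => pz; apply: np; exists p => //; apply/eqP => e.
  by apply: pz; have := line_polyE (p : {mpoly Cc[n]}) z t; rewrite e horner0.
have [p1 s1 n1] := nline _ _ h1 (fun h' => hn (or_introl h')).
have [p2 s2 n2] := nline _ _ h2 (fun h' => hn (or_intror h')).
have [t] := poly_nonroot (mulf_neq0 n1 n2).
rewrite hornerM !line_polyE mulf_eq0 => /norP [/eqP e1 /eqP e2].
by case: (h (fun i => t * z i) (ex_intro _ t erefl)) => [/h1 /(_ _ s1)|/h2 /(_ _ s2)].
Qed.

(** The chain consists of the origin, as the line through the zero vector, and the line through
    z. *)
Lemma dim_ge1_cone Z (z : 'I_n -> C) i : z i != 0 -> subs (line z) Z -> dim_ge Z 1.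
Proof.
move=> zi h; exists (fun m => if m is 0%N then line (fun=> 0) else line z); split.
- by case=> [|m] _; apply: zirreducible_line.
- case=> // _; split=> [_ [t ->]|].
    by exists 0; apply: boolp.funext => s; rewrite mulr0 mul0r.
  exists z; split; first by exists 1; apply: boolp.funext => s; rewrite mul1r.
  by move=> [t /(congr1 (@^~ i)) /eqP]; rewrite mulr0 (negPf zi).
by [].
Qed.

(** Scaled to height h = 1, the points of Z have finitely many possible coordinates, so the
    irreducible [Y 2] lies on one line v = h(v) c. A proper closed subset [Y 1] of it meets only
    finitely many heights, hence one by irreducibility, and is a point; [Y 0] cannot be smaller. *)
Lemma not_dim_ge2_cone Z (h : {mpoly C[n]}) : h \is 1.-homog ->
  (forall v c, Z v -> Z (fun i => c * v i)) ->
  (forall v, Z v -> h.@[v] = 0 -> forall i, v i = 0) ->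
  (forall i, exists2 P : {poly C}, P != 0 & forall v, Z v -> h.@[v] = 1 -> P.[v i] = 0) ->
  ~ dim_ge Z 2.
Proof.
move=> hh cone triv fin [Y [irr inc sub]].
have roots (P : {poly C}) : P != 0 -> exists s : seq C, forall c, P.[c] = 0 -> c \in s.
  move=> P0; have [s e] := closed_field_poly_normal (P : {poly Cc}).
  exists s => c /eqP; rewrite -rootE e rootZ ?lead_coef_eq0 //.
  by rewrite root_prod_XsubC.
have /boolp.choice [c hc] : forall i, exists c, forall v, Y 2%N v -> ('X_i - c *: h).@[v] = 0.
  move=> i; have [P P0 hP] := fin i; have [s hs] := roots P P0.
  (* The extra 0 serves the points of height 0, which are the origin by [triv]. *)
  apply: (zirreducible_has (s := 0 :: s) (irr 2%N _)) => // v /sub Zv.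
  have [h0|h0] := eqVneq h.@[v] 0.
    by exists 0; rewrite ?mem_head // mevalB mevalZ mevalXU mul0r subr0 triv.
  exists (h.@[v]^-1 * v i).
    rewrite inE orbC hs //; apply: hP (cone _ _ Zv) _.
    by rewrite (homog_meval (K := Cc) _ _ hh) expr1 mulVf.
  by rewrite mevalB mevalZ mevalXU mulrC mulrA divff // mul1r subrr.
have hc' v : Y 2%N v -> v = fun i => h.@[v] * c i.
  move=> /hc e; apply: boolp.funext => i; have := e i.
  by rewrite mevalB mevalZ mevalXU mulrC => /eqP; rewrite subr_eq0 => /eqP.
have [s01 [v1 [Y1v1 nY0]]] := inc 0%N isT.
have [s12 [w [Y2w nY1]]] := inc 1%N isT.
have [[S hS] _ _] := irr 1%N isT.
have [p Sp pw] : exists2 p, S p & p.@[w] != 0.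
  apply: contrapT => np; apply: nY1; apply/hS => p Sp; apply/eqP/negPn/negP => pw.
  by apply: np; exists p.
pose q := line_poly (p : {mpoly Cc[n]}) c.
have qE t : q.[t] = p.@[fun i => t * c i] := line_polyE (p : {mpoly Cc[n]}) c t.
have q0 : q != 0.
  by apply: contraNneq pw => e; rewrite (hc' w Y2w) -qE e horner0.
have [s hs] := roots q q0.
have [rho hrho] : exists rho, forall v, Y 1%N v -> (h - rho%:MP).@[v] = 0.
  apply: (zirreducible_has (s := s) (irr 1%N _)) => // v Yv; exists h.@[v].
    by apply: hs; rewrite qE -(hc' v (s12 v Yv)); apply: (iffLR (hS v) Yv).
  by rewrite mevalB mevalC subrr.
have one v : Y 1%N v -> v = fun i => rho * c i.
  move=> Yv; rewrite [LHS](hc' v (s12 v Yv)); apply: boolp.funext => i; congr (_ * _).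
  by apply/eqP; rewrite -subr_eq0; have := hrho v Yv; rewrite mevalB mevalC => ->.
have [_ [v0 Y0v0] _] := irr 0%N isT.
by apply: nY0; rewrite (one v1 Y1v1) -(one v0 (s01 _ Y0v0)).
Qed.

End ComplexDimension.

(** * From the first-order condition to regularity *)

Section Regularity.

Lemma zset_cone n (S : {mpoly C[n]} -> Prop) v (c : C) :
  (forall p, S p -> exists e, p \is e.-homog) -> zset S v -> zset S (fun i => c * v i).
Proof.
move=> hS h p Sp; have [e he] := hS p Sp.
by rewrite (homog_meval (K := Cc) _ _ he) h // mulr0.
Qed.

(* If h has no zero on the cone {g = 0} but the origin, then {g = 0, h = 1} is
   finite, and the cone is a finite union of lines. *)
Lemma complete_intersection_dim1 n r (g : 'I_r -> {mpoly C[n]}) (e : 'I_r -> nat)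
    (h : {mpoly C[n]}) : r.+1 = n ->
  (forall a, (0 < e a)%N) -> (forall a, g a \is (e a).-homog) -> h \is 1.-homog ->
  (forall v, (forall a, (g a).@[v] = 0) -> h.@[v] = 0 -> forall i, v i = 0) ->
  has_dim (zset (fun p => exists a, p = g a)) 1.
Proof.
move=> rn e0 hg hh triv; set Z := zset _.
have ZP v : Z v <-> forall a, (g a).@[v] = 0.
  by split=> [hv a|hv _ [a ->]]; [apply: hv; exists a|apply: hv].
have cone v c : Z v -> Z (fun i => c * v i).
  by apply: zset_cone => _ [a ->]; exists (e a).
split.
  have rn' : (r < n)%N by rewrite -rn.
  have [z [hz [i zi]]] := common_zero (K := Cc) Cc_char0 Cc_uncountable e0 hg rn'.
  by apply: (dim_ge1_cone zi) => _ [t ->]; apply: cone; apply/ZP.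
apply: (not_dim_ge2_cone hh) => [v c|v /ZP hv hv0|i].
- exact: cone.
- exact: triv.
pose g' a := if unlift ord0 a is Some b then g b else h : {mpoly Cc[n]}.
pose e' a := if unlift ord0 a is Some b then e b else 1%N.
have e'0 a : (0 < e' a)%N by rewrite /e'; case: unlift.
have hg' a : g' a \is (e' a).-homog by rewrite /e' /g'; case: unlift.
have triv' : only_trivial_zero g'.
  move=> v hv; apply: triv => [a|]; first by have := hv (lift ord0 a); rewrite /g' liftK.
  by have := hv ord0; rewrite /g' unlift_none.
have [P P0 hP] := finite_at_height_one Cc_uncountable e'0 hg' ord0 triv' i.
exists P => // v /ZP hv h1; apply: hP; last by rewrite /g' unlift_none.
by move=> a; case: (unliftP ord0 a) => [b ->|->]; rewrite ?eqxx // /g' liftK => _.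
Qed.

Lemma linear_form_meval n (l : {mpoly C[n]}) (y : 'I_n -> C) : l \is 1.-homog ->
  l.@[y] = \sum_t l@_U_(t)%MM * y t.
Proof.
move=> hl; have <- := sum_degset1 (K := Cc) (fun m => l@_m) y (bd := 2) isT.
rewrite -(hp_meval (K := Cc) (e := 1)) //; congr meval.
rewrite /hp {1}[l]mpolyE [LHS]big_seq_cond [RHS]big_seq_cond; apply: eq_bigl => m.
rewrite andbT; case: (boolP (m \in _)) => //= lm.
by apply/esym/eqP; apply: (dhomogP _ _ _ hl).
Qed.

Variables (k : nat) (d : 'I_k -> nat).
Hypothesis k2 : (2 <= k)%N.
Hypothesis d2 : forall i, (2 <= d i)%N.
Hypothesis dmono : forall i j : 'I_k, (i <= j)%N -> (d i <= d j)%N.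
Variable N : nat.
Hypothesis NE : N = (\sum_i d i)%N.

Lemma chart_idx_neq0 (x : 'I_N.+1 -> C) : nonzero_pt x -> x (chart_idx x) != 0.
Proof.
by move=> [t xt]; rewrite /chart_idx; case: pickP => [//|/(_ t)]; rewrite xt.
Qed.

Lemma on_V_scale (F : 'I_k -> {mpoly C[N.+1]}) (x : 'I_N.+1 -> C) c :
  (forall i, F i \is (d i).-homog) -> on_V F x -> on_V F (fun t => c * x t).
Proof. by move=> hF h i; rewrite (homog_meval (K := Cc) _ _ (hF i)) h mulr0. Qed.

(** The vector h of [good_charts], read as a linear form, meets the cone {l = q = 0} only at the
    origin. That cone has N - 1 equations, so [complete_intersection_dim1] applies. *)
Lemma regular_of_good_charts (F : 'I_k -> {mpoly C[N.+1]})
    (w : 'I_(ncidx N (Ibound d) d) -> Cc) :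
  (forall i, F i \is (d i).-homog) ->
  (forall i, system (K := Cc) w i = F i) ->
  good_charts (bd := Ibound d) (quadric_blocks d ++ high_blocks d) w -> regular d F.
Proof.
move=> hF hw good x x0 onx q T l hl [v [Tv lv]].
pose j := chart_idx x; have xj : x j != 0 := chart_idx_neq0 x0.
pose x' t := x t / x j; have x'j : x' j = 1 by rewrite /x' divff.
have onx' i : (system (K := Cc) w i).@[x'] = 0.
  rewrite hw -[RHS](on_V_scale ((x j)^-1) hF onx i); apply: meval_eq => t.
  by rewrite /x' mulrC.
have qhom i e : q i e \is e.-homog := hp_homog (K := Cc) e (aff_eq F x i).
have qE i e y : (e < Ibound d)%N ->
    (q i e).@[y] = \sum_(m in degset N (Ibound d) e) lc j x' w i (bmnm m) * bmonv (y : 'I_N -> Cc) m.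
  move=> he; rewrite /lc hw.
  exact: (hp_meval (K := Cc) (aff_eq F x i : {mpoly Cc[N]}) y he).
have Ib1 : (1 < Ibound d)%N.
  apply: leq_trans (d2 (ilast k2)) _; apply: ltnW; exact: d_lt_Ibound.
have q1E i y : (q i 1%N).@[y] = \sum_t lc j x' w i U_(t)%MM * y t.
  rewrite qE //; exact: (sum_degset1 (K := Cc) (fun m => lc j x' w i m) y Ib1).
have [h hh] := good j x' x'j onx' (fun t => l@_U_(t)%MM) v
  (fun i => etrans (esym (q1E i v)) (Tv i)) (fun e => negP lv (introT eqP (etrans (linear_form_meval v hl) e))).
pose H : {mpoly C[N]} := \sum_t h t *: 'X_t.
have HE y : H.@[y] = \sum_t h t * y t.
  by rewrite raddf_sum /=; apply: eq_bigr => t _; rewrite mevalZ mevalXU.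
have Hhom : H \is 1.-homog.
  by apply: rpred_sum => t _; apply: rpredZ; rewrite dhomogX; apply/eqP/mdeg1.
pose r := (card_I d).+1.
pose IJ := [set ij : 'I_k * 'I_(Ibound d) | inI d ij.1 ij.2].
(* Index 0 carries l, and the others enumerate I. *)
pose g (a : 'I_r) : {mpoly C[N]} :=
  if unlift ord0 a is Some b then let ij := enum_val (b : 'I_#|IJ|) in q ij.1 ij.2 else l.
pose e (a : 'I_r) : nat :=
  if unlift ord0 a is Some b then let ij := enum_val (b : 'I_#|IJ|) in ij.2 : nat else 1%N.
have bI i s : inI d i s -> (s < Ibound d)%N.
  by case/and3P=> _ sd _; apply: leq_ltn_trans sd (d_lt_Ibound d i).
have gP p : (exists a, p = g a) <-> (p = l \/ exists i s, inI d i s /\ p = q i s).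
  split=> [[a ->]|[->|[i [s [his ->]]]]].
  - rewrite /g; case: unlift => [b|]; last by left.
    right; exists (enum_val (b : 'I_#|IJ|)).1, (enum_val (b : 'I_#|IJ|)).2; split=> //.
    by have := enum_valP (b : 'I_#|IJ|); rewrite inE.
  - by exists ord0; rewrite /g unlift_none.
  have mem : (i, Ordinal (bI i s his)) \in IJ by rewrite inE.
  by exists (lift ord0 (enum_rank_in mem (i, Ordinal (bI i s his)))); rewrite /g liftK enum_rankK_in.
have -> : (fun p => p = l \/ exists i s, inI d i s /\ p = hpart s (aff_eq F x i)) =
    (fun p => exists a, p = g a).
  by apply: boolp.funext => p; apply: boolp.propext; rewrite gP.
have cN := card_IE k2 d2 dmono; rewrite -NE in cN.
split; first by rewrite -cN addn2.
have -> : (N - (card_I d).+1 = 1)%N by rewrite -cN addn2 subSS subSnn.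
apply: (complete_intersection_dim1 (e := e) (h := H)) => //.
- by rewrite -cN addn2.
- rewrite /e => a; case: unlift => // b.
  by have := enum_valP (b : 'I_#|IJ|); rewrite inE => /and3P [].
- by rewrite /g /e => a; case: unlift => [b|//].
move=> y hy Hy; apply: hh => [i|b||].
- by have [] := (iffRL (gP (q i 1%N)) _); [right; exists i, 1%N; split=> //; apply: inI1|move=> a ea; rewrite -q1E ea hy].
- have bL := mem_tnth b (in_tuple (quadric_blocks d ++ high_blocks d)).
  move: (tnth _ _) bL => [i s] /= bL.
  have his : inI d i s.
    by move: bL; rewrite mem_cat !mem_filter /= => /orP [] /andP [] /andP [].
  have [|a ea] := iffRL (gP (q i s)); first by right; exists i, s.
  apply: etrans (esym (qE i s y (bI i s his))) _.
  exact: etrans (congr1 (meval y) ea) (hy a).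
- have [|a ea] := iffRL (gP l); first by left.
  by rewrite -(linear_form_meval y hl) ea hy.
by rewrite -HE.
Qed.
End Regularity.

(** * The generic member and the open set *)

Section GenericMember.
Variables (k : nat) (d : 'I_k -> nat).
Hypothesis k2 : (2 <= k)%N.
Hypothesis d2 : forall i, (2 <= d i)%N.
Hypothesis dmono : forall i j : 'I_k, (i <= j)%N -> (d i <= d j)%N.
Variable N : nat.
Local Notation bd := (Ibound d).
Local Notation nc := (ncidx N bd d).

Let bd3 : (2 < bd)%N.
Proof. by apply: leq_ltn_trans (d2 (ilast k2)) (d_lt_Ibound d _). Qed.

Lemma generic_nonsingular (w : 'I_nc -> Cc) : rk [::] (codom w) = nc ->
  nonsingular_ci (system (K := Cc) w : 'I_k -> {mpoly C[N.+1]}).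
Proof.
move=> wgen x x0 onx; set j := chart_idx x.
have xj : x j != 0 := chart_idx_neq0 x0.
pose x' t : Cc := (x j)^-1 * x t.
have x'j : x' j = 1 by rewrite /x' mulVf.
have onx' i : (system (K := Cc) w i).@[x'] = 0.
  by have := on_V_scale ((x j)^-1) (fun i => system_homog (K := Cc) w i) onx i.
apply/eqP; rewrite -[_ == _]/(row_free _) -kermx_eq0.
apply/rowV0P => u /sub_kermxP hu; apply/rowP => i; rewrite mxE.
(* Partial derivatives are forms of degree d_i - 1, so passing to the point scaled to x_j = 1
   multiplies the i-th entry of a Jacobian relation by this power. *)
suff /eqP : u 0 i * x j ^+ (d i).-1 = 0.
  by rewrite mulf_eq0 expf_eq0 (negPf xj) andbF orbF => /eqP.
have part := blocks_partition k2 d2 dmono.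
apply: (generic_smooth Cc_char0 Cc_uncountable bd3 (d_lt_Ibound d) x'j onx' wgen part
  (mu := fun i => u 0 i * x j ^+ (d i).-1)) => s.
have := congr1 (fun A : 'rV_N.+1 => A 0 (lift j s)) hu; rewrite !mxE => e.
rewrite -[RHS]e; apply: eq_bigr => i' _; rewrite mxE -mulrA; congr (_ * _).
rewrite /lc loc_linear_part -(homog_meval (K := Cc)).
  by apply: meval_eq => t; rewrite /x' mulrA divff // mul1r.
by apply: mderiv_homog; rewrite prednK ?system_homog // ltnW.
Qed.

Hypothesis NM : N = (Mdim d + k)%N.
Hypothesis HM : (3 * k + 4 <= Mdim d)%N.

Lemma generic_good_charts (w : 'I_nc -> Cc) : rk [::] (codom w) = nc ->
  good_charts (quadric_blocks d ++ high_blocks d) w.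
Proof.
move=> wgen j x xj onx l v Tv lv.
have part := blocks_partition k2 d2 dmono.
have szL : (size (quadric_blocks d) + size (high_blocks d) = Mdim d - 2)%N.
  have := size_index_blocks k2 d2 dmono; rewrite /Mdim.
  by move: (\sum_i d i)%N (size _) (size _) => a b c; lia.
have deg2 b : b \in quadric_blocks d -> b.2 = 2%N.
  by rewrite mem_filter => /andP [/andP [_ /eqP]].
have deg3 b : b \in high_blocks d -> (2 < b.2 < bd)%N.
  rewrite mem_filter mem_all_blocks => /andP [/andP [_ ->] h].
  exact: leq_ltn_trans h (d_lt_Ibound d _).
have [|h hh] := generic_hyperplane Cc_char0 Cc_uncountable bd3 (d_lt_Ibound d) xj onx wgen part
  (size_quadric_blocks d) deg2 deg3 k2 NM HM szL Tv (l := l).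
  exact/eqP.
exists h => y h1 h2; apply: hh => // b bL.
have [i ->] : exists i : 'I_(size (quadric_blocks d ++ high_blocks d)), b = tnth (in_tuple _) i.
  by have /tnthP [i ->] : b \in in_tuple (quadric_blocks d ++ high_blocks d) by []; exists i.
exact: h2.
Qed.

(** Taking w generic over the coefficients of s gives s(w) nonzero as well as independent
    coefficients. Since [good_charts] holds at w, the alternative that it fails wherever s is
    nonzero is excluded, and w itself is a member of the open set. *)
Lemma exists_regular_open : exists S : {mpoly C[ncoef N d]} -> Prop,
  (exists F : 'I_k -> {mpoly C[N.+1]}, in_family d F /\ in_open S F) /\
  (forall F : 'I_k -> {mpoly C[N.+1]}, in_family d F -> in_open S F -> regular d F).
Proof.
pose L := quadric_blocks d ++ high_blocks d.
have [s s0 hs] := definable_generic (@good_charts_definable Cc N k bd d L).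
have [w hw] := exists_generic Cc_char0 Cc_uncountable [seq s@_m | m <- msupp s] nc.
have wgen : rk [::] (codom w) = nc.
  apply/eqP; rewrite eqn_leq; apply/andP; split.
    by apply: leq_trans (rk_size _ _) _; rewrite size_codom card_ord.
  by rewrite -{1}hw; apply: rk_anti.
have sw : s.@[w] != 0.
  apply: contraNneq s0 => e; apply/eqP; apply: (rk_full_free Cc_char0 hw) e => m.
  have [ms|ms] := boolP (m \in msupp s); first exact/cl_mem/map_f.
  by rewrite memN_msupp_eq0 //; apply: cl0.
have good v : s.@[v] != 0 -> good_charts L v.
  by case: hs => [|h]; [apply|case: (h w sw (generic_good_charts wgen))].
pose c (q : 'I_nc) : 'I_(ncoef N d) := enum_rank (val (enum_val q) : coef_idx N d).
(* The polynomial s on the larger parameter space, reading only the coefficients of degree d_i. *)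
pose s' : {mpoly C[ncoef N d]} := s \mPo [tuple 'X_(c q) | q < nc].
pose wF (F : 'I_k -> {mpoly C[N.+1]}) (q : 'I_nc) : Cc := coefs F (c q).
have s'E F : s'.@[coefs F] = s.@[wF F].
  rewrite (comp_mpoly_meval (R := Cc)); apply: meval_eq => q.
  by rewrite tnth_mktuple mevalXU.
have wFE F i : in_family d F -> system (wF F) i = F i.
  case=> hF _; apply: (system_of (K := Cc)) => // p; first exact: d_lt_Ibound.
  by rewrite /wF /coefs /c !enum_rankK.
exists (eq s'); split.
  exists (system w); split.
    by split; [apply: system_homog|apply: generic_nonsingular].
  exists s'; split=> //; rewrite s'E; suff -> : wF (system w) = w by [].
  apply: boolp.funext => q; rewrite /wF /coefs /c enum_rankK.
  by rewrite (system_coef (K := Cc)) enum_valK.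
move=> F hF [_ [<- hs']]; have NE : N = (\sum_i d i)%N.
  have h : (k <= \sum_i d i)%N.
    by rewrite -[X in (X <= _)%N](card_ord k) -sum1_card; apply: leq_sum => i _; apply: ltnW.
  by rewrite NM /Mdim subnK.
apply: (regular_of_good_charts k2 d2 dmono NE hF.1 (fun i => wFE F i hF)).
by apply: good; rewrite -s'E.
Qed.
End GenericMember.
Theorem theorem7 (k : nat) (d : 'I_k -> nat) :
  (2 <= k)%N ->
  (forall i, 2 <= d i)%N ->
  (forall i j : 'I_k, (i <= j)%N -> (d i <= d j)%N) ->
  (3 * k + 4 <= Mdim d)%N ->
  exists S : {mpoly C[ncoef (Mdim d + k) d]} -> Prop,
    (exists F : 'I_k -> {mpoly C[(Mdim d + k).+1]},
        in_family d F /\ in_open S F) /\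
    (forall F : 'I_k -> {mpoly C[(Mdim d + k).+1]},
        in_family d F -> in_open S F -> regular d F).
Proof. by move=> k2 d2 dmono HM; apply: exists_regular_open. Qed.
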